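(* Let $\varepsilon=(\varepsilon_j)_{j\in\Gamma}$ be a summable family of nonnegative real numbers. 1. For every $m\geq 1$ and $t>0$, the operator $H_t$ is continuous from $S_m(\mathcal B,\varepsilon)$ to $S_{m-1}(\mathcal B,\varepsilon)$; for every $m\geq 2$, the operator $\Delta$ is continuous from $S_m(\mathcal B,\varepsilon)$ to $S_{m-2}(\mathcal B,\varepsilon)$. 2. For every $m\geq 3$, $H_t$ and $\Delta$ commute: for all $F\in S_m(\mathcal B,\varepsilon)$, $\Delta H_tF=H_t\Delta F\in S_{m-3}(\mathcal B,\varepsilon)$. 3. Let $m\geq 6$ and $F\in S_m(\mathcal B,\varepsilon)$. The map $t\mapsto H_tF$ is $C^1$ from $[0,+\infty[$ to $S_{m-6}(\mathcal B,\varepsilon)$ and its derivative is $t\mapsto\frac12 H_t\Delta F$.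
   Context: Wiener space. $H$ is a real, separable, infinite dimensional Hilbert space with scalar product $\langle\cdot,\cdot\rangle$ and norm $|\cdot|$; $B$ is the Banach space obtained by completing $H$ for a measurable norm (in the sense of Gross), and $H$ is identified with its dual, so that $B'\subset H\subset B$. For $h>0$, $\mu_{B,h}$ is the Gaussian probability measure of variance $h$ on the Borel $\sigma$-algebra of $B$: for $y_1,\dots,y_n\in B'$ orthonormal in $H$, the image of $\mu_{B,h}$ under $x\mapsto (y_1(x),\dots,y_n(x))$ is $(2\pi h)^{-n/2}e^{-|v|^2/(2h)}dv$ on $\mathbb R^n$. For $a\in H$, $\ell_a\in L^2(B,\mu_{B,h})$ is the image of $a$ under the continuous extension to $H$ of the map $B'\ni y\mapsto y(\cdot)$. $\mathcal F(H)$ is the set of finite dimensional subspaces of $H$; for $E\in\mathcal F(H)$ with orthonormal basis $(w_1,\dots,w_n)$, $\pi_E$ is the orthogonal projection onto $E$ and $\tilde\pi_E(x)=\sum_j\ell_{w_j}(x)w_j$ for $x\in B$. A Borel function $f$ on $H$ admits $\tilde f$ as a stochastic extension in $L^p(B,\mu_{B,h})$ if, for every increasing sequence $(E_n)$ in $\mathcal F(H)$ with dense union in $H$, $f\circ\tilde\pi_{E_n}\in L^p(B,\mu_{B,h})$ and $f\circ\tilde\pi_{E_n}\to\tilde f$ in $L^p(B,\mu_{B,h})$. All this is used likewise for $(H^2,B^2,\mu_{B^2,h})$. Symbol classes. $\mathcal B=(e_j)_{j\in\Gamma}$ is a Hilbert basis of $H$ ($\Gamma$ countable) with all $e_j\in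 B'$; $u_j=(e_j,0)$, $v_j=(0,e_j)$. For $m\in\mathbb N$, $M\ge0$ and a family $\varepsilon=(\varepsilon_j)_{j\in\Gamma}$ of nonnegative reals, $S_m(\mathcal B,M,\varepsilon)$ is the set of bounded continuous $F:H^2\to\mathbb C$ such that for every pair of finitely supported multi-indices $(\alpha,\beta)$ with $0\le\alpha_j,\beta_j\le m$ for all $j$, the derivative $\prod_{j}\partial_{u_j}^{\alpha_j}\partial_{v_j}^{\beta_j}F$ exists, is continuous on $H^2$ and is bounded in modulus by $M\prod_j\varepsilon_j^{\alpha_j+\beta_j}$. $S_m(\mathcal B,\varepsilon)=\bigcup_{M\ge0}S_m(\mathcal B,M,\varepsilon)$, normed by $\|F\|_{m,\varepsilon}=\inf\{M\ge0: F\in S_m(\mathcal B,M,\varepsilon)\}$. Operators. $\Delta F=\sum_{j\in\Gamma}\left(\partial_{u_j}^2+\partial_{v_j}^2\right)F$ for $F\in S_m(\mathcal B,\varepsilon)$, $m\ge2$. For $t>0$ and $F$ on $H^2$ admitting a stochastic extension $\tilde F$ in some $L^p(B^2,\mu_{B^2,t})$, $p\in[1,\infty[$ (this holds for $F\in S_m(\mathcal B,\varepsilon)$, $m\ge1$, $\varepsilon$ summable), $(H_tF)(X)=\int_{B^2}\tilde F(X+Y)\,d\mu_{B^2,t}(Y)$ for $X\in H^2$. $H_0$ is the identity. *)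

(* Defs.v *)
From HB Require Import structures.
From mathcomp Require Import all_boot all_order all_algebra finmap.
From mathcomp Require Import complex.
From mathcomp Require Import all_classical all_reals all_analysis.

Set Implicit Arguments.
Unset Strict Implicit.
Unset Printing Implicit Defensive.

Import Order.TTheory GRing.Theory Num.Theory.
Import numFieldNormedType.Exports.

Local Open Scope classical_set_scope.
Local Open Scope ring_scope.
Local Open Scope complex_scope.

Section InnerProduct.
Variables (R : realType) (H : normedModType R) (ip : H -> H -> R).

(* Compatibility with the norm of H gives positive definiteness. *)
Definition inner_product :=
  [/\ forall x y, ip x y = ip y x,
      forall y, scalar (ip^~ y) &
      forall x, ip x x = `|x| ^+ 2].

Definition linspan (A : set H) : set H :=
  [set x | exists n (c : 'I_n -> R) (v : 'I_n -> H),
     (forall i, A (v i)) /\ x = \sum_i c i *: v i].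

Definition separable := exists2 D : set H, countable D & dense D.

Definition infinite_dim := forall s : seq H, linspan [set` s] != [set: H].

Definition orthonormal_tuple n (w : n.-tuple H) :=
  forall i j, ip (tnth w i) (tnth w j) = (i == j)%:R.

Definition orthonormal_basis (E : set H) n (w : n.-tuple H) :=
  orthonormal_tuple w /\ E = linspan [set` w].

Definition hilbert_basis (J : eqType) (e : J -> H) :=
  (forall i j, ip (e i) (e j) = (i == j)%:R) /\ dense (linspan (range e)).

End InnerProduct.

Section GaussianRn.
Variable R : realType.

(* Lebesgue integral over R^n of a nonnegative function, as an iterated
   integral (Tonelli). *)
Fixpoint lebesgue_int n : (n.-tuple R -> \bar R) -> \bar R :=
  if n is n'.+1 then
    fun g => (\int[@lebesgue_measure R]_x
                lebesgue_int (fun v : n'.-tuple R => g [tuple of x :: v]))%E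
  else fun g => g [tuple].

Definition gauss_density n (h : R) (v : n.-tuple R) : R :=
  (2 * pi * h) `^ (- (n%:R / 2)) *
  expR (- (\sum_(i < n) tnth v i ^+ 2) / (2 * h)).

Definition gauss n (h : R) (A : set (n.-tuple R)) : \bar R :=
  lebesgue_int (fun v => (gauss_density h v * \1_A v)%:E).

End GaussianRn.

Section Wiener.
Variables (R : realType) (H B : normedModType R).
Variables (ip : H -> H -> R) (emb : H -> B).

(* Gross measurability of the norm x |-> `|emb x| on H: the Gaussian measure
   of variance 1 on a finite dimensional subspace F of H is transported from
   R^n by an orthonormal basis of F. *)
Definition measurable_norm :=
  forall eps : R, 0 < eps ->
  exists (n0 : nat) (w0 : n0.-tuple H), orthonormal_tuple ip w0 /\
  forall (n : nat) (w : n.-tuple H), orthonormal_tuple ip w ->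
    (forall i j, ip (tnth w0 i) (tnth w j) = 0) ->
    (gauss 1 [set v : n.-tuple R |
       (eps < `|emb (\sum_(i < n) tnth v i *: tnth w i)|)%R] < eps%:E)%E.

Definition borel (T : topologicalType) := g_sigma_algebraType (@open T).

(* y is the continuous linear form on B identified with b, an element of H. *)
Definition dual_elt (y : B -> R) (b : H) :=
  [/\ scalar y, continuous y & forall x, y (emb x) = ip b x].

Definition in_dual (b : H) := exists y, dual_elt y b.

Definition gaussian_measure (h : R) (mu : set B -> \bar R) :=
  forall n (y : 'I_n -> B -> R) (b : n.-tuple H),
    (forall i, dual_elt (y i) (tnth b i)) -> orthonormal_tuple ip b ->
    forall A : set (n.-tuple R), measurable A ->
      mu [set x | A [tuple y i x | i < n]] = gauss h A.

End Wiener.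

Section ComplexValued.
Variable R : realType.

Definition ccontinuous (T : topologicalType) (f : T -> R[i]) :=
  continuous (fun x => complex.Re (f x)) /\ continuous (fun x => complex.Im (f x)).

Section Lp.
Variables (d : measure_display) (T : measurableType d).
Variable mu : {measure set T -> \bar R}.

Definition cmeasurable (f : T -> R[i]) :=
  measurable_fun setT (fun x => complex.Re (f x)) /\
  measurable_fun setT (fun x => complex.Im (f x)).

Definition cLnorm (p : R) (f : T -> R[i]) : \bar R :=
  Lnorm mu p%:E (fun x => (Normc.normc (f x))%:E).

Definition cLfun (p : R) (f : T -> R[i]) :=
  cmeasurable f /\ (cLnorm p f < +oo)%E.

Definition cintegral (f : T -> R[i]) : R[i] :=
  (\int[mu]_x complex.Re (f x)) +i* (\int[mu]_x complex.Im (f x)).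

End Lp.

Section Derivative.
Variable V : normedModType R.

Definition cderivable (F : V -> R[i]) (v : V) := forall x,
  derivable (fun y => complex.Re (F y)) x v /\
  derivable (fun y => complex.Im (F y)) x v.

Definition cderive (v : V) (F : V -> R[i]) (x : V) : R[i] :=
  ('D_v (fun y => complex.Re (F y)) x) +i*
  ('D_v (fun y => complex.Im (F y)) x).

End Derivative.

(* Sum of an absolutely summable family. *)
Definition rsum (J : choiceType) (f : J -> R) : R :=
  fine (\esum_(j in setT) (Num.max (f j) 0)%:E) -
  fine (\esum_(j in setT) (Num.max (- f j) 0)%:E).

Definition csum (J : choiceType) (f : J -> R[i]) : R[i] :=
  (rsum (fun j => complex.Re (f j))) +i* (rsum (fun j => complex.Im (f j))).

End ComplexValued.

Section StochasticExtension.
Variables (R : realType) (H B : normedModType R).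
Variables (ip : H -> H -> R) (emb : H -> B).
Variable mu : {measure set (borel B) -> \bar R}.

(* l represents the value at a of the continuous extension to H of the map
   which sends an element of B' to its class in L^2(B, mu). *)
Definition is_ell (a : H) (l : borel B -> R) :=
  l \in Lfun mu 2%:E /\
  forall (y : nat -> B -> R) (b : nat -> H),
    (forall n, dual_elt ip emb (y n) (b n)) -> b @ \oo --> a ->
    Lnorm mu 2%:E (fun x => (y n x - l x)%:E) @[n --> \oo] --> (0 : \bar R)%E.

Definition ell (a : H) : borel B -> R := xget (cst 0) [set l | is_ell a l].

(* For w an orthonormal basis of E; up to a negligible set, this does not
   depend on w nor on the representatives of the classes ell (tnth w j). *)
Definition tpi n (w : n.-tuple H) (x : borel B) : H :=
  \sum_(j < n) ell (tnth w j) x *: tnth w j.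

Definition stoch_ext (p : R) (f : H -> R[i]) (ft : borel B -> R[i]) :=
  [/\ cmeasurable (f : borel H -> R[i]), cLfun mu p ft &
   forall (E : nat -> set H) (d : nat -> nat)
          (w : forall n, (d n).-tuple H),
     (forall n, orthonormal_basis ip (E n) (w n)) ->
     (forall n, E n `<=` E n.+1) -> dense (\bigcup_n E n) ->
     (forall n, cLfun mu p (f \o tpi (w n))) /\
     cLnorm mu p (fun x => f (tpi (w n) x) - ft x) @[n --> \oo]
       --> (0 : \bar R)%E].

(* Two stochastic extensions of f, possibly for different exponents, agree
   almost everywhere. *)
Definition the_stoch_ext (f : H -> R[i]) : borel B -> R[i] :=
  xget (cst 0) [set ft | exists2 p, 1 <= p & stoch_ext p f ft].

Definition heat_integral (f : H -> R[i]) (X : H) : R[i] :=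
  cintegral mu (fun Y : borel B => the_stoch_ext f (emb X + Y)).

End StochasticExtension.

(* The Wiener space (H^2, B^2). The library equips H * H with the sup norm,
   which is equivalent to the Hilbert norm attached to [ip2]; above, the norm
   of H is only used through its topology. *)
Section Square.
Variables (R : realType) (H B : normedModType R).
Variables (ip : H -> H -> R) (emb : H -> B).

Definition ip2 (X Y : H * H) : R := ip X.1 Y.1 + ip X.2 Y.2.

Definition emb2 (X : H * H) : B * B := (emb X.1, emb X.2).

Definition heat (mu : R -> probability (borel (B * B)%type) R)
    (t : R) (F : H * H -> R[i]) : H * H -> R[i] :=
  if t == 0 then F else heat_integral ip2 emb2 (mu t) F.

End Square.

Section Symbols.
Variables (R : realType) (H : normedModType R) (J : countType) (e : J -> H).

(* inl j stands for the direction u_j, inr j for v_j. *)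
Definition dir (k : J + J) : H * H :=
  match k with inl j => (e j, 0) | inr j => (0, e j) end.

Fixpoint derive_word (s : seq (J + J)) (F : H * H -> R[i]) : H * H -> R[i] :=
  if s is k :: s' then cderive (dir k) (derive_word s' F) else F.

Fixpoint derivable_word (s : seq (J + J)) (F : H * H -> R[i]) : Prop :=
  if s is k :: s' then
    derivable_word s' F /\ cderivable (derive_word s' F) (dir k)
  else True.

Local Notation mindex := {fsfun J -> nat with 0%N}.

(* s lists the factors of the differential operator of multi-index
   (alpha, beta) in some order. The product notation for this operator
   presupposes that the order is irrelevant, so the symbol classes consider
   all orders. *)
Definition word_of (s : seq (J + J)) (alpha beta : mindex) :=
  forall j, count_mem (inl j) s = alpha j /\ count_mem (inr j) s = beta j.

Variable eps : J -> R.

Definition symbol_bound (m : nat) (M : R) (F : H * H -> R[i]) :=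
  [/\ exists C, forall X, Normc.normc (F X) <= C,
      ccontinuous F &
      forall alpha beta : mindex,
        (forall j, alpha j <= m /\ beta j <= m)%N ->
        forall s, word_of s alpha beta ->
        [/\ derivable_word s F,
            ccontinuous (derive_word s F) &
            forall X, Normc.normc (derive_word s F X) <=
              M * \prod_(j <- (finsupp alpha `|` finsupp beta)%fset)
                    eps j ^+ (alpha j + beta j)]].

Definition symbol (m : nat) : set (H * H -> R[i]) :=
  [set F | exists2 M, 0 <= M & symbol_bound m M F].

Definition symbol_norm (m : nat) (F : H * H -> R[i]) : R :=
  inf [set M | 0 <= M /\ symbol_bound m M F].

Definition laplace (F : H * H -> R[i]) (X : H * H) : R[i] :=
  csum (fun j : J => derive_word [:: inl j; inl j] F X +
                     derive_word [:: inr j; inr j] F X).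

Definition continuous_operator (m k : nat)
    (T : (H * H -> R[i]) -> (H * H -> R[i])) :=
  (forall F, symbol m F -> symbol k (T F)) /\
  forall F0, symbol m F0 -> forall eta, 0 < eta ->
  exists2 delta, 0 < delta &
    forall F, symbol m F -> symbol_norm m (F \- F0) < delta ->
      symbol_norm k (T F \- T F0) < eta.

(* Differentiability and continuity of the derivative on [0, +oo[ for the
   norm of S_k, one-sided at 0. *)
Definition C1_halfline (k : nat) (c c' : R -> H * H -> R[i]) :=
  (forall t, 0 <= t -> symbol k (c t) /\ symbol k (c' t)) /\
  forall t, 0 <= t ->
    symbol_norm k (fun X => ((s - t)^-1)%:C * (c s X - c t X) - c' t X)
      @[s --> within [set s | 0 <= s] t^'] --> (0 : R) /\
    symbol_norm k (c' s \- c' t)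
      @[s --> within [set s | 0 <= s] (nbhs t)] --> (0 : R).

End Symbols.

(* Main.v *)
Require Import Defs.
From HB Require Import structures.
From mathcomp Require Import all_boot all_order all_algebra finmap.
From mathcomp Require Import complex.
From mathcomp Require Import all_classical all_reals all_analysis.
From mathcomp Require Import measurable_realfun ring lra.
Import Order.TTheory GRing.Theory Num.Theory.
Import numFieldNormedType.Exports.
Local Open Scope classical_set_scope.
Local Open Scope ring_scope.
Local Open Scope complex_scope.
Set Implicit Arguments.
Unset Strict Implicit.
Unset Printing Implicit Defensive.

(* Every symbol F is bounded and moves by at most D * sum_j w_j |z_j| under an
   increment z = sum_j z_j u_j, where w = eps is summable. Hence F (sum_(i < n) Y_i x u_i),
   with Y_i the coordinate linear forms on B * B, converges for almost every x, and
   its limit is the stochastic extension of F. As the Gaussian measure is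
   quasi-invariant under the shifts of H, this limit may be evaluated at emb X + x for
   almost every x, and H_t F (X) becomes the limit of n-fold one dimensional Gaussian
   averages of F along u_0, ..., u_(n-1). Such averages are linear, contract the
   sup norm and commute with translations, thus with derivatives: this gives the
   mapping properties and the commutation with Laplace. In dimension one, Stein's
   identity E[Z h(Z)] = E[h'(Z)] and a Taylor expansion show that an average of variance
   b differs from one of variance a by (b - a)/2 times the averaged second derivative,
   up to (b - a)^2 times a bound of the fourth derivative; telescoping over the
   coordinates gives the differentiability in t with constants sum_j w_j ^ 2.

   Quasi-invariance is proved on cylinders, which by Hahn-Banach and the Riesz
   representation generate the Borel sets of the separable space B * B. *)

(** * Directional derivatives *)

(** Symbols have derivatives along the basis directions only. One order of differentiation is
    therefore exchanged for Lipschitz bounds ([rsymb_rclass]), and this is the order lost by [H_t]: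
    any operator that is linear, contracts the sup norm and commutes with translations preserves the
    Lipschitz classes with the same constants. Derivatives cross such an operator because a
    quadratic Taylor remainder does.

    Means are parametrised by the standard deviation [b = Num.sqrt t]. Stein's identity puts a
    factor [b] into the derivative of a mean in [b], so every estimate is in terms of
    [b ^+ 2 - a ^+ 2], a difference of times, and the endpoint [t = 0] is not special.

    A stochastic extension is a representative picked by [xget], so its value at [emb X + x] is
    meaningful only if translations by [emb X] preserve null sets. The Gross condition enters there:
    it makes [emb] bounded, so [B] is separable and continuous linear forms on [B * B] are
    represented by elements of [H * H]. *)

Section DirectionalCalculus.
Variables (R : realType) (V : normedModType R).
Implicit Types (f g : V -> R) (u v x : V).

(** The difference quotients of [f] along [v] are those of its restriction to a line, so one
    dimensional calculus applies line by line. *)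
Lemma is_derive_line f v x (r : R) : derivable f (x + r *: v) v ->
  is_derive r 1 (fun s : R => f (x + s *: v)) ('D_v f (x + r *: v)).
Proof.
have E : (fun h : R => h^-1 *: (((fun s : R => f (x + s *: v)) \o shift r) (h *: 1) -
    f (x + r *: v))) =
  (fun h : R => h^-1 *: ((f \o shift (x + r *: v)) (h *: v) - f (x + r *: v))).
  apply/funext => h /=; congr (_ *: (f _ - _)).
  by rewrite [h *: 1]mulr1 scalerDl addrCA.
move=> df; apply: DeriveDef; rewrite /derivable /derive E //.
Qed.

Lemma dir_mvt f v x (h : R) : (forall y, derivable f y v) ->
  exists2 c : R, `|c| <= `|h| & f (x + h *: v) - f x = h * 'D_v f (x + c *: v).
Proof.
move=> df; pose F (r : R) := f (x + r *: v).
have dF (r : R) : is_derive r 1 F ('D_v f (x + r *: v)) by exact: is_derive_line.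
have cF : continuous F.
  by move=> r; apply: differentiable_continuous; apply/derivable1_diffP; case: (dF r).
have [h0|h0] := leP 0 h.
  have [c] := MVT_segment h0 (fun (r : R) _ => dF r) (continuous_subspaceT cF).
  rewrite /F in_itv /= scale0r addr0 subr0 => /andP[c0 ch] ->.
  by exists c; [rewrite !ger0_norm | rewrite mulrC].
have [c] := MVT_segment (ltW h0) (fun (r : R) _ => dF r) (continuous_subspaceT cF).
rewrite /F in_itv /= scale0r addr0 sub0r mulrN => /andP[ch c0] E.
exists c; first by rewrite !ler0_norm ?lerN2 // ltW.
by rewrite -opprB E opprK mulrC.
Qed.

Lemma dir_lipschitz f v K : (forall y, derivable f y v) ->
  (forall y, `|'D_v f y| <= K) -> forall x h, `|f (x + h *: v) - f x| <= K * `|h|.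
Proof.
move=> df dK x h; have [c _ ->] := dir_mvt x h df.
by rewrite normrM mulrC ler_wpM2r.
Qed.

(** A Lipschitz bound for the derivative along the line stands in for a second derivative. Using the
    mean value point instead of an integral remainder gives [L] rather than [L / 2]. *)
Lemma dir_taylor f v L : (forall y, derivable f y v) ->
  (forall y r, `|'D_v f (y + r *: v) - 'D_v f y| <= L * `|r|) ->
  forall x h, `|f (x + h *: v) - f x - h * 'D_v f x| <= L * h ^+ 2.
Proof.
move=> df dL x h; have [c ch ->] := dir_mvt x h df.
rewrite -mulrBr normrM -real_normK ?num_real // expr2 mulrCA ler_wpM2l //.
apply: (le_trans (dL _ _)); apply: ler_wpM2l => //.
by have := le_trans (normr_ge0 _) (dL x 1); rewrite normr1 mulr1.
Qed.

(** Converse of [dir_taylor]. Such a remainder bound, unlike a limit of difference quotients, passes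
    through any average, which is how derivatives are moved across averages below. *)
Lemma derive_quadratic f v x l C :
  (forall h : R, `|f (x + h *: v) - f x - h * l| <= C * h ^+ 2) ->
  derivable f x v /\ 'D_v f x = l.
Proof.
move=> H.
suff cv : h^-1 *: ((f \o shift x) (h *: v) - f x) @[h --> 0^'] --> l.
  by split; [apply/cvg_ex; exists l | exact: cvg_lim cv].
have C0 : 0 <= C.
  by have := le_trans (normr_ge0 _) (H 1); rewrite expr1n mulr1.
apply/cvgrPdist_le => /= e e0.
near=> h.
have h0 : h != 0 by near: h; exact: nbhs_dnbhs_neq.
rewrite distrC [h *: v + x]addrC.
have -> : h^-1 *: (f (x + h *: v) - f x) - l =
    h^-1 * (f (x + h *: v) - f x - h * l).
  by rewrite mulrBr mulKf.
rewrite normrM normfV ler_pdivrMl ?normr_gt0 //.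
apply: le_trans (H h) _; rewrite -real_normK ?num_real // expr2 mulrCA ler_wpM2l //.
have : `|h| <= e / (C + 1).
  near: h; apply: dnbhs0_le; apply: divr_gt0 => //; exact: ltr_wpDl.
rewrite ler_pdivlMr ?ltr_wpDl //; apply: le_trans.
by rewrite mulrC; apply: ler_wpM2l => //; rewrite lerDl.
Unshelve. all: by end_near.
Qed.

(** Termwise differentiation. The mean value inequality for [F n \- F N], with [n] sent to infinity,
    makes the difference quotients of [f] and of one fixed [F N] differ by at most [e / 2],
    uniformly in [h]. *)
Lemma dir_derive_limit (F : nat -> V -> R) f g v :
  (forall n x, derivable (F n) x v) ->
  (forall x, F n x @[n --> \oo] --> f x) ->
  (forall e, 0 < e -> \forall n \near \oo, forall x, `|'D_v (F n) x - g x| <= e) ->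
  forall x, derivable f x v /\ 'D_v f x = g x.
Proof.
move=> dF Ff Dg x.
suff cv : h^-1 *: ((f \o shift x) (h *: v) - f x) @[h --> 0^'] --> g x.
  by split; [apply/cvg_ex; exists (g x) | exact: cvg_lim cv].
apply/cvgrPdist_le => /= e e0.
have e4 : 0 < e / 4 by rewrite divr_gt0.
have [N _ DN] := Dg _ e4.
have Dq h : `|(f (x + h *: v) - f x) - (F N (x + h *: v) - F N x)| <= e / 2 * `|h|.
  have cq : ((F n (x + h *: v) - F n x) - (F N (x + h *: v) - F N x)) @[n --> \oo] -->
      ((f (x + h *: v) - f x) - (F N (x + h *: v) - F N x)).
    by apply: cvgB; [exact: cvgB | exact: cvg_cst].
  rewrite -(cvg_lim _ (cvg_norm cq)) //.
  apply: limr_le; first by apply/cvg_ex; eexists; exact: cvg_norm cq.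
  near=> n; have nN : (N <= n)%N by near: n; exists N.
  have dB y : derivable (F n \- F N) y v by exact: derivableB.
  have -> : F n (x + h *: v) - F n x - (F N (x + h *: v) - F N x) =
     (F n \- F N) (x + h *: v) - (F n \- F N) x by rewrite /=; ring.
  apply: dir_lipschitz => // y.
  rewrite deriveB //.
  have := DN _ nN y; have := DN _ (leqnn N) y.
  have -> : 'D_v (F n) y - 'D_v (F N) y =
     ('D_v (F n) y - g y) - ('D_v (F N) y - g y) by ring.
  move=> A B; apply: le_trans (ler_normB _ _) _; lra.
have /cvgrPdist_le /(_ _ e4) cN :
    h^-1 *: ((F N \o shift x) (h *: v) - F N x) @[h --> 0^'] --> 'D_v (F N) x.
  exact: dF.
near=> h.
have h0 : h != 0 by near: h; exact: nbhs_dnbhs_neq.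
have A : `|'D_v (F N) x - h^-1 *: ((F N \o shift x) (h *: v) - F N x)| <= e / 4.
  by near: h.
have B := DN _ (leqnn N) x.
have : `|h^-1 *: ((f (x + h *: v) - f x) - (F N (x + h *: v) - F N x))| <= e / 2.
  by rewrite normrZ normfV ler_pdivrMl ?normr_gt0 // mulrC.
move: A B; rewrite /= [h *: v + x]addrC /GRing.scale /=.
rewrite [X in _ -> _ -> `|X| <= _ -> _]mulrBr.
set a := h^-1 * (f _ - f x); set b := h^-1 * _; set c := 'D_v _ _.
move=> A B C.
have -> : g x - a = (c - b) - (c - g x) - (a - b) by ring.
apply: le_trans (ler_normB _ _) _.
apply: le_trans (lerD (ler_normB _ _) (lexx _)) _; lra.
Unshelve. all: by end_near.
Qed.

End DirectionalCalculus.

(** * Bounded integrals and the normal law *)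

Section BoundedIntegral.
Variables (R : realType) (d : measure_display) (T : measurableType d).
Variable P : probability T R.
Implicit Types f g : T -> R.

Lemma bounded_integrable f C : measurable_fun setT f -> (forall x, `|f x| <= C) ->
  P.-integrable setT (EFin \o f).
Proof.
move=> mf fC; apply: measurable_bounded_integrable => //.
  by have : (P setT < +oo)%E by rewrite probability_setT ltry.
exists C; split; first exact: num_real.
by move=> x Cx y _; apply: le_trans (fC y) (ltW Cx).
Qed.

Lemma Rintegral_norm_le f C : measurable_fun setT f -> (forall x, `|f x| <= C) ->
  `|\int[P]_x f x| <= C.
Proof.
move=> mf fC; have If := bounded_integrable mf fC.
apply: le_trans (le_normr_Rintegral _ If) _ => //.
have -> : C = \int[P]_x C by rewrite Rintegral_cst // [fine _](_ : _ = 1) ?mulr1 // -[RHS]/(fine 1%E) -(@probability_setT _ _ _ P).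
apply: le_Rintegral => //.
  exact: integrable_norm.
by apply: (@bounded_integrable _ `|C|); [exact: measurable_cst | move=> _].
Qed.

Lemma Rintegral_prob_cst (C : R) : \int[P]_x C = C.
Proof. by rewrite Rintegral_cst // [fine _](_ : _ = 1) ?mulr1 // -[RHS]/(fine 1%E) -(@probability_setT _ _ _ P). Qed.

Lemma bounded_cvg_Rintegral (F : nat -> T -> R) f C :
  (forall n, measurable_fun setT (F n)) -> measurable_fun setT f ->
  (forall n x, `|F n x| <= C) ->
  {ae P, forall x, F n x @[n --> \oo] --> f x} ->
  \int[P]_x F n x @[n --> \oo] --> \int[P]_x f x.
Proof.
move=> mF mf FC Ff.
have [|||||] := @dominated_convergence _ _ _ P setT measurableT
  (fun n => EFin \o F n) (EFin \o f) (cst C%:E).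
- by move=> n; exact/measurable_EFinP.
- exact/measurable_EFinP.
- by apply: filterS Ff => x Ff _; apply: cvg_EFin => //; exact: nearW.
- by apply: (@bounded_integrable _ `|C|); [exact: measurable_cst | move=> _].
- by apply: aeW => x n _; rewrite /= lee_fin.
move=> If _ cv; apply: fine_cvg; rewrite fineK //.
exact: integrable_fin_num.
Qed.

Lemma EFin_integrableB f g : P.-integrable setT (EFin \o f) ->
  P.-integrable setT (EFin \o g) -> P.-integrable setT (EFin \o (fun x => f x - g x)).
Proof.
move=> If Ig; rewrite (_ : EFin \o _ = (EFin \o f) \- (EFin \o g))%E //.
exact: integrableB.
Qed.

Lemma EFin_integrableD f g : P.-integrable setT (EFin \o f) ->
  P.-integrable setT (EFin \o g) -> P.-integrable setT (EFin \o (fun x => f x + g x)).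
Proof.
move=> If Ig; rewrite (_ : EFin \o _ = (EFin \o f) \+ (EFin \o g))%E //.
exact: integrableD.
Qed.

Lemma EFin_integrableZ (c : R) f : P.-integrable setT (EFin \o f) ->
  P.-integrable setT (EFin \o (fun x => c * f x)).
Proof.
move=> If; rewrite (_ : EFin \o _ = (fun x => c%:E * (EFin \o f) x))%E //.
exact: integrableZl.
Qed.

End BoundedIntegral.

Section NormalLaw.
Variable R : realType.
Local Notation leb := (@lebesgue_measure R).

(** Change of variables holds for the Radon-Nikodym derivative; uniqueness of densities identifies
    it almost everywhere with [normal_pdf]. *)
Lemma normal_prob_ge0_integral (m s : R) (f : R -> \bar R) : s != 0 ->
  measurable_fun setT f -> (forall x, 0 <= f x)%E ->
  (\int[normal_prob m s]_x f x = \int[leb]_x (f x * (normal_pdf m s x)%:E))%E.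
Proof.
move=> s0 mf f0.
have dom := @normal_prob_dominates R m s.
rewrite -(Radon_Nikodym_SigmaFinite.change_of_variables dom) //.
apply: ae_eq_integral => //.
- apply: emeasurable_funM => //.
  by apply: (measurable_int leb); exact: Radon_Nikodym_SigmaFinite.f_integrable.
- apply: emeasurable_funM => //; apply/measurable_EFinP.
  exact: measurable_normal_pdf.
- apply: ae_eqe_mul2l; apply: integral_ae_eq => //.
  + exact: Radon_Nikodym_SigmaFinite.f_integrable.
  + by apply/measurable_EFinP; exact: measurable_normal_pdf.
  + by move=> A _ mA; rewrite -Radon_Nikodym_SigmaFinite.f_integral.
Qed.

Lemma normal_prob_integral (m s : R) (f : R -> R) : s != 0 ->
  (normal_prob m s).-integrable setT (EFin \o f) ->
  leb.-integrable setT (fun x => (f x * normal_pdf m s x)%:E) /\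
  \int[normal_prob m s]_x f x = \int[leb]_x (f x * normal_pdf m s x).
Proof.
move=> s0 /integrableP [mf fi].
have Ifn : leb.-integrable setT (fun x => (f x * normal_pdf m s x)%:E).
  apply/integrableP; split.
    apply/measurable_EFinP; apply: measurable_funM; last exact: measurable_normal_pdf.
    exact/measurable_EFinP.
  rewrite normal_prob_ge0_integral // in fi; last by apply: measurableT_comp.
  rewrite (le_lt_trans _ fi) //; apply: ge0_le_integral => //.
  - apply: measurableT_comp => //.
    apply/measurable_EFinP; apply: measurable_funM; last exact: measurable_normal_pdf.
    exact/measurable_EFinP.
  - apply: emeasurable_funM; first exact: measurableT_comp.
    by apply/measurable_EFinP; exact: measurable_normal_pdf.
  - by move=> x _ /=; rewrite lee_fin normrM [X in _ * X]ger0_norm // normal_pdf_ge0.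
split => //.
rewrite /Rintegral; congr fine.
rewrite [LHS]integralE [RHS]integralE.
have mE : measurable_fun setT f by exact/measurable_EFinP.
rewrite !normal_prob_ge0_integral //; first last.
- exact: measurable_funepos.
- exact: measurable_funeneg.
have p0 x : (0 <= (normal_pdf m s x)%:E)%E by rewrite lee_fin normal_pdf_ge0.
congr (_ - _)%E; apply: eq_integral => x _.
- by rewrite !funeposE (EFinM (f x)) maxe_pMl // mul0e.
- by rewrite !funenegE (EFinM (f x)) -mulNe maxe_pMl // mul0e.
Qed.

Local Notation gam := (normal_prob (0 : R) 1).
Local Notation p := (normal_pdf (0 : R) 1).

Let one0 : (1 : R) != 0. Proof. exact: oner_neq0. Qed.

Lemma std_normal_pdfE z : p z = normal_peak (1 : R) * expR (- (z ^+ 2 / 2)).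
Proof.
rewrite normal_pdfE // /normal_fun subr0 expr1n mulNr.
by congr (_ * expR (- (_ / _))).
Qed.

Lemma is_derive_std_normal_pdf (z : R) : is_derive z 1 p (- z * p z).
Proof.
rewrite (_ : p = fun z => normal_peak (1 : R) * expR (- (z ^+ 2 / 2))); last first.
  by apply/funext => y; exact: std_normal_pdfE.
apply: is_derive_eq.
by rewrite /GRing.scale /=; field.
Qed.

Lemma std_normal_integrable_sqr : gam.-integrable setT (EFin \o (fun z : R => z ^+ 2)).
Proof.
have m2 : measurable_fun setT (fun z : R => z ^+ 2) by exact: measurable_funX.
apply/integrableP; split; first exact/measurable_EFinP.
rewrite normal_prob_ge0_integral //; last first.
  by do 2 apply: measurableT_comp => //.
have s2 : Num.sqrt 2 != 0 :> R by rewrite gt_eqF // sqrtr_gt0.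
(* From [x ^+ 2 / 4 <= expR (x ^+ 2 / 4)], the product of [x ^+ 2] and the standard density is at
   most [c] times the normal density of variance 2, which is integrable. *)
pose c := 4 * normal_peak 1 / normal_peak (Num.sqrt 2) : R.
apply: (@le_lt_trans _ _ (\int[leb]_x (c * normal_pdf 0 (Num.sqrt 2) x)%:E)%E).
  apply: ge0_le_integral => //.
  - by move=> x _; apply: mule_ge0; [exact: abse_ge0 | rewrite lee_fin normal_pdf_ge0].
  - apply: emeasurable_funM; first by do 2 apply: measurableT_comp => //.
    by apply/measurable_EFinP; exact: measurable_normal_pdf.
  - apply/measurable_EFinP; apply: measurable_funM => //.
    exact: measurable_normal_pdf.
  - move=> x _ /=; rewrite lee_fin ger0_norm ?sqr_ge0 // std_normal_pdfE.
    rewrite normal_pdfE // /c /normal_fun subr0 sqr_sqrtr //.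
    have -> : (2 *+ 2 : R) = 4 by rewrite -mulr_natr -natrM.
    have -> : - x ^+ 2 / 4 = - (x ^+ 2 / 4) by rewrite mulNr.
    have k2 := normal_peak_gt0 s2; have k1 := normal_peak_gt0 one0.
    set k := normal_peak (Num.sqrt 2) in k2 *; set l := normal_peak 1 in k1 *.
    have -> : 4 * l / k * (k * expR (- (x ^+ 2 / 4))) = l * (4 * expR (- (x ^+ 2 / 4))).
      by field; exact: lt0r_neq0.
    rewrite mulrCA ler_pM2l //.
    have -> : expR (- (x ^+ 2 / 2)) = expR (- (x ^+ 2 / 4)) * expR (- (x ^+ 2 / 4)).
      by rewrite -expRD; congr expR; lra.
    rewrite mulrA ler_pM2r ?expR_gt0 // expRN ler_pdivrMr ?expR_gt0 //.
    have := expR_ge1Dx (x ^+ 2 / 4); lra.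
under eq_integral do rewrite EFinM.
rewrite integralZl //; last exact: integrable_normal_pdf.
by rewrite integral_normal_pdf mule1 ltry.
Qed.

Lemma std_normal_integrable_lin (h : R -> R) (C : R) : measurable_fun setT h ->
  (forall z, `|h z| <= C) -> gam.-integrable setT (EFin \o (fun z => z * h z)).
Proof.
move=> mh hC.
have I1 : gam.-integrable setT (EFin \o (fun z : R => C * (1 + z ^+ 2))).
  have -> : EFin \o (fun z : R => C * (1 + z ^+ 2)) =
     (fun z : R => C%:E * ((EFin \o cst (1 : R)%R) z + (EFin \o (fun z : R => (z ^+ 2)%R)) z))%E.
    by apply/funext => z /=.
  apply: integrableZl => //; apply: integrableD => //.
    by apply: (@bounded_integrable _ _ _ _ _ 1) => // z; rewrite normr1.
  exact: std_normal_integrable_sqr.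
apply: le_integrable I1 => //.
  by apply/measurable_EFinP; apply: measurable_funM.
move=> z _ /=; rewrite lee_fin normrM.
have C0 : 0 <= C := le_trans (normr_ge0 _) (hC 0).
rewrite mulrC [X in _ <= X]ger0_norm; last by rewrite mulr_ge0 // addr_ge0 // sqr_ge0.
apply: ler_pM => //.
rewrite -real_normK ?num_real //.
have := sqr_ge0 (`|z| - 1); rewrite sqrrB1; nra.
Qed.

(** Integration by parts: [F z = h z * p z] has derivative [(dh z - z * h z) * p z]. Its integral
    over a symmetric interval is a difference of boundary values, which tend to 0 as [p] decays and
    [h] is bounded. *)
Lemma stein_identity (h dh : R -> R) (C : R) : (forall z : R, is_derive z 1 h (dh z)) ->
  continuous dh -> (forall z, `|h z| <= C) -> (forall z, `|dh z| <= C) ->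
  \int[gam]_z (z * h z) = \int[gam]_z dh z.
Proof.
move=> Dh cdh hC dhC.
have ch : continuous h.
  by move=> z; apply: differentiable_continuous; apply/derivable1_diffP; case: (Dh z).
have mh : measurable_fun setT h by exact: continuous_measurable_fun.
have mdh : measurable_fun setT dh by exact: continuous_measurable_fun.
have [I1 E1] := normal_prob_integral one0 (std_normal_integrable_lin mh hC).
have [I2 E2] := normal_prob_integral one0 (bounded_integrable gam mdh dhC).
apply/eqP; rewrite eq_sym -subr_eq0 E1 E2 -RintegralB //.
pose f z := dh z * p z - z * h z * p z.
pose F z := h z * p z.
have DF (z : R) : is_derive z 1 F (f z).
  apply: is_derive_eq.
    by apply: is_deriveM; exact: is_derive_std_normal_pdf.
  by rewrite /f /GRing.scale /=; ring.
have cp : continuous p by exact: continuous_normal_pdf.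
have cf : continuous f.
  move=> z; apply: cvgB; first by apply: cvgM; [exact: cdh | exact: cp].
  by apply: cvgM; [apply: cvgM; [exact: cvg_id | exact: ch] | exact: cp].
have If : leb.-integrable setT (EFin \o f).
  rewrite (_ : EFin \o f = fun z => (dh z * p z)%:E - (z * h z * p z)%:E)%E //.
  exact: integrableB.
have mf : measurable_fun setT f by exact: continuous_measurable_fun.
have FTC n : (\int[leb]_(x in `[(- n.+1%:R)%R, n.+1%:R]) (f x)%:E)%E =
    (F n.+1%:R - F (- n.+1%:R))%:E.
  rewrite (@continuous_FTC2 _ f F) ?EFinB //.
  - by rewrite -subr_gt0 opprK -natrD ltr0n.
  - exact: continuous_subspaceT.
  - have cF : continuous F.
      by move=> z; apply: differentiable_continuous; apply/derivable1_diffP; case: (DF z).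
    split => [z _||]; first by case: (DF z).
      by apply: cvg_at_right_filter; exact: cF.
    by apply: cvg_at_left_filter; exact: cF.
  - by move=> z _; rewrite derive1E; case: (DF z).
have cv1 : (\int[leb]_(x in `[(- n.+1%:R)%R, n.+1%:R]) (f x)%:E)%E @[n --> \oo] -->
    (\int[leb]_x (f x)%:E)%E.
  have E n : (\int[leb]_(x in `[(- n.+1%:R)%R, n.+1%:R]) (f x)%:E)%E =
     (\int[leb]_x (((EFin \o f) \_ `[(- n.+1%:R)%R, n.+1%:R]) x))%E.
    by rewrite integral_mkcond.
  under eq_fun do rewrite E.
  have [] // := @dominated_convergence _ _ _ leb setT measurableT
    (fun n => (EFin \o f) \_ `[(- n.+1%:R)%R, n.+1%:R]) (EFin \o f) (abse \o (EFin \o f)).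
  - move=> n; apply: (measurable_restrictT _ _).1 => //.
    by apply/measurable_EFinP; exact: measurable_funTS.
  - exact/measurable_EFinP.
  - apply: aeW => x _; apply: cvg_near_cst.
    near=> n; rewrite /patch mem_set //= in_itv /= -ler_norml.
    apply: (@le_trans _ _ n%:R); last by rewrite ler_nat.
    by near: n; exact: nbhs_infty_ger.
  - exact: integrable_abse.
  - apply: aeW => x n _; rewrite /patch; case: ifP => _ //=.
    by rewrite lee_fin normr0.
have cv2 : (F n.+1%:R - F (- n.+1%:R)) @[n --> \oo] --> 0.
  apply/cvgrPdist_le => e e0; near=> n.
  rewrite sub0r normrN.
  (* A crude decay rate suffices: [expR (y ^+ 2 / 2) >= 1 + y ^+ 2 / 2 >= y / 2]. *)
  have pb (x : R) : `|x| = n.+1%:R -> `|F x| <= C * (normal_peak 1 * 2 / n.+1%:R).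
    move=> xn; rewrite normrM ler_pM // std_normal_pdfE ger0_norm; last first.
      by rewrite mulr_ge0 ?expR_ge0 // normal_peak_ge0.
    rewrite -mulrA ler_wpM2l ?normal_peak_ge0 // -real_normK ?num_real // xn.
    rewrite expRN -[X in _ <= X]invf_div lef_pV2 ?posrE ?expR_gt0 ?divr_gt0 ?ltr0n //.
    apply: le_trans (expR_ge1Dx _).
    have : (1 : R) <= n.+1%:R by rewrite ler1n.
    by rewrite expr2; set y := n.+1%:R; nra.
  apply: (le_trans (ler_normB _ _)).
  apply: (le_trans (lerD (pb _ _) (pb _ _))); rewrite ?normrN ?normr_nat //.
  have C0 : 0 <= C := le_trans (normr_ge0 _) (hC 0).
  have k0 := normal_peak_ge0 (1 : R).
  have -> : C * (normal_peak 1 * 2 / n.+1%:R) + C * (normal_peak 1 * 2 / n.+1%:R) =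
     C * normal_peak 1 * 4 / n.+1%:R by ring.
  rewrite ler_pdivrMr ?ltr0n // [e * _]mulrC -ler_pdivrMr //.
  apply: (@le_trans _ _ n%:R); last by rewrite ler_nat.
  by near: n; exact: nbhs_infty_ger.
have cv3 : (F n.+1%:R - F (- n.+1%:R))%:E @[n --> \oo] --> (0 : \bar R).
  by apply: cvg_EFin; [exact: nearW | exact: cv2].
rewrite /Rintegral.
have -> : (\int[leb]_x (f x)%:E = 0)%E.
  have cv5 : (\int[leb]_(x in `[(- n.+1%:R)%R, n.+1%:R]) (f x)%:E)%E @[n --> \oo] -->
      (0 : \bar R).
    by under eq_fun do rewrite FTC.
  exact: (cvg_unique _ cv1 cv5).
by [].
Unshelve. all: by end_near.
Qed.

Lemma mvt_between (f df : R -> R) (a b : R) : (forall x : R, is_derive x 1 f (df x)) ->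
  exists2 c, Num.min a b <= c <= Num.max a b & f b - f a = df c * (b - a).
Proof.
move=> Df.
have cf : continuous f.
  by move=> z; apply: differentiable_continuous; apply/derivable1_diffP; case: (Df z).
have [ab|ba] := leP a b.
  have [c] := MVT_segment ab (fun (r : R) _ => Df r) (continuous_subspaceT cf).
  by rewrite in_itv /= => H E; exists c.
have [c] := MVT_segment (ltW ba) (fun (r : R) _ => Df r) (continuous_subspaceT cf).
rewrite in_itv /= => H E; exists c => //.
by rewrite -opprB E; ring.
Qed.

(** The constant [C] serves integrability; the quantitative estimates below involve [K] alone. *)
Definition C2_bounded (f f2 : R -> R) (K : R) := exists (f1 : R -> R) (C : R),
  [/\ forall z : R, is_derive z 1 f (f1 z), forall z : R, is_derive z 1 f1 (f2 z),
      continuous f2, (forall z, `|f z| <= C /\ `|f1 z| <= C) & forall z, `|f2 z| <= K].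

(** The mean of [f] under the centred normal law of variance [b ^+ 2], written so that [b = 0] is
    allowed. *)
Definition gauss_mean (f : R -> R) (b : R) := \int[gam]_z f (b * z).

Lemma gauss_mean_le (f : R -> R) K b : continuous f -> (forall z, `|f z| <= K) ->
  `|gauss_mean f b| <= K.
Proof.
move=> cf fK; apply: Rintegral_norm_le => //.
apply: continuous_measurable_fun => z.
by apply: (cvg_comp (fun z => b * z) f); [apply: cvgM; [exact: cvg_cst | exact: cvg_id] | exact: cf].
Qed.

Lemma is_derive_scale (f df : R -> R) (b z : R) : (forall z : R, is_derive z 1 f (df z)) ->
  is_derive z 1 (fun z => f (b * z)) (b * df (b * z)).
Proof.
move=> Df; have Db : is_derive (b * z) 1 f (df (b * z)) by exact: Df.
apply: is_derive_eq.
by rewrite /GRing.scale /=; ring.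
Qed.

(** Differentiation under the integral gives the mean of [z * f1 (b * z)], which Stein's identity
    turns into [b] times the mean of [f2]. The factor [b] makes the mean a smooth function of the
    variance down to variance 0. *)
Lemma is_derive_gauss_mean (f f2 : R -> R) K (b : R) : C2_bounded f f2 K ->
  is_derive b 1 (gauss_mean f) (b * gauss_mean f2 b).
Proof.
move=> [f1 [C [D1 D2 cf2 fC f2K]]].
have cD g dg : (forall z : R, is_derive z 1 g (dg z)) -> continuous (g : R -> R).
  by move=> D z; apply: differentiable_continuous; apply/derivable1_diffP; case: (D z).
have cf := cD _ _ D1; have cf1 := cD _ _ D2.
have cs (g : R -> R) (c : R) : continuous g -> continuous (fun z => g (c * z)).
  move=> cg z; apply: (cvg_comp (fun z => c * z) g); last exact: cg.
  by apply: cvgM; [exact: cvg_cst | exact: cvg_id].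
have ms (g : R -> R) (c : R) : continuous g -> measurable_fun setT (fun z : R => g (c * z) : R).
  by move=> cg; apply: continuous_measurable_fun; exact: cs.
have stein : \int[gam]_z (z * f1 (b * z)) = b * gauss_mean f2 b.
  transitivity (\int[gam]_z (b * f2 (b * z))); last first.
    rewrite RintegralZl //; apply: (@bounded_integrable _ _ _ _ _ K) => //.
    exact: ms.
  apply: (@stein_identity (fun z => f1 (b * z)) (fun z => b * f2 (b * z)) (C + `|b| * K)).
  - by move=> z; exact: (@is_derive_scale f1 f2).
  - by move=> z; apply: cvgM; [exact: cvg_cst | exact: cs].
  - move=> z; apply: le_trans (fC _).2 _; rewrite lerDl mulr_ge0 //.
    exact: le_trans (normr_ge0 _) (f2K 0).
  - move=> z; rewrite normrM; apply: (@le_trans _ _ (`|b| * K)).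
      exact: ler_wpM2l.
    by rewrite lerDr; exact: le_trans (normr_ge0 _) (fC 0).1.
have K0 : 0 <= K := le_trans (normr_ge0 _) (f2K 0).
have taylor (x h : R) : `|f (x + h) - f x - h * f1 x| <= K * h ^+ 2.
  have df1 (y : R) : derivable f y 1 by case: (D1 y).
  have df2 (y : R) : derivable f1 y 1 by case: (D2 y).
  have dv (y : R) : 'D_1 f y = f1 y by case: (D1 y).
  have dv1 (y : R) : 'D_1 f1 y = f2 y by case: (D2 y).
  have := @dir_taylor _ _ f 1 K df1 _ x h; rewrite dv [h *: 1]mulr1; apply.
  move=> y r; rewrite !dv; apply: (dir_lipschitz df2) => z; rewrite dv1; exact: f2K.
set m2 := \int[gam]_z (z ^+ 2).
suff [d1 d2] : derivable (gauss_mean f) b 1 /\ 'D_1 (gauss_mean f) b = b * gauss_mean f2 b.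
  by apply: DeriveDef.
(* The pointwise remainder at the increment [h * z] is [K * (h * z) ^+ 2]; integrating it produces
   the second moment [m2]. *)
apply: (@derive_quadratic _ _ _ _ _ _ (K * m2)) => h.
rewrite [h *: 1]mulr1 -stein /gauss_mean.
have If (c : R) : gam.-integrable setT (EFin \o (fun z => f (c * z))).
  by apply: (@bounded_integrable _ _ _ _ _ C); [exact: ms | move=> z; case: (fC (c * z))].
have I1 : gam.-integrable setT (EFin \o (fun z => z * f1 (b * z))).
  by apply: (@std_normal_integrable_lin _ C); [exact: ms | move=> z; case: (fC (b * z))].
have I2 : gam.-integrable setT (EFin \o (fun z : R => h * (z * f1 (b * z)))).
  by apply: (integrableZl measurableT h I1).
have I3 : gam.-integrable setT (EFin \o (fun z : R => f ((b + h) * z) - f (b * z))).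
  exact: EFin_integrableB.
have I4 : gam.-integrable setT (EFin \o (fun z : R => K * h ^+ 2 * z ^+ 2)).
  by apply: (integrableZl measurableT _ std_normal_integrable_sqr).
rewrite -RintegralB // -RintegralZl // -RintegralB //.
have I5 : gam.-integrable setT
    (EFin \o (fun z : R => f ((b + h) * z) - f (b * z) - h * (z * f1 (b * z)))).
  exact: EFin_integrableB.
apply: (le_trans (le_normr_Rintegral _ I5)) => //.
rewrite [K * m2 * _]mulrAC -RintegralZl //; last exact: std_normal_integrable_sqr.
apply: le_Rintegral => //; first exact: integrable_norm.
move=> z _.
have := taylor (b * z) (h * z).
by rewrite exprMn !mulrA [(b + h) * z]mulrDl.
Qed.

(** The mean value point satisfies [c <= b + a], hence [c * |b - a| <= |b ^+ 2 - a ^+ 2|]. *)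
Lemma gauss_mean_lipschitz (f f2 : R -> R) K (a b : R) : 0 <= a -> 0 <= b ->
  C2_bounded f f2 K -> `|gauss_mean f b - gauss_mean f a| <= `|b ^+ 2 - a ^+ 2| * K.
Proof.
move=> a0 b0 H.
have [c /andP[c1 c2] ->] := mvt_between a b (fun b => is_derive_gauss_mean b H).
have gK : `|gauss_mean f2 c| <= K.
  by case: H => f1 [C [_ _ cf2 _ f2K]]; exact: gauss_mean_le.
have c0 : 0 <= c by apply: le_trans c1; rewrite le_min a0.
have cab : c <= b + a.
  by apply: (le_trans c2); rewrite ge_max lerDr lerDl a0 b0.
rewrite subr_sqr !normrM (ger0_norm c0) (ger0_norm (addr_ge0 b0 a0)).
have -> : c * `|gauss_mean f2 c| * `|b - a| = `|b - a| * (c * `|gauss_mean f2 c|) by ring.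
by rewrite -mulrA ler_wpM2l // ler_pM.
Qed.

Lemma gauss_mean_taylor (f f2 f4 : R -> R) (K K' a b : R) : 0 <= a -> 0 <= b ->
  C2_bounded f f2 K' -> C2_bounded f2 f4 K ->
  `|gauss_mean f b - gauss_mean f a - (b ^+ 2 - a ^+ 2) / 2 * gauss_mean f2 a| <=
     `|b ^+ 2 - a ^+ 2| ^+ 2 * K.
Proof.
move=> a0 b0 H H2; set A := gauss_mean f2 a.
(* Removing the part linear in the variance leaves the derivative [x * (gauss_mean f2 x - A)], where
   the second factor is small by the Lipschitz estimate for [f2]. *)
pose u x := gauss_mean f x - x ^+ 2 / 2 * A.
have Du (x : R) : is_derive x 1 u (x * (gauss_mean f2 x - A)).
  have Df := is_derive_gauss_mean x H.
  apply: is_derive_eq.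
  by rewrite /GRing.scale /=; field.
have [c /andP[c1 c2]] := mvt_between a b Du.
have -> : u b - u a = gauss_mean f b - gauss_mean f a - (b ^+ 2 - a ^+ 2) / 2 * A.
  by rewrite /u; ring.
move=> ->.
have K0 : 0 <= K by case: H2 => f1 [C [_ _ _ _ /(_ 0)]]; exact: le_trans.
have c0 : 0 <= c by apply: le_trans c1; rewrite le_min a0.
have cab : c <= b + a.
  by apply: (le_trans c2); rewrite ge_max lerDr lerDl a0 b0.
have L : `|gauss_mean f2 c - A| <= `|b ^+ 2 - a ^+ 2| * K.
  apply: (le_trans (gauss_mean_lipschitz a0 c0 H2)); apply: ler_wpM2r => //.
  have [ab|ba] := leP a b.
    move: c1 c2; rewrite (min_idPl ab) (max_idPr ab) => c1 c2.
    by rewrite !ger0_norm ?subr_ge0 ?lerB // ler_sqr ?nnegrE.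
  move: c1 c2; rewrite (min_idPr (ltW ba)) (max_idPl (ltW ba)) => c1 c2.
  rewrite !ler0_norm ?subr_le0 ?ler_sqr ?nnegrE ?lerN2 ?lerB // ?ler_sqr ?nnegrE //.
  exact: ltW.
rewrite !normrM (ger0_norm c0).
apply: (@le_trans _ _ ((b + a) * (`|b ^+ 2 - a ^+ 2| * K) * `|b - a|)).
  by apply: ler_wpM2r => //; apply: ler_pM.
rewrite [X in _ <= X ^+ 2 * _](_ : _ = `|b - a| * (b + a)); last first.
  by rewrite subr_sqr normrM (ger0_norm (addr_ge0 b0 a0)).
rewrite subr_sqr normrM (ger0_norm (addr_ge0 b0 a0)).
by rewrite le_eqVlt; apply/orP; left; apply/eqP; ring.
Qed.

End NormalLaw.

(** * Gaussian averages of weighted Lipschitz functions *)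

Lemma cvg_norm_le (R : realType) (F : nat -> R) (l c : R) : F n @[n --> \oo] --> l ->
  (forall n, `|F n| <= c) -> `|l| <= c.
Proof.
move=> Fl Fc; have cn : `|F n| @[n --> \oo] --> `|l|.
  by exact: cvg_norm.
rewrite -(cvg_lim _ cn) //; apply: limr_le; first by apply/cvg_ex; eexists; exact: cn.
exact: nearW.
Qed.

Section Averaging.
Variables (R : realType) (W : normedModType R) (K : eqType) (u : K -> W) (w : K -> R).
Hypothesis w_ge0 : forall k, 0 <= w k.
Implicit Types (f g : W -> R) (s : seq K).

Fixpoint dword s f : W -> R :=
  if s is k :: s' then fun x => 'D_(u k) (dword s' f) x else f.

Fixpoint derw s f : Prop :=
  if s is k :: s' then derw s' f /\ forall x, derivable (dword s' f) x (u k) else True.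

(** Only the multiplicity of each direction is bounded, as in the symbol classes; the length of the
    word is arbitrary. *)
Definition wle m s := forall k, (count_mem k s <= m)%N.

Definition wprod s := \prod_(k <- s) w k.

Lemma wprod_ge0 s : 0 <= wprod s.
Proof. exact: prodr_ge0. Qed.

Lemma dword_cat s1 s2 f : dword (s1 ++ s2) f = dword s1 (dword s2 f).
Proof. by elim: s1 => //= k s1 ->. Qed.

Lemma derw_cat s1 s2 f : derw (s1 ++ s2) f <-> derw s2 f /\ derw s1 (dword s2 f).
Proof.
elim: s1 => /= [|k s1 IH]; first by split=> [|[]].
rewrite dword_cat; split=> [[/IH[? ?] ?]//|[? [? ?]]]; split => //; exact/IH.
Qed.

Lemma wle_cons m k s : wle m (k :: s) -> wle m s.
Proof. by move=> H l; apply: leq_trans (H l); rewrite /= leq_addl. Qed.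

Lemma wle_cat m1 m2 s1 s2 : wle m1 s1 -> wle m2 s2 -> wle (m1 + m2) (s1 ++ s2).
Proof. by move=> H1 H2 k; rewrite count_cat leq_add. Qed.

Lemma wle_nil m : wle m [::]. Proof. by []. Qed.

Lemma wle_pair k : wle 2 [:: k; k].
Proof. by move=> l /=; case: (k == l). Qed.

Lemma wle_one k : wle 1 [:: k].
Proof. by move=> l /=; case: (k == l). Qed.

Lemma leq_wle m m' s : (m <= m')%N -> wle m s -> wle m' s.
Proof. by move=> mm H k; apply: leq_trans (H k) mm. Qed.

Lemma dwordD s (a : R) f g : derw s f -> derw s g ->
  derw s (fun x => a * f x + g x) /\
  dword s (fun x => a * f x + g x) = fun x => a * dword s f x + dword s g x.
Proof.
elim: s => [|k s IH] /=; first by split.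
move=> [df dkf] [dg dkg]; have [d E] := IH df dg.
have dZ x : derivable (fun x => a * dword s f x) x (u k) by exact: derivableZ.
split; first by rewrite E; split; [exact: d | move=> x; exact: (derivableD (dZ x) (dkg x))].
apply/funext => x; rewrite E (deriveD (dZ x) (dkg x)); congr (_ + _).
exact: (deriveZ a (dkf x)).
Qed.

(** The first clause handles arbitrary increments. The second records the gain [w k] in the
    direction [u k], which makes means over infinitely many directions converge. *)
Definition lipschitz_w (L : R) f :=
  (forall x y, `|f x - f y| <= L * `|x - y|) /\
  (forall k x h, `|f (x + h *: u k) - f x| <= L * w k * `|h|).

Definition BL f := exists C L : R, (forall x, `|f x| <= C) /\ lipschitz_w L f.

Lemma BL_cont f : BL f -> continuous f.
Proof.
move=> [C [L [_ [fL _]]]] x; apply/cvgrPdist_le => /= e e0.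
have L0 : 0 <= `|L| + 1 by rewrite addr_ge0.
have L1 : 0 < `|L| + 1 by rewrite ltr_wpDl.
near=> y; apply: (le_trans (fL _ _)).
apply: (@le_trans _ _ ((`|L| + 1) * `|x - y|)).
  by apply: ler_wpM2r => //; apply: le_trans (ler_norm _) _; rewrite lerDl.
rewrite mulrC -ler_pdivlMr //.
near: y; apply: cvgr_dist_le => //; exact: divr_gt0.
Unshelve. all: by end_near.
Qed.

Lemma lipschitz_wD a b L L' f g : lipschitz_w L f -> lipschitz_w L' g ->
  lipschitz_w (`|a| * L + `|b| * L') (fun x => a * f x + b * g x).
Proof.
move=> [f1 f2] [g1 g2]; split=> [x y|k x h].
  have -> : a * f x + b * g x - (a * f y + b * g y) =
     a * (f x - f y) + b * (g x - g y) by ring.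
  apply: (le_trans (ler_normD _ _)); rewrite !normrM mulrDl -!mulrA.
  by apply: lerD; apply: ler_wpM2l.
have -> : a * f (x + h *: u k) + b * g (x + h *: u k) - (a * f x + b * g x) =
     a * (f (x + h *: u k) - f x) + b * (g (x + h *: u k) - g x) by ring.
apply: (le_trans (ler_normD _ _)); rewrite !normrM !mulrDl -!mulrA.
by apply: lerD; apply: ler_wpM2l => //; rewrite mulrA.
Qed.

Lemma BL_lin a b f g : BL f -> BL g -> BL (fun x => a * f x + b * g x).
Proof.
move=> [C [L [fC fL]]] [C' [L' [gC gL]]].
exists (`|a| * C + `|b| * C'), (`|a| * L + `|b| * L'); split; last exact: lipschitz_wD.
move=> x; apply: (le_trans (ler_normD _ _)); rewrite !normrM.
by apply: lerD; apply: ler_wpM2l.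
Qed.

Lemma BL_sub f g : BL f -> BL g -> BL (fun x => f x - g x).
Proof.
move=> Bf Bg; have := BL_lin 1 (-1) Bf Bg.
by congr BL; apply/funext => x; rewrite mul1r mulN1r.
Qed.

Lemma BL_shift f a : BL f -> BL (fun x => f (x + a)).
Proof.
move=> [C [L [fC [f1 f2]]]]; exists C, L; split => //; split=> [x y|k x h].
  by have -> : x - y = (x + a) - (y + a); [rewrite opprD addrACA subrr addr0 | exact: f1].
by rewrite addrAC; exact: f2.
Qed.

(** These properties hold for one dimensional Gaussian means and pass to compositions and to their
    limit [havg]. Commutation with derivatives and stability of the classes are deduced from them
    alone. *)
Record averaging (T : (W -> R) -> (W -> R)) := Averaging {
  avg_lin : forall a f g, BL f -> BL g ->
    T (fun x => a * f x + g x) = fun x => a * T f x + T g x;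
  avg_bound : forall f (C : R), BL f -> (forall x, `|f x| <= C) -> forall x, `|T f x| <= C;
  avg_shift : forall f a, BL f -> T (fun x => f (x + a)) = fun x => T f (x + a) }.

Section AveragingTheory.
Variables (T : (W -> R) -> (W -> R)) (avgT : averaging T).

Lemma avg_sub f g : BL f -> BL g -> T (fun x => f x - g x) = fun x => T f x - T g x.
Proof.
move=> Bf Bg; have := avg_lin avgT (-1) Bg Bf.
have -> : (fun x => -1 * g x + f x) = (fun x => f x - g x).
  by apply/funext => x; rewrite mulN1r addrC.
by move=> ->; apply/funext => x; rewrite mulN1r addrC.
Qed.

Lemma avg_dist f g C : BL f -> BL g -> (forall x, `|f x - g x| <= C) ->
  forall x, `|T f x - T g x| <= C.
Proof.
move=> Bf Bg fgC x; have := avg_bound avgT (BL_sub Bf Bg) fgC x.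
by rewrite avg_sub.
Qed.

Lemma avg_shift_dist f C a : BL f -> (forall x, `|f (x + a) - f x| <= C) ->
  forall x, `|T f (x + a) - T f x| <= C.
Proof.
move=> Bf fC x; have := avg_dist (BL_shift a Bf) Bf fC x.
by rewrite (avg_shift avgT).
Qed.

Lemma avg_lipschitz_w f L : BL f -> lipschitz_w L f -> lipschitz_w L (T f).
Proof.
move=> Bf [f1 f2]; split=> [x y|k x h].
  have := @avg_shift_dist f (L * `|x - y|) (x - y) Bf _ y.
  rewrite [y + _]addrC subrK; apply => z.
  by apply: (le_trans (f1 _ _)); rewrite [z + _]addrC addrK.
by apply: avg_shift_dist => // z; exact: f2.
Qed.

Lemma avg_BL f : BL f -> BL (T f).
Proof.
move=> Bf; have [C [L [fC fL]]] := Bf; exists C, L; split.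
  exact: avg_bound.
exact: avg_lipschitz_w.
Qed.

(** The three properties of [T] transfer the quadratic Taylor remainder from [f] to [T f], with the
    same constant; [derive_quadratic] then reads off the derivative. *)
Lemma avg_derive f v : BL f -> (forall x, derivable f x v) -> BL (fun x => 'D_v f x) ->
  (forall x, derivable (T f) x v) /\ (fun x => 'D_v (T f) x) = T (fun x => 'D_v f x).
Proof.
move=> Bf df Bdf; have [C [L [_ [dL _]]]] := Bdf.
have quad x h : `|T f (x + h *: v) - T f x - h * T (fun x => 'D_v f x) x| <=
    L * `|v| * h ^+ 2.
  have := avg_bound avgT (BL_sub (BL_sub (BL_shift (h *: v) Bf) Bf)
     (BL_lin h 0 Bdf Bdf)) _ x.
  move=> /(_ (L * `|v| * h ^+ 2)).
  rewrite !avg_sub //; [|exact: BL_shift|exact: BL_sub (BL_shift _ Bf) Bf|exact: BL_lin].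
  rewrite (avg_shift avgT) //.
  (* The vanishing summand brings [h * 'D_v f] into the form to which [avg_lin] applies. *)
  have -> : (fun x => h * 'D_v f x + 0 * 'D_v f x) =
     (fun x => h * 'D_v f x + (fun=> 0) x) by apply/funext => y; rewrite mul0r.
  have B0 : BL (fun=> 0).
    have := BL_lin 0 0 Bf Bf; congr BL; apply/funext => y; ring.
  rewrite (avg_lin avgT) //.
  have -> : T (fun=> 0) x = 0.
    apply/eqP; rewrite -normr_le0; apply: (avg_bound avgT) => // y.
    by rewrite normr0.
  rewrite addr0; apply => y; rewrite mul0r addr0.
  apply: dir_taylor => // z r; apply: (le_trans (dL _ _)).
  by rewrite [z + _]addrC addrK normrZ [X in L * X]mulrC mulrA.
split=> [x|]; first by case: (derive_quadratic (quad x)).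
by apply/funext => x; case: (derive_quadratic (quad x)).
Qed.

End AveragingTheory.

(** The version of the symbol classes on which averages act without loss: each admissible derivative
    carries its own Lipschitz bounds, with a constant [L] kept apart from the sup bound [M]. *)
Definition rclass m (M L : R) f := forall s, wle m s ->
  [/\ derw s f, forall x, `|dword s f x| <= M * wprod s & lipschitz_w (L * wprod s) (dword s f)].

Lemma rclass_BL m M L f s : rclass m M L f -> wle m s -> BL (dword s f).
Proof. by move=> H /H [_ B Li]; exists (M * wprod s), (L * wprod s). Qed.

Lemma rclass_BL0 m M L f : rclass m M L f -> BL f.
Proof. by move=> H; exact: (rclass_BL H (wle_nil m)). Qed.

Lemma leq_rclass m m' M L f : (m' <= m)%N -> rclass m M L f -> rclass m' M L f.
Proof. by move=> mm H s ws; apply: H; exact: leq_wle ws. Qed.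

Lemma wprod_cat s1 s2 : wprod (s1 ++ s2) = wprod s1 * wprod s2.
Proof. exact: big_cat. Qed.

Lemma rclass_dword m p M L f s : rclass (m + p) M L f -> wle p s ->
  rclass m (M * wprod s) (L * wprod s) (dword s f).
Proof.
move=> H ws s' ws'; have [] := H (s' ++ s) (wle_cat ws' ws).
rewrite derw_cat dword_cat wprod_cat => -[_ D] B Li.
by split => //; [move=> x; apply: (le_trans (B x))|]; rewrite -mulrA [wprod s * _]mulrC.
Qed.

Lemma rclassD m M L M' L' f g a b : rclass m M L f -> rclass m M' L' g ->
  rclass m (`|a| * M + `|b| * M') (`|a| * L + `|b| * L') (fun x => a * f x + b * g x).
Proof.
move=> Hf Hg s ws; have [df Bf Lf] := Hf s ws; have [dg Bg Lg] := Hg s ws.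
(* The zero function is obtained as [-1 * g + g], so that [dwordD] also yields the derivatives of
   [b * g] alone. *)
have d0 : derw s (fun x => b * g x + (fun=> 0) x).
  have d00 : derw s (fun x => -1 * g x + g x) by case: (dwordD (-1) dg dg).
  have E0 : (fun x => -1 * g x + g x) = (fun=> 0) by apply/funext => x; ring.
  rewrite E0 in d00.
  by case: (dwordD b dg d00).
have E1 : (fun x => b * g x + (fun=> 0) x) = (fun x => b * g x).
  by apply/funext => x; rewrite addr0.
rewrite E1 in d0.
have E2 : dword s (fun x => b * g x) = (fun x => b * dword s g x).
  have := (dwordD (-1) d0 (dwordD (b) dg d0).1).2; rewrite (dwordD b dg d0).2.
  have -> : (fun x => -1 * (b * g x) + (b * g x + b * g x)) = (fun x => b * g x).
    by apply/funext => x; ring.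
  move=> ->; apply/funext => x; ring.
have [d E] := dwordD a df d0; rewrite E2 in E.
rewrite E; split; [exact: d | move=> x |].
  apply: (le_trans (ler_normD _ _)); rewrite !normrM mulrDl -!mulrA.
  by apply: lerD; apply: ler_wpM2l.
by rewrite mulrDl -!mulrA; exact: lipschitz_wD.
Qed.

Lemma avg_dword T m M L f s : averaging T -> rclass m M L f -> wle m s ->
  derw s (T f) /\ dword s (T f) = T (dword s f).
Proof.
move=> avgT H; elim: s => //= k s IH ws.
have [d E] := IH (wle_cons ws); rewrite E.
have [df _ _] := H _ ws; have Bs := rclass_BL H (wle_cons ws).
have Bd : BL (fun x => 'D_(u k) (dword s f) x) := rclass_BL H ws.
have [d' E'] := avg_derive avgT Bs df.2 Bd.
by split; [split | exact: E'].
Qed.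

Lemma avg_rclass T m M L f : averaging T -> rclass m M L f -> rclass m M L (T f).
Proof.
move=> avgT H s ws; have [d E] := avg_dword avgT H ws.
have [df Bf Lf] := H s ws; have BLf := rclass_BL H ws.
rewrite E; split; [exact: d | exact: (avg_bound avgT BLf) | exact: (avg_lipschitz_w avgT)].
Qed.

Lemma averaging_id : averaging id.
Proof. by split. Qed.

Lemma averaging_comp T T' : averaging T -> averaging T' -> averaging (T \o T').
Proof.
move=> aT aT'; split=> [a f g Bf Bg|f C Bf fC|f a Bf] /=.
- by rewrite (avg_lin aT') // (avg_lin aT) //; exact: avg_BL.
- by apply: (avg_bound aT); [exact: avg_BL | exact: avg_bound].
- by rewrite (avg_shift aT') // (avg_shift aT) //; exact: avg_BL.
Qed.

End Averaging.

(** * Gaussian means in one, finitely many and countably many directions *)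

Section GaussianAveraging.
Variables (R : realType) (W : normedModType R) (K : eqType) (u : K -> W) (w : K -> R).
Hypothesis w_ge0 : forall k, 0 <= w k.
Local Notation gam := (normal_prob (0 : R) 1).
Local Notation BL := (BL u w).
Local Notation averaging := (averaging u w).
Local Notation rclass := (rclass u w).

Definition gavg (v : W) (b : R) (f : W -> R) (x : W) : R :=
  gauss_mean (fun z => f (x + z *: v)) b.

Lemma line_continuous (f : W -> R) (x v : W) : continuous f ->
  continuous (fun z : R => f (x + z *: v)).
Proof.
move=> cf z; apply: (cvg_comp (fun z : R => x + z *: v) f); last exact: cf.
by apply: cvgD; [exact: cvg_cst | apply: cvgZl; exact: cvg_id].
Qed.

Lemma line_measurable (f : W -> R) (x v : W) (b : R) : continuous f ->
  measurable_fun setT (fun z : R => f (x + (b * z) *: v)).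
Proof.
move=> cf; apply: continuous_measurable_fun => z.
apply: (cvg_comp (fun z : R => b * z) (fun z : R => f (x + z *: v))).
  by apply: cvgM; [exact: cvg_cst | exact: cvg_id].
exact: line_continuous.
Qed.

Lemma averaging_gavg v b : averaging (gavg v b).
Proof.
have Ig f x : BL f -> gam.-integrable setT (EFin \o (fun z : R => f (x + (b * z) *: v))).
  move=> Bf; have [C [_ [fC _]]] := Bf.
  apply: (@bounded_integrable _ _ _ _ _ C) => //.
  by apply: line_measurable; exact: BL_cont Bf.
split=> [a f g Bf Bg|f C Bf fC x|f a Bf].
- apply/funext => x; rewrite /gavg /gauss_mean RintegralD ?RintegralZl //; try exact: Ig.
  by apply: EFin_integrableZ; exact: Ig.
- apply: Rintegral_norm_le => //.
  by apply: line_measurable; exact: BL_cont Bf.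
- by apply/funext => x; rewrite /gavg /gauss_mean; under eq_Rintegral do rewrite addrAC.
Qed.

Lemma rclass_line m M L f k x : (2 <= m)%N -> rclass m M L f ->
  C2_bounded (fun z : R => f (x + z *: u k))
     (fun z : R => dword u [:: k; k] f (x + z *: u k)) (M * w k ^+ 2).
Proof.
move=> m2 H.
have w2 : wle m [:: k; k] by apply: leq_wle m2 _; exact: wle_pair.
have w1 : wle m [:: k] := wle_cons w2.
have [d2 b2 l2] := H _ w2; have [d1 b1 l1] := H _ w1.
have [d0 b0 l0] := H _ (@wle_nil _ m).
exists (fun z : R => dword u [:: k] f (x + z *: u k)), (M * 1 + M * w k).
have M0 : 0 <= M by have := le_trans (normr_ge0 _) (b0 0); rewrite /wprod big_nil mulr1.
split.
- by move=> z; apply: is_derive_line; exact: d1.2.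
- by move=> z; apply: is_derive_line; exact: d2.2.
- by apply: line_continuous; exact: BL_cont (rclass_BL H w2).
- move=> z; split.
    have := b0 (x + z *: u k); rewrite /wprod big_nil => /le_trans; apply.
    by rewrite lerDl mulr_ge0.
  have := b1 (x + z *: u k); rewrite /wprod big_seq1 => /le_trans; apply.
  by rewrite lerDr mulr1.
- by move=> z; have := b2 (x + z *: u k); rewrite /wprod big_cons big_seq1 expr2.
Qed.

Lemma gavg_lipschitz M L f k a b x : 0 <= a -> 0 <= b -> rclass 2 M L f ->
  `|gavg (u k) b f x - gavg (u k) a f x| <= `|b ^+ 2 - a ^+ 2| * (M * w k ^+ 2).
Proof. by move=> a0 b0 H; apply: gauss_mean_lipschitz => //; exact: rclass_line H. Qed.

Lemma gavg_taylor M L f k a b x : 0 <= a -> 0 <= b -> rclass 4 M L f ->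
  `|gavg (u k) b f x - gavg (u k) a f x -
    (b ^+ 2 - a ^+ 2) / 2 * gavg (u k) a (dword u [:: k; k] f) x| <=
  `|b ^+ 2 - a ^+ 2| ^+ 2 * (M * w k ^+ 4).
Proof.
move=> a0 b0 H.
have H2 := rclass_dword (H : rclass (2 + 2) M L f) (@wle_pair _ k).
have := rclass_line k x (isT : 2 <= 4)%N H.
have := rclass_line k x (isT : 2 <= 2)%N H2.
rewrite /wprod big_cons big_seq1 -mulrA -expr2 -exprD => A B.
exact: (gauss_mean_taylor a0 b0 B A).
Qed.

Variable en : nat -> K.

Fixpoint navg n (b : R) (f : W -> R) : W -> R :=
  if n is n'.+1 then gavg (u (en n')) b (navg n' b f) else f.

Lemma averaging_navg n b : averaging (navg n b).
Proof.
elim: n => [|n IH]; first exact: averaging_id.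
exact: (averaging_comp (averaging_gavg (u (en n)) b) IH).
Qed.

Definition nlap n (f : W -> R) x := \sum_(i < n) dword u [:: en i; en i] f x.

Definition nsq n := \sum_(i < n) w (en i) ^+ 2.

Lemma nsq_ge0 n : 0 <= nsq n.
Proof. by apply: sumr_ge0 => i _; exact: sqr_ge0. Qed.

Lemma rclass_nlap m M L f n : rclass (m + 2) M L f ->
  rclass m (M * nsq n) (L * nsq n) (nlap n f).
Proof.
move=> H; elim: n => [|n IH].
  have -> : nlap 0 f = (fun x => 0 * f x + 0 * f x).
    by apply/funext => x; rewrite /nlap big_ord0 !mul0r addr0.
  have H' : rclass m M L f by apply: leq_rclass H; rewrite leq_addr.
  have := rclassD 0 0 H' H'.
  by rewrite normr0 !mul0r addr0 /nsq big_ord0 !mulr0.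
have -> : nlap n.+1 f = (fun x => 1 * nlap n f x + 1 * dword u [:: en n; en n] f x).
  by apply/funext => x; rewrite /nlap big_ord_recr !mul1r.
have H' := rclass_dword H (@wle_pair _ (en n)).
have := rclassD 1 1 IH H'.
rewrite normr1 !mul1r /nsq big_ord_recr /= /wprod big_cons big_seq1 -expr2.
by rewrite -!mulrDr.
Qed.

Lemma navg_lipschitz M L f a b n x : 0 <= a -> 0 <= b -> rclass 2 M L f ->
  `|navg n b f x - navg n a f x| <= `|b ^+ 2 - a ^+ 2| * (M * nsq n).
Proof.
move=> a0 b0 H; elim: n x => [|n IH] x.
  by rewrite /= subrr normr0 /nsq big_ord0 !mulr0.
have aG c := averaging_gavg (u (en n)) c; have aN c := averaging_navg n c.
have Bf := rclass_BL0 H.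
have Ha := avg_rclass (aN a) H; have Hb := avg_rclass (aN b) H.
(* Insert the mean with variance [b ^+ 2] in the new direction and [a ^+ 2] in the others: the first
   difference is the induction hypothesis, averaged once more, the second a one dimensional
   estimate. *)
rewrite /= -[X in X - _](subrK (gavg (u (en n)) b (navg n a f) x)) -addrA.
apply: (le_trans (ler_normD _ _)).
rewrite /nsq big_ord_recr /= mulrDr mulrDr; apply: lerD.
  by apply: (avg_dist (aG b) (rclass_BL0 Hb) (rclass_BL0 Ha)); exact: IH.
exact: gavg_lipschitz Ha.
Qed.

(** Telescoping over the directions. With [N = nsq n] and [v = w k ^+ 2], the errors are [N ^+ 2]
    from the old directions, [v ^+ 2] from the new one and [N * v / 2] from replacing [b] by [a] in
    the new direction for the old Laplacian, all times [d ^+ 2 * M]. Their sum is at most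
    [(N + v) ^+ 2], which is why the square of [nsq] appears. *)
Lemma navg_taylor M L f a b n x : 0 <= a -> 0 <= b -> rclass 4 M L f ->
  `|navg n b f x - navg n a f x - (b ^+ 2 - a ^+ 2) / 2 * navg n a (nlap n f) x| <=
  `|b ^+ 2 - a ^+ 2| ^+ 2 * (M * nsq n ^+ 2).
Proof.
move=> a0 b0 H; set c := (b ^+ 2 - a ^+ 2) / 2; set d := `|b ^+ 2 - a ^+ 2|.
have M0 : 0 <= M.
  have [_ /(_ 0) B _] := H _ (@wle_nil _ 4).
  by have := le_trans (normr_ge0 _) B; rewrite /wprod big_nil mulr1.
elim: n x => [|n IH] x.
  rewrite /= /nlap big_ord0 mulr0 !subrr normr0; apply: mulr_ge0.
    by apply: exprn_ge0; exact: normr_ge0.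
  by apply: mulr_ge0 => //; apply: exprn_ge0; exact: nsq_ge0.
pose k := en n; pose g := dword u [:: k; k] f.
have aG c := averaging_gavg (u k) c; have aN c := averaging_navg n c.
have Bf := rclass_BL0 H.
have Ha := avg_rclass (aN a) H; have Hb := avg_rclass (aN b) H.
have Hl := rclass_nlap n (H : rclass (2 + 2) M L f).
have Hg : rclass 2 _ _ g := rclass_dword (H : rclass (2 + 2) M L f) (@wle_pair _ k).
have -> : nlap n.+1 f = (fun x => 1 * nlap n f x + g x).
  by apply/funext => y; rewrite /nlap big_ord_recr mul1r.
have Bl := rclass_BL0 Hl; have Bg := rclass_BL0 Hg.
have BNl := avg_BL (aN a) Bl; have BNg := avg_BL (aN a) Bg.
have BNa := avg_BL (aN a) Bf; have BNb := avg_BL (aN b) Bf.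
rewrite [navg n.+1 b f]/= [navg n.+1 a f]/= [navg n.+1 a (fun _ => _)]/=.
rewrite (avg_lin (aN a)) // (avg_lin (aG a)) // -/k.
set Nl := navg n a (nlap n f) in BNl *; set Ng := navg n a g in BNg *.
set Na := navg n a f in BNa Ha *; set Nb := navg n b f in BNb Hb *.
have EN : Ng = dword u [:: k; k] Na.
  have [_ ->] := avg_dword (aN a) H (leq_wle (isT : 2 <= 4)%N (@wle_pair _ k)).
  by [].
have T1 : `|gavg (u k) b Nb x - gavg (u k) b Na x - c * gavg (u k) b Nl x| <=
    d ^+ 2 * (M * nsq n ^+ 2).
  have B2 : BL (fun x => Nb x - Na x) := BL_sub BNb BNa.
  have B3 : BL (fun x => (- c) * Nl x + (Nb x - Na x)).
    have := BL_lin (- c) 1 BNl B2; congr BL; apply/funext => y; by rewrite mul1r.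
  have := avg_bound (aG b) B3 _ x.
  rewrite (avg_lin (aG b)) // (avg_sub (aG b)) // => /(_ (d ^+ 2 * (M * nsq n ^+ 2))).
  rewrite mulNr addrC; apply => y.
  by rewrite mulNr addrC; exact: IH.
have T2 : `|gavg (u k) b Nl x - gavg (u k) a Nl x| <= d * (M * nsq n * w k ^+ 2).
  exact: gavg_lipschitz a0 b0 (avg_rclass (aN a) Hl).
have T3 : `|gavg (u k) b Na x - gavg (u k) a Na x - c * gavg (u k) a Ng x| <=
    d ^+ 2 * (M * w k ^+ 4).
  by rewrite EN; exact: (gavg_taylor k x a0 b0 Ha).
have cd : `|c| = d / 2 by rewrite normrM [X in _ * X]ger0_norm // invr_ge0.
have -> : gavg (u k) b Nb x - gavg (u k) a Na x -
    c * (1 * gavg (u k) a Nl x + gavg (u k) a Ng x) =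
   (gavg (u k) b Nb x - gavg (u k) b Na x - c * gavg (u k) b Nl x) +
   c * (gavg (u k) b Nl x - gavg (u k) a Nl x) +
   (gavg (u k) b Na x - gavg (u k) a Na x - c * gavg (u k) a Ng x) by ring.
apply: (le_trans (ler_normD _ _)).
apply: (le_trans (lerD (ler_normD _ _) (lexx _))).
rewrite normrM cd.
apply: (@le_trans _ _ (d ^+ 2 * (M * nsq n ^+ 2) + d / 2 * (d * (M * nsq n * w k ^+ 2)) +
   d ^+ 2 * (M * w k ^+ 4))).
  apply: (lerD (lerD T1 _) T3); apply: ler_wpM2l => //.
  by apply: divr_ge0 => //; exact: normr_ge0.
rewrite [nsq n.+1](_ : _ = nsq n + w k ^+ 2); last by rewrite /nsq big_ord_recr.
have n0 := nsq_ge0 n; have k0 : 0 <= w k ^+ 2 := sqr_ge0 _.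
have -> : w k ^+ 4 = (w k ^+ 2) ^+ 2 by rewrite -exprM.
have -> : d ^+ 2 * (M * (nsq n + w k ^+ 2) ^+ 2) =
  d ^+ 2 * (M * nsq n ^+ 2) + d / 2 * (d * (M * nsq n * w k ^+ 2)) +
   d ^+ 2 * (M * (w k ^+ 2) ^+ 2) + 3 / 2 * (d ^+ 2 * M * (nsq n * w k ^+ 2)) by field.
rewrite lerDl; apply: mulr_ge0; first by apply: divr_ge0.
by apply: mulr_ge0; [apply: mulr_ge0 => //; exact: sqr_ge0 | exact: mulr_ge0].
Qed.

(** The inequality [|z| <= 1 + z ^+ 2] bounds the first absolute moment by an integrable polynomial.
    What matters is the factor [w k]. *)
Lemma gavg_dist L f k b x : BL f -> lipschitz_w u w L f ->
  `|gavg (u k) b f x - f x| <= w k * (L * `|b| * \int[gam]_z (1 + z ^+ 2)).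
Proof.
move=> Bf [_ fL]; have [C [_ [fC _]]] := Bf.
have I1 : gam.-integrable setT (EFin \o (fun z : R => f (x + (b * z) *: u k))).
  apply: (@bounded_integrable _ _ _ _ _ C) => //.
  by apply: line_measurable; exact: BL_cont Bf.
have Ic (c : R) : gam.-integrable setT (EFin \o (fun z : R => c)).
  by apply: (@bounded_integrable _ _ _ _ _ `|c|).
have I2 : gam.-integrable setT (EFin \o (fun z : R => f (x + (b * z) *: u k) - f x)).
  exact: EFin_integrableB.
have I3 : gam.-integrable setT (EFin \o (fun z : R => 1 + z ^+ 2)).
  by apply: EFin_integrableD => //; exact: std_normal_integrable_sqr.
rewrite -[X in _ - X](Rintegral_prob_cst gam (f x)) /gavg /gauss_mean -RintegralB //.
apply: (le_trans (le_normr_Rintegral _ I2)) => //.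
rewrite mulrA -RintegralZl //; apply: le_Rintegral => //.
- exact: integrable_norm.
- exact: EFin_integrableZ.
move=> z _; apply: (le_trans (fL _ _ _)).
have L0 : 0 <= L * w k.
  by have := le_trans (normr_ge0 _) (fL k 0 1); rewrite normr1 mulr1.
have -> : w k * (L * `|b|) * (1 + z ^+ 2) = L * w k * (`|b| * (1 + z ^+ 2)) by ring.
rewrite normrM; apply: ler_wpM2l => //; apply: ler_wpM2l => //.
rewrite -real_normK ?num_real //; have := sqr_ge0 (`|z| - 1); rewrite sqrrB1; nra.
Qed.

(* The integral of f (x + sqrt h * y) against the standard Gaussian measure,
   for b = sqrt h, as a limit over the coordinates. *)
Definition havg b f x := lim (navg n b f x @[n --> \oo]).

Hypothesis w_summable : cvgn (series (w \o en)).

(** Including the direction [en n] changes the mean by at most a constant times [w (en n)], because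
    [navg n b f] inherits the Lipschitz constants of [f]; the weights are summable. *)
Lemma navg_cvg b f x : BL f -> navg n b f x @[n --> \oo] --> havg b f x.
Proof.
move=> Bf; have [C [L [_ fL]]] := Bf.
pose c := L * `|b| * \int[gam]_z (1 + z ^+ 2).
pose dd n := navg n.+1 b f x - navg n b f x.
have dle n : `|dd n| <= c * w (en n).
  have aN := averaging_navg n b.
  rewrite mulrC; exact: (gavg_dist (en n) b x (avg_BL aN Bf) (avg_lipschitz_w aN Bf fL)).
have sd : series dd = fun n => navg n b f x - f x.
  by apply/funext => n; rewrite /series /= telescope_sumr.
have cvd : cvgn (series dd).
  apply: normed_cvg; apply: (@series_le_cvg _ _ (c *: (w \o en))).
  - by move=> n; exact: normr_ge0.
  - by move=> n; exact: le_trans (dle n).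
  - by move=> n; exact: dle.
  - exact: is_cvg_seriesZ.
have -> : (fun n => navg n b f x) = (fun n => series dd n + f x).
  by apply/funext => n; rewrite sd subrK.
rewrite /havg.
have -> : (fun n => navg n b f x) = (fun n => series dd n + f x).
  by apply/funext => n; rewrite sd subrK.
by apply: is_cvgD => //; exact: is_cvg_cst.
Qed.

Lemma averaging_havg b : averaging (havg b).
Proof.
split=> [a f g Bf Bg|f C Bf fC x|f a Bf].
- apply/funext => x.
  apply: cvg_lim => //.
  under eq_fun do rewrite (avg_lin (averaging_navg _ b)) //.
  by apply: cvgD; [apply: cvgM; [exact: cvg_cst|]|]; exact: navg_cvg.
- have cv : navg n b f x @[n --> \oo] --> havg b f x by exact: navg_cvg.
  apply: (cvg_norm_le cv) => n.
  exact: (avg_bound (averaging_navg n b)).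
- apply/funext => x; apply: cvg_lim => //.
  under eq_fun do rewrite (avg_shift (averaging_navg _ b)) //.
  exact: navg_cvg.
Qed.

Lemma havg_lipschitz M L f a b S x : 0 <= a -> 0 <= b -> (forall n, nsq n <= S) ->
  rclass 2 M L f -> `|havg b f x - havg a f x| <= `|b ^+ 2 - a ^+ 2| * (M * S).
Proof.
move=> a0 b0 nS H; have Bf := rclass_BL0 H.
have M0 : 0 <= M.
  have [_ /(_ 0) B _] := H _ (@wle_nil _ 2).
  by have := le_trans (normr_ge0 _) B; rewrite /wprod big_nil mulr1.
have cv : (navg n b f x - navg n a f x) @[n --> \oo] --> havg b f x - havg a f x.
  by apply: cvgB; exact: navg_cvg.
apply: (cvg_norm_le cv) => n.
apply: (le_trans (navg_lipschitz n x a0 b0 H)).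
by apply: ler_wpM2l => //; apply: ler_wpM2l.
Qed.

Lemma havg_taylor M L f g tau a b S x : 0 <= a -> 0 <= b -> (forall n, nsq n <= S) ->
  rclass 4 M L f -> BL g -> (forall n y, `|nlap n f y - g y| <= tau n) ->
  tau n @[n --> \oo] --> 0 ->
  `|havg b f x - havg a f x - (b ^+ 2 - a ^+ 2) / 2 * havg a g x| <=
  `|b ^+ 2 - a ^+ 2| ^+ 2 * (M * S ^+ 2).
Proof.
move=> a0 b0 nS H Bg fg tau0; have Bf := rclass_BL0 H.
have M0 : 0 <= M.
  have [_ /(_ 0) B _] := H _ (@wle_nil _ 4).
  by have := le_trans (normr_ge0 _) B; rewrite /wprod big_nil mulr1.
(* Both the operator and its argument vary with [n]. The operators are contractions and [nlap n f]
   converges uniformly to [g], so the argument may be replaced by [g]. *)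
have cl : navg n a (nlap n f) x @[n --> \oo] --> havg a g x.
  have -> : (fun n => navg n a (nlap n f) x) =
     (fun n => (navg n a (nlap n f) x - navg n a g x) + navg n a g x).
    by apply/funext => n; rewrite subrK.
  rewrite -[X in _ --> X]add0r; apply: cvgD; last exact: navg_cvg.
  apply/norm_cvg0P; apply: (@squeeze_cvgr _ _ _ _ (fun=> 0) tau) => //; last exact: cvg_cst.
  apply: nearW => n; rewrite normr_ge0 /=; apply: (avg_dist (averaging_navg n a)) => //.
  exact: (rclass_BL0 (rclass_nlap n (H : rclass (2 + 2) M L f))).
pose c := (b ^+ 2 - a ^+ 2) / 2.
have cv : (navg n b f x - navg n a f x - c * navg n a (nlap n f) x) @[n --> \oo] -->
    havg b f x - havg a f x - c * havg a g x.
  apply: cvgB; first by apply: cvgB; exact: navg_cvg.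
  by apply: cvgM; [exact: cvg_cst | exact: cl].
apply: (cvg_norm_le cv) => n.
apply: (le_trans (navg_taylor n x a0 b0 H)).
apply: ler_wpM2l; first by rewrite exprn_ge0.
apply: ler_wpM2l => //; rewrite ler_sqr ?nnegrE ?nsq_ge0 //.
exact: le_trans (nsq_ge0 0) (nS 0).
Qed.

End GaussianAveraging.

(** * Real symbols and the Laplacian *)

Section InnerForm.
Variables (R : realType) (W : normedModType R) (q : W -> W -> R).
Hypotheses (qC : forall x y, q x y = q y x) (q_scalar : forall y, scalar (q^~ y)).
Hypotheses (q_lo : forall x, `|x| ^+ 2 <= q x x) (q_hi : forall x, q x x <= 2 * `|x| ^+ 2).

Lemma qDl x y z : q (x + y) z = q x z + q y z.
Proof. by have := q_scalar z 1 x y; rewrite scale1r mul1r. Qed.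

Lemma q0l z : q 0 z = 0.
Proof. by apply: (addrI (q 0 z)); rewrite -qDl !addr0. Qed.

Lemma qZl a x z : q (a *: x) z = a * q x z.
Proof. by have := q_scalar z a x 0; rewrite !addr0 q0l addr0. Qed.

Lemma qBl x y z : q (x - y) z = q x z - q y z.
Proof. by rewrite qDl -scaleN1r qZl mulN1r. Qed.

Lemma qDr x y z : q z (x + y) = q z x + q z y.
Proof. by rewrite qC qDl ![q _ z]qC. Qed.

Lemma qZr a x z : q z (a *: x) = a * q z x.
Proof. by rewrite qC qZl qC. Qed.

Lemma qBr x y z : q z (x - y) = q z x - q z y.
Proof. by rewrite qC qBl ![q _ z]qC. Qed.

Lemma q_suml n (c : 'I_n -> R) (v : 'I_n -> W) z :
  q (\sum_i c i *: v i) z = \sum_i c i * q (v i) z.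
Proof.
elim: n c v => [|n IH] c v; first by rewrite !big_ord0 q0l.
by rewrite !big_ord_recr /= qDl qZl IH.
Qed.

Lemma q_ge0 x : 0 <= q x x.
Proof. by apply: le_trans (q_lo x); rewrite exprn_ge0. Qed.

Lemma q_cauchy x y : q x y ^+ 2 <= q x x * q y y.
Proof.
have [->|x0] := eqVneq x 0; first by rewrite !q0l expr0n mul0r.
have qx : 0 < q x x by apply: lt_le_trans (q_lo x); rewrite exprn_gt0 // normr_gt0.
have := q_ge0 (q x x *: y - q x y *: x).
rewrite qBl !qBr !qZl !qZr [q y x]qC.
have -> : q x x * (q x x * q y y) - q x x * (q x y * q x y) -
  (q x y * (q x x * q x y) - q x y * (q x y * q x x)) =
  q x x * (q x x * q y y - q x y ^+ 2) by ring.
by rewrite pmulr_rge0 // subr_ge0.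
Qed.

Lemma q_le x y : `|q x y| <= 2 * `|x| * `|y|.
Proof.
rewrite -ler_sqr ?nnegrE ?mulr_ge0 // real_normK ?num_real //.
apply: (le_trans (q_cauchy x y)).
have -> : (2 * `|x| * `|y|) ^+ 2 = (2 * `|x| ^+ 2) * (2 * `|y| ^+ 2) by ring.
by apply: ler_pM; rewrite ?q_ge0.
Qed.

Variable u : nat -> W.
Hypotheses (u_on : forall i j, q (u i) (u j) = (i == j)%:R).
Hypothesis (u_dense : dense (linspan (range u))).

Definition fproj n z := \sum_(i < n) q z (u i) *: u i.

Lemma q_fproj n z y : q (fproj n z) y = \sum_(i < n) q z (u i) * q (u i) y.
Proof. exact: q_suml. Qed.

Lemma q_fproj_u n z i : q (fproj n z) (u i) = if (i < n)%N then q z (u i) else 0.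
Proof.
rewrite q_fproj; case: ifP => [lt|ge].
  rewrite (bigD1 (Ordinal lt)) //= u_on eqxx mulr1 big1 ?addr0 // => j ji.
  rewrite u_on (_ : (j == i :> nat) = false) ?mulr0 //.
  by apply/negbTE; apply: contra ji => /eqP E; apply/eqP/val_inj.
rewrite big1 // => j _; rewrite u_on (_ : (j == i :> nat) = false) ?mulr0 //.
by apply/negbTE/eqP => E; rewrite -E ltn_ord in ge.
Qed.

Lemma q_fproj_fproj n z : q (fproj n z) (fproj n z) = \sum_(i < n) q z (u i) ^+ 2.
Proof.
rewrite q_fproj; apply: eq_bigr => i _.
by rewrite [q (u i) _]qC q_fproj_u ltn_ord expr2.
Qed.

Lemma fproj_sqr n z : q (fproj n z) (fproj n z) = q (fproj n z) z.
Proof.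
by rewrite q_fproj_fproj q_fproj; apply: eq_bigr => i _; rewrite [q (u i) z]qC expr2.
Qed.

Lemma bessel n z : q (fproj n z) (fproj n z) <= q z z.
Proof.
have := q_ge0 (z - fproj n z); rewrite qBl !qBr [q z (fproj _ _)]qC -fproj_sqr.
by rewrite subrr subr0 subr_ge0.
Qed.

Lemma fprojB n x y : fproj n (x - y) = fproj n x - fproj n y.
Proof.
rewrite /fproj -sumrB; apply: eq_bigr => i _.
by rewrite qBl scalerBl.
Qed.

Lemma fproj_norm_le n z : `|fproj n z| <= 2 * `|z|.
Proof.
rewrite -ler_sqr ?nnegrE ?mulr_ge0 //; apply: (le_trans (q_lo _)).
apply: (le_trans (bessel _ _)); apply: (le_trans (q_hi _)).
rewrite exprMn; apply: ler_wpM2r; first exact: exprn_ge0.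
by rewrite -natrX ler_nat.
Qed.

Lemma fproj_span x : linspan (range u) x -> exists N, forall n, (N <= n)%N -> fproj n x = x.
Proof.
move=> [k [c [v [vu ->]]]].
have /choice[p pv] : forall i, exists p, u p = v i by move=> i; have [p _ <-] := vu i; exists p.
exists (\max_i p i).+1 => n Nn.
have fs : fproj n (\sum_i c i *: v i) = \sum_i c i *: fproj n (v i).
  rewrite /fproj; under eq_bigr do rewrite q_suml scaler_suml.
  rewrite exchange_big /=; apply: eq_bigr => i _; rewrite scaler_sumr.
  by apply: eq_bigr => j _; rewrite scalerA.
rewrite fs; apply: eq_bigr => i _; congr (_ *: _).
have pn : (p i < n)%N by apply: leq_trans Nn; rewrite ltnS leq_bigmax.
rewrite -pv /fproj (bigD1 (Ordinal pn)) //= u_on eqxx scale1r big1 ?addr0 // => j ji.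
rewrite u_on (_ : (p i == j :> nat) = false) ?scale0r //.
by apply/negbTE; apply: contra ji => /eqP E; apply/eqP/val_inj.
Qed.

(** The partial Fourier sums are uniformly bounded by Bessel's inequality and are eventually the
    identity on the dense span. *)
Lemma fproj_cvg z : fproj n z @[n --> \oo] --> z.
Proof.
apply/cvgrPdist_le => e e0.
have e4 : 0 < e / 4 by rewrite divr_gt0.
have [] := @u_dense (ball z (e / 4)); [|exact: ball_open|].
  by exists z; exact: ballxx.
move=> y [zy ys]; have [N NP] := fproj_span ys.
exists N => // n /= Nn.
have {zy} : `|z - y| < e / 4 by move: zy; rewrite -ball_normE.
move=> zy; have -> : z - fproj n z = (z - y) - fproj n (z - y).
  by rewrite fprojB NP // opprB addrA subrK.
apply: (le_trans (ler_normB _ _)).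
apply: (le_trans (lerD (lexx _) (fproj_norm_le _ _))); lra.
Qed.

End InnerForm.

Section RealSymbols.
Variables (R : realType) (W : normedModType R) (K : eqType) (u : K -> W) (w : K -> R).
Variables (q : W -> W -> R) (en : nat -> K).
Hypotheses (qC : forall x y, q x y = q y x) (q_scalar : forall y, scalar (q^~ y)).
Hypotheses (q_lo : forall x, `|x| ^+ 2 <= q x x) (q_hi : forall x, q x x <= 2 * `|x| ^+ 2).
Hypotheses (u_on : forall i j, q (u (en i)) (u (en j)) = (i == j)%:R).
Hypothesis (u_dense : dense (linspan (range (u \o en)))).
Hypotheses (en_onto : forall k, exists i, en i = k).
Hypothesis w_ge0 : forall k, 0 <= w k.
Variable Sw : R.
Hypothesis w_sum : forall n, \sum_(i < n) w (en i) <= Sw.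

Definition rsymb m (M : R) (f : W -> R) := forall s, wle m s ->
  [/\ derw u s f, continuous (dword u s f) & forall x, `|dword u s f x| <= M * wprod w s].

Local Notation ue := (u \o en).

Lemma Sw_ge0 : 0 <= Sw.
Proof. by have := w_sum 0; rewrite big_ord0. Qed.

(** The increment [z] is reached through its partial Fourier sums, changing one coordinate at a
    time, each step costing a directional derivative. Continuity of [g] closes the gap to [z]
    itself. *)
Lemma basis_increment (g : W -> R) (C D : R) y z : 0 <= C -> continuous g ->
  (forall k x, derivable g x (u k)) -> (forall k x, `|'D_(u k) g x| <= C * w k) ->
  (forall n, \sum_(i < n) w (en i) * `|q z (u (en i))| <= D) ->
  `|g (y + z) - g y| <= C * D.
Proof.
move=> C0 cg dg gC zD.
have step n : `|g (y + fproj q ue n z) - g y| <=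
    C * \sum_(i < n) w (en i) * `|q z (u (en i))|.
  elim: n => [|n IH]; first by rewrite /fproj !big_ord0 addr0 subrr normr0 mulr0.
  rewrite /fproj !big_ord_recr /= -/(fproj q ue n z) addrA mulrDr.
  set y' := y + fproj q ue n z; set v := _ *: _.
  have -> : g (y' + v) - g y = (g y' - g y) + (g (y' + v) - g y') by ring.
  apply: (le_trans (ler_normD _ _)); apply: lerD; first exact: IH.
  by rewrite mulrA; exact: dir_lipschitz.
have cv : g (y + fproj q ue n z) - g y @[n --> \oo] --> g (y + z) - g y.
  apply: cvgB; last exact: cvg_cst.
  apply: (cvg_comp (fun n => y + fproj q ue n z) g); last exact: cg.
  by apply: cvgD; [exact: cvg_cst | exact: fproj_cvg].
apply: (cvg_norm_le cv) => n; apply: (le_trans (step n)).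
exact: ler_wpM2l.
Qed.

Lemma u_norm_le1 k : `|u k| <= 1.
Proof.
have [i <-] := en_onto k.
have := q_lo (u (en i)); rewrite u_on eqxx => H.
by rewrite -(ler_sqr (x := `|u (en i)|)) ?nnegrE // expr1n.
Qed.

Lemma rsymb_M_ge0 m M f : rsymb m M f -> 0 <= M.
Proof.
move=> H; have [_ _ /(_ 0) B] := H _ (@wle_nil _ m).
by have := le_trans (normr_ge0 _) B; rewrite /wprod big_nil mulr1.
Qed.

Lemma leq_rsymb m m' M f : (m' <= m)%N -> rsymb m M f -> rsymb m' M f.
Proof. by move=> mm H s ws; apply: H; exact: leq_wle ws. Qed.

(** Here one order is lost: the Lipschitz bound of a derivative uses one further derivative in each
    direction. The coordinates of [z] are at most [2 * |z|], whence [2 * Sw]; the added [1] makes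
    the constant large enough for the directional clause of [lipschitz_w]. *)
Lemma rsymb_rclass m M f : rsymb m.+1 M f -> rclass u w m M (M * (2 * Sw + 1)) f.
Proof.
move=> H s ws; have M0 := rsymb_M_ge0 H.
have [d c b] := H _ (leq_wle (leqnSn m) ws).
have wk k : wle m.+1 (k :: s) by apply: (wle_cat (@wle_one _ k) ws).
have p0 := wprod_ge0 w_ge0 s; have S0 := Sw_ge0.
have gC k x : `|'D_(u k) (dword u s f) x| <= M * wprod w s * w k.
  have [_ _ /(_ x)] := H _ (wk k).
  by rewrite /wprod big_cons mulrA mulrAC.
have gd k x : derivable (dword u s f) x (u k) by have [[]] := H _ (wk k).
split; [exact: d | exact: b | split=> [x y|k x h]].
  have := @basis_increment _ (M * wprod w s) (2 * Sw * `|x - y|) y (x - y) _ c gd gC.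
  rewrite [y + _]addrC subrK => B; apply: (le_trans (B _ _)).
  - exact: mulr_ge0.
  - move=> n; apply: (@le_trans _ _ (\sum_(i < n) w (en i) * (2 * `|x - y|))).
      apply: ler_sum => i _; apply: ler_wpM2l => //.
      apply: (le_trans (q_le qC q_scalar q_lo q_hi _ _)).
      by apply: ler_piMr; [exact: mulr_ge0 | exact: u_norm_le1].
    rewrite -mulr_suml mulrCA mulrA; apply: ler_wpM2r => //.
    by apply: ler_wpM2l.
  - have -> : M * (2 * Sw + 1) * wprod w s * `|x - y| =
      M * wprod w s * (2 * Sw * `|x - y|) + M * wprod w s * `|x - y| by ring.
    by rewrite lerDl !mulr_ge0.
apply: (le_trans (dir_lipschitz (gd k) (gC k) x h)).
apply: ler_wpM2r => //; apply: ler_wpM2r => //; apply: ler_wpM2r => //.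
by apply: ler_peMr => //; rewrite lerDr mulr_ge0.
Qed.

(** The tail bound depends on [b] alone, hence is uniform when [a] depends on a point. *)
Lemma series_tail (a b : nat -> R) (S : R) : (forall i, `|a i| <= b i) ->
  \sum_(i < n) b i @[n --> \oo] --> S ->
  \sum_(i < n) a i @[n --> \oo] --> lim (\sum_(i < n) a i @[n --> \oo]) /\
  forall n, `|\sum_(i < n) a i - lim (\sum_(i < n) a i @[n --> \oo])| <= S - \sum_(i < n) b i.
Proof.
move=> ab bS.
have sE (c : nat -> R) : (fun n => \sum_(i < n) c i) = series c.
  by apply/funext => n; rewrite /series /= big_mkord.
have cb : cvgn (series b) by rewrite -sE; apply/cvg_ex; exists S.
have ca : \sum_(i < n) a i @[n --> \oo] --> lim (\sum_(i < n) a i @[n --> \oo]).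
  have : cvgn (series a).
    apply: normed_cvg; apply: (@series_le_cvg _ [sequence `|a n|]_n b) => //= n.
    exact: le_trans (normr_ge0 _) (ab n).
  by rewrite -sE.
split=> // n.
have cv : `|\sum_(i < n) a i - \sum_(i < m) a i| @[m --> \oo] -->
    `|\sum_(i < n) a i - lim (\sum_(i < n) a i @[n --> \oo])|.
  by apply: cvg_norm; apply: cvgB; [exact: cvg_cst | exact: ca].
have cvb : (\sum_(i < m) b i - \sum_(i < n) b i) @[m --> \oo] --> S - \sum_(i < n) b i.
  by apply: cvgB; [exact: bS | exact: cvg_cst].
apply: (ler_cvg_to cv cvb); exists n => // m /= nm.
have E (c : nat -> R) : \sum_(i < m) c i = \sum_(i < n) c i + \sum_(n <= i < m) c i.
  by rewrite -!(big_mkord xpredT) (@big_cat_nat _ _ _ n).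
rewrite !E opprD addNKr normrN [_ + _ - _]addrC addKr.
by apply: (le_trans (ler_norm_sum _ _ _)); apply: ler_sum.
Qed.

Lemma dword_nlap p M f n s : rsymb (p + 2) M f -> wle p s ->
  derw u s (nlap u en n f) /\
  dword u s (nlap u en n f) = (fun x => \sum_(i < n) dword u (s ++ [:: en i; en i]) f x).
Proof.
move=> H ws; elim: n => [|n [d E]].
  have [df _ _] := H _ (leq_wle (leq_addr 2 p) ws).
  have [d0 E0] := dwordD (-1) df df.
  have -> : nlap u en 0 f = (fun x => -1 * f x + f x).
    by apply/funext => x; rewrite /nlap big_ord0; ring.
  by split => //; rewrite E0; apply/funext => x; rewrite big_ord0; ring.
have [dn _ _] := H _ (wle_cat ws (@wle_pair _ (en n))).
move/derw_cat : dn => [_ dn].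
have [d' E'] := dwordD 1 d dn.
have -> : nlap u en n.+1 f = (fun x => 1 * nlap u en n f x + dword u [:: en n; en n] f x).
  by apply/funext => x; rewrite /nlap big_ord_recr mul1r.
split => //; rewrite E' E; apply/funext => x.
by rewrite mul1r big_ord_recr /= dword_cat.
Qed.

Lemma continuous_uniform_limit (F : nat -> W -> R) (g : W -> R) (tau : nat -> R) :
  (forall n, continuous (F n)) -> (forall n x, `|F n x - g x| <= tau n) ->
  tau n @[n --> \oo] --> 0 -> continuous g.
Proof.
move=> cF Fg t0 x; apply/cvgrPdist_le => /= e e0.
have e3 : 0 < e / 3 by rewrite divr_gt0.
move/cvgrPdist_le : t0 => /(_ _ e3) [N _ /(_ N (leqnn N))] /=.
rewrite sub0r normrN => tN.
have /cvgrPdist_le /(_ _ e3) := cF N x.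
apply: filterS => y xy.
have -> : g x - g y = (F N x - F N y) - (F N x - g x) + (F N y - g y) by ring.
apply: (le_trans (ler_normD _ _)); apply: (le_trans (lerD (ler_normB _ _) (lexx _))).
have := le_trans (Fg N x) (le_trans (ler_norm _) tN).
have := le_trans (Fg N y) (le_trans (ler_norm _) tN).
lra.
Qed.

Variable S : R.
Hypothesis nsq_cvg : nsq w en n @[n --> \oo] --> S.

Lemma nsq_le n : nsq w en n <= S.
Proof.
have cvc : nsq w en n @[m --> \oo] --> nsq w en n by exact: cvg_cst.
apply: (ler_cvg_to cvc nsq_cvg); exists n => // m /= nm.
rewrite /nsq -!(big_mkord xpredT (fun i => w (en i) ^+ 2)) (@big_cat_nat _ _ _ n _ m) //=.
by rewrite lerDl; apply: sumr_ge0 => i _; exact: sqr_ge0.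
Qed.

Lemma nsq_tail_cvg0 c : c * (S - nsq w en n) @[n --> \oo] --> 0.
Proof.
have E : 0 = c * (S - S) by rewrite subrr mulr0.
rewrite [X in _ --> X]E.
by apply: cvgM; [exact: cvg_cst | apply: cvgB; [exact: cvg_cst | exact: nsq_cvg]].
Qed.

Definition lapl (f : W -> R) x := lim (nlap u en n f x @[n --> \oo]).

(** Induction on the word, one use of [dir_derive_limit] per letter. The uniform convergence it asks
    for is the third clause, a tail of the series of squared weights. *)
Lemma dword_lapl p M f s : rsymb (p + 2) M f -> wle p s ->
  [/\ derw u s (lapl f),
      (forall x, dword u s (nlap u en n f) x @[n --> \oo] --> dword u s (lapl f) x) &
      forall n x, `|dword u s (nlap u en n f) x - dword u s (lapl f) x| <=
         M * wprod w s * (S - nsq w en n)].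
Proof.
move=> H; have M0 := rsymb_M_ge0 H.
have tail s' x : wle p s' ->
   let a := fun n => dword u s' (nlap u en n f) x in
   a n @[n --> \oo] --> lim (a n @[n --> \oo]) /\
   forall n, `|a n - lim (a n @[n --> \oo])| <= M * wprod w s' * (S - nsq w en n).
  move=> ws' a.
  pose b i := M * wprod w s' * w (en i) ^+ 2.
  pose c i := dword u (s' ++ [:: en i; en i]) f x.
  have cb i : `|c i| <= b i.
    have [_ _ /(_ x)] := H _ (wle_cat ws' (@wle_pair _ (en i))).
    by rewrite wprod_cat [X in _ * (_ * X)]/wprod big_cons big_seq1 mulrA -expr2.
  have bn n : \sum_(i < n) b i = M * wprod w s' * nsq w en n by rewrite -mulr_sumr.
  have an : a = fun n => \sum_(i < n) c i.
    by apply/funext => n; rewrite /a (dword_nlap n H ws').2.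
  have bS : \sum_(i < n) b i @[n --> \oo] --> M * wprod w s' * S.
    under eq_fun do rewrite bn.
    by apply: cvgM; [exact: cvg_cst | exact: nsq_cvg].
  have [A B] := series_tail cb bS; rewrite an; split=> // n.
  by rewrite mulrBr -bn; exact: B.
elim: s => [|k s IH] ws.
  by split => // [x|n x]; have [A B] := tail [::] x (@wle_nil _ p); [exact: A | exact: B].
have [d cv _] := IH (wle_cons ws).
have dn n x : derivable (dword u s (nlap u en n f)) x (u k).
  by have [[_]] := dword_nlap n H ws.
pose g x := lim (dword u (k :: s) (nlap u en n f) x @[n --> \oo]).
have tk x := tail (k :: s) x ws.
have tau0 := nsq_tail_cvg0 (M * wprod w (k :: s)).
have unif e : 0 < e -> \forall n \near \oo, forall x,
    `|'D_(u k) (dword u s (nlap u en n f)) x - g x| <= e.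
  move=> e0; move/cvgrPdist_le : tau0 => /(_ _ e0).
  apply: filterS => n; rewrite sub0r normrN => H1 x.
  by apply: (le_trans ((tk x).2 n)); exact: le_trans (ler_norm _) H1.
have DL := dir_derive_limit dn cv unif.
have Eg x : dword u (k :: s) (lapl f) x = g x by case: (DL x).
split.
- by split=> // x; case: (DL x).
- by move=> x; rewrite Eg; exact: (tk x).1.
- by move=> n x; rewrite Eg; exact: (tk x).2.
Qed.

Lemma rsymb_lapl p M f : rsymb (p + 2) M f -> rsymb p (M * S) (lapl f).
Proof.
move=> H s ws; have [d cv le] := dword_lapl H ws; split => //.
  apply: (continuous_uniform_limit (tau := fun n => M * wprod w s * (S - nsq w en n))
     (F := fun n => dword u s (nlap u en n f))) => //.
    move=> n; rewrite (dword_nlap n H ws).2.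
    elim: n => [|n IH] x.
      rewrite (_ : (fun x => _) = fun=> 0); first exact: cvg_cst.
      by apply/funext => y; rewrite big_ord0.
    rewrite (_ : (fun x => _) = fun x => \sum_(i < n) dword u (s ++ [:: en i; en i]) f x +
       dword u (s ++ [:: en n; en n]) f x); last by apply/funext => y; rewrite big_ord_recr.
    have [_ c _] := H _ (wle_cat ws (@wle_pair _ (en n))).
    by apply: cvgD; [exact: IH | exact: c].
  exact: nsq_tail_cvg0.
move=> x; apply: (cvg_norm_le (cv x)) => n.
rewrite (dword_nlap n H ws).2; apply: (le_trans (ler_norm_sum _ _ _)).
apply: (@le_trans _ _ (\sum_(i < n) M * wprod w s * w (en i) ^+ 2)).
  apply: ler_sum => i _.
  have [_ _ /(_ x)] := H _ (wle_cat ws (@wle_pair _ (en i))).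
  by rewrite wprod_cat [X in _ * (_ * X)]/wprod big_cons big_seq1 mulrA -expr2.
rewrite -mulr_sumr [M * S * _]mulrAC; apply: ler_wpM2l; last exact: nsq_le.
by apply: mulr_ge0; [exact: rsymb_M_ge0 H | exact: wprod_ge0].
Qed.

End RealSymbols.

Section Swap.
Variables (R : realType) (W : normedModType R) (K : eqType) (u : K -> W) (w : K -> R).

(** Schwarz's theorem by termwise differentiation: the difference quotients of [g] along [u l] with
    steps [n.+1%:R^-1] converge uniformly, and so do their derivatives along [u k], thanks to the
    Lipschitz bounds of ['D_(u l) g] and of ['D_(u l) ('D_(u k) g)] along [u l]. *)
Lemma dword_swap m M L f s k l : rclass u w m M L f -> wle m (k :: l :: s) ->
  dword u (k :: l :: s) f = dword u (l :: k :: s) f.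
Proof.
move=> H ws; set g := dword u s f.
have wkl : wle m (l :: k :: s) by move=> j; have := ws j; rewrite /= addnCA.
have [dkl _ Lkl] := H _ ws; have [dlk _ Llk] := H _ wkl.
have dl x : derivable g x (u l) by case: dkl => -[].
have dk x : derivable g x (u k) by case: dlk => -[].
have dlkg x : derivable (dword u (k :: s) f) x (u l) by case: dlk.
have wl : wle m (l :: s) := wle_cons ws.
have wk : wle m (k :: s) := wle_cons wkl.
have [_ _ [_ Ll]] := H _ wl.
pose h (n : nat) : R := n.+1%:R^-1.
have h0 n : h n != 0 by rewrite invr_eq0 pnatr_eq0.
pose F n x := (h n)^-1 * (g (x + h n *: u l) - g x).
have dsh n x : derivable (fun y => g (y + h n *: u l)) x (u k) /\
   'D_(u k) (fun y => g (y + h n *: u l)) x = 'D_(u k) g (x + h n *: u l).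
  have E : (fun t : R => t^-1 *: (((fun y => g (y + h n *: u l)) \o shift x) (t *: u k) -
     g (x + h n *: u l))) =
     (fun t : R => t^-1 *: ((g \o shift (x + h n *: u l)) (t *: u k) - g (x + h n *: u l))).
    by apply/funext => t /=; rewrite addrA.
  by rewrite /derivable /derive E; split=> //; exact: dk.
have DF n x : derivable (F n) x (u k) /\
   'D_(u k) (F n) x = (h n)^-1 * ('D_(u k) g (x + h n *: u l) - 'D_(u k) g x).
  have [d1 E1] := dsh n x.
  have dB : derivable ((fun y => g (y + h n *: u l)) \- g) x (u k) by exact: derivableB.
  split; first by exact: derivableZ.
  by rewrite (deriveZ (h n)^-1 dB) (deriveB d1 (dk x)) E1.
have quot G (LG : R) x n : (forall y, derivable G y (u l)) ->
   (forall y r, `|'D_(u l) G (y + r *: u l) - 'D_(u l) G y| <= LG * `|r|) ->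
   `|(h n)^-1 * (G (x + h n *: u l) - G x) - 'D_(u l) G x| <= LG * h n.
  move=> dG GL; have := dir_taylor dG GL x (h n).
  have hp : 0 < h n by rewrite invr_gt0 ltr0n.
  have -> : (h n)^-1 * (G (x + h n *: u l) - G x) - 'D_(u l) G x =
     (h n)^-1 * (G (x + h n *: u l) - G x - h n * 'D_(u l) G x) by field.
  by rewrite normrM normfV (ger0_norm (ltW hp)) ler_pdivrMl // expr2 mulrCA mulrA.
have hcv : h n @[n --> \oo] --> 0 by exact: cvg_harmonic.
apply/funext => x.
have near0 (c e : R) : 0 < e -> \forall n \near \oo, c * h n <= e.
  move=> e0; have : c * h n @[n --> \oo] --> 0.
    by rewrite -[X in _ --> X](mulr0 c); apply: cvgM; [exact: cvg_cst | exact: hcv].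
  move=> /cvgrPdist_le /(_ _ e0); apply: filterS => n; rewrite sub0r normrN.
  exact: le_trans (ler_norm _).
have unif (G : W -> R) (LG : R) e : (forall y, derivable G y (u l)) ->
   (forall y r, `|'D_(u l) G (y + r *: u l) - 'D_(u l) G y| <= LG * `|r|) -> 0 < e ->
   \forall n \near \oo, forall x,
     `|(h n)^-1 * (G (x + h n *: u l) - G x) - 'D_(u l) G x| <= e.
  move=> dG GL e0; have := near0 LG e e0; apply: filterS => n H1 y.
  exact: le_trans (quot G LG y n dG GL) H1.
have [| | |_ E] := @dir_derive_limit _ _ F (dword u (l :: s) f) (dword u (l :: k :: s) f)
  (u k) _ _ _ x.
- by move=> n y; case: (DF n y).
- move=> y; apply/cvgrPdist_le => e e0.
  have := @unif g _ e dl (fun y r => Ll l y r) e0.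
  by apply: filterS => n H1; rewrite distrC; exact: H1.
- move=> e e0; have := @unif (dword u (k :: s) f) _ e dlkg (fun y r => Llk.2 l y r) e0.
  by apply: filterS => n H1 y; rewrite (DF n y).2; exact: H1.
exact: E.
Qed.

Lemma dword_rcons m M L f s k : rclass u w m M L f -> wle m (k :: s) ->
  dword u (k :: s) f = dword u (s ++ [:: k]) f.
Proof.
move=> H; elim: s => [|l s IH] ws //.
have wk : wle m (k :: s).
  by move=> j; have := ws j; rewrite /= addnCA; apply: leq_trans; rewrite leq_addl.
rewrite (dword_swap H ws) cat_cons.
by have E := IH wk; rewrite /= in E *; rewrite E.
Qed.

(** Differentiating a Laplacian applies the pair first and [s] afterwards, whereas the Taylor
    estimate for [dword u s f] involves its own second derivatives. This reconciles the two
    orders. *)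
Lemma dword_pair_comm m M L f s k : rclass u w (m + 2) M L f -> wle m s ->
  dword u (s ++ [:: k; k]) f = dword u ([:: k; k] ++ s) f.
Proof.
move=> H ws; have w2 : wle (m + 2) (k :: k :: s).
  by move=> j; have := ws j; rewrite /= addnA addnC; move: (k == j) => [] ?; rewrite ?leq_add.
have ws1 : wle (m + 1) (k :: s) by rewrite addnC; exact: (wle_cat (@wle_one _ k) ws).
have H1 : rclass u w (m + 1) (M * wprod w [:: k]) (L * wprod w [:: k]) (dword u [:: k] f).
  by apply: rclass_dword (@wle_one _ k); rewrite -addnA.
have E1 := dword_rcons H1 ws1.
have E2 := dword_rcons H w2.
rewrite [RHS]E2 (dword_cat _ (k :: s) [:: k]) E1 -dword_cat -catA.
by [].
Qed.

End Swap.

(** * Complex symbols *)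

Section ComplexNorm.
Variable R : realType.
Implicit Types z : R[i].

Lemma normc_Re z : `|complex.Re z| <= Normc.normc z.
Proof.
by case: z => a b /=; rewrite -sqrtr_sqr ler_sqrt ?addr_ge0 ?sqr_ge0 // lerDl sqr_ge0.
Qed.

Lemma normc_Im z : `|complex.Im z| <= Normc.normc z.
Proof.
by case: z => a b /=; rewrite -sqrtr_sqr ler_sqrt ?addr_ge0 ?sqr_ge0 // lerDr sqr_ge0.
Qed.

Lemma normc_le z (M : R) : `|complex.Re z| <= M -> `|complex.Im z| <= M ->
  Normc.normc z <= 2 * M.
Proof.
case: z => a b /= aM bM.
have M0 : 0 <= M := le_trans (normr_ge0 _) aM.
rewrite -(ger0_norm (_ : 0 <= 2 * M)) ?mulr_ge0 // -sqrtr_sqr ler_sqrt ?sqr_ge0 //.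
rewrite -(real_normK (num_real a)) -(real_normK (num_real b)).
have := ler_pM (normr_ge0 _) (normr_ge0 _) aM aM.
have := ler_pM (normr_ge0 _) (normr_ge0 _) bM bM.
rewrite -!expr2 exprMn; have := sqr_ge0 M; lra.
Qed.

Lemma complex_eta z : z = (complex.Re z) +i* (complex.Im z).
Proof. by case: z. Qed.

End ComplexNorm.

Section Enumeration.
Variables (R : realType) (J : countType).
Local Notation K := (J + J)%type.

(** The directions [inl] and [inr] over [enJ i] sit at positions [2 i] and [2 i + 1], so a partial
    sum over [J] of both contributions is an even partial sum over [J + J]. *)
Definition enK (enJ : nat -> J) (n : nat) : K :=
  if odd n then inr (enJ n./2) else inl (enJ n./2).

Lemma sum_enK (enJ : nat -> J) (a : K -> R) n :
  \sum_(i < n.*2) a (enK enJ i) = \sum_(i < n) (a (inl (enJ i)) + a (inr (enJ i))).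
Proof.
elim: n => [|n IH]; first by rewrite !big_ord0.
rewrite doubleS !big_ord_recr IH /= -addrA; congr (_ + (_ + _)).
  by rewrite /enK odd_double doubleK.
by rewrite /enK /= odd_double /= uphalf_double.
Qed.

(** The positive and negative parts are unordered sums of nonnegative terms, reindexed by the
    bijection; domination by [b] makes both finite, so that [fine] loses nothing. *)
Lemma rsum_cvg (enJ : nat -> J) (f : J -> R) (b : nat -> R) (S : R) :
  bijective enJ -> (forall i, `|f (enJ i)| <= b i) ->
  \sum_(i < n) b i @[n --> \oo] --> S ->
  \sum_(i < n) f (enJ i) @[n --> \oo] --> rsum f.
Proof.
move=> bij fb bS.
have pos (g : J -> R) : (forall j, 0 <= g j) -> (forall i, g (enJ i) <= b i) ->
    \sum_(i < n) g (enJ i) @[n --> \oo] --> fine (\esum_(j in setT) (g j)%:E).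
  move=> g0 gb.
  have gn i : `|g (enJ i)| <= b i by rewrite ger0_norm.
  have [cv _] := series_tail gn bS.
  have -> : \esum_(j in setT) (g j)%:E = (lim (\sum_(i < n) g (enJ i) @[n --> \oo]))%:E.
    rewrite (@reindex_esum _ _ _ setT setT enJ); last by rewrite setTT_bijective.
    rewrite -nneseries_esumT; last by move=> n; rewrite lee_fin.
    apply: cvg_lim => //.
    have -> : (fun n => \sum_(0 <= i < n) (g (enJ i))%:E)%E =
       (fun n => (\sum_(i < n) g (enJ i))%:E).
      by apply/funext => n; rewrite big_mkord sumEFin.
    by apply: cvg_EFin; [exact: nearW | exact: cv].
  exact: cv.
have E : (fun n => \sum_(i < n) f (enJ i)) =
    (fun n => \sum_(i < n) Num.max (f (enJ i)) 0 - \sum_(i < n) Num.max (- f (enJ i)) 0).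
  apply/funext => n; rewrite -sumrB; apply: eq_bigr => i _.
  by case: (leP (f (enJ i)) 0) => h; case: (leP (- f (enJ i)) 0) => h'; lra.
rewrite E; apply: cvgB; apply: pos => [j|i].
- by rewrite le_max lexx orbT.
- by rewrite ge_max (le_trans (ler_norm _) (fb i)) (le_trans (normr_ge0 _) (fb i)).
- by rewrite le_max lexx orbT.
- rewrite ge_max (le_trans (normr_ge0 _) (fb i)) andbT.
  by apply: le_trans (fb i); rewrite -normrN ler_norm.
Qed.

End Enumeration.

Section Words.
Variables (R : realType) (H : normedModType R) (J : countType) (e : J -> H) (eps : J -> R).
Hypothesis eps_ge0 : forall j, 0 <= eps j.
Local Notation K := (J + J)%type.
Local Notation u := (dir e).
Implicit Types (F : H * H -> R[i]) (s : seq K).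

Definition lab (k : K) : J := match k with inl j => j | inr j => j end.

Definition wt (k : K) : R := eps (lab k).

Definition cRe F : H * H -> R := fun X => complex.Re (F X).
Definition cIm F : H * H -> R := fun X => complex.Im (F X).

Lemma wt_ge0 k : 0 <= wt k.
Proof. exact: eps_ge0. Qed.

Lemma derive_wordE s F : derive_word e s F =
  (fun X => (dword u s (cRe F) X) +i* (dword u s (cIm F) X)).
Proof.
elim: s => [|k s IH] /=; first by apply/funext => X; exact: complex_eta.
by rewrite IH.
Qed.

Lemma derivable_wordE s F : derivable_word e s F <->
  derw u s (cRe F) /\ derw u s (cIm F).
Proof.
elim: s => [|k s IH] //=; rewrite derive_wordE /cderivable /=.
split=> [[/IH[dr di] d]|[[dr dr'] [di di']]].
  by split; split => // x; case: (d x).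
by split; [exact/IH | move=> x; split].
Qed.

Local Notation mindex := {fsfun J -> nat with 0%N}.

Lemma wprod_count (A : {fset J}) s : (forall k, k \in s -> lab k \in A) ->
  \prod_(j <- A) eps j ^+ (count_mem (inl j) s + count_mem (inr j) s) = wprod wt s.
Proof.
elim: s => [|k s IH] sA; first by rewrite /wprod big_nil big1.
rewrite /wprod big_cons -/(wprod wt s) -IH; last first.
  by move=> l ls; apply: sA; rewrite inE ls orbT.
have kA : lab k \in A by apply: sA; rewrite mem_head.
have E : \prod_(j <- A) eps j ^+ (lab k == j) = wt k.
  rewrite (bigD1_seq (lab k)) ?fset_uniq //= eqxx expr1 big1 ?mulr1 // => j.
  by rewrite eq_sym => /negbTE ->.
rewrite -E -big_split /=; apply: eq_bigr => j _; rewrite -exprD; congr (_ ^+ _).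
case: k {sA kA E} => l /=.
  have -> : (inl l == inl j :> K) = (l == j) by [].
  by rewrite add0n addnA.
have -> : (inr l == inr j :> K) = (l == j) by [].
by rewrite add0n addnCA.
Qed.

(** Every word has its pair of multi-indices; through them [symbol_bound], quantified over
    multi-indices, becomes a statement about words. *)
Definition count_index (f : J -> K) s : mindex :=
  [fsfun j in [fset lab k | k in s]%fset => count_mem (f j) s].

Lemma count_indexE f s j : (forall j, lab (f j) = j) ->
  count_index f s j = count_mem (f j) s.
Proof.
move=> lf; rewrite fsfunE; case: ifP => // /negbT; apply: contraNeq.
rewrite eq_sym -lt0n -has_count has_pred1 => fs.
by apply/imfsetP; exists (f j).
Qed.

Lemma word_of_count s : word_of s (count_index inl s) (count_index inr s).
Proof. by move=> j; split; rewrite count_indexE. Qed.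

Lemma word_of_prod s (al be : mindex) : word_of s al be ->
  \prod_(j <- (finsupp al `|` finsupp be)%fset) eps j ^+ (al j + be j) = wprod wt s.
Proof.
move=> sab; rewrite -(@wprod_count (finsupp al `|` finsupp be)%fset); last first.
  move=> k ks; rewrite in_fsetU !mem_finsupp; have [A B] := sab (lab k).
  case: k ks A B => j /= ks A B; apply/orP; [left|right].
    by rewrite -A -lt0n -has_count has_pred1.
  by rewrite -B -lt0n -has_count has_pred1.
by apply: eq_bigr => j _; have [-> ->] := sab j.
Qed.

Lemma word_of_wle m s (al be : mindex) : word_of s al be ->
  (forall j, al j <= m /\ be j <= m)%N <-> wle m s.
Proof.
move=> sab; split=> [H' [] j|H' j].
- by have [-> _] := sab j; case: (H' j).
- by have [_ ->] := sab j; case: (H' j).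
- by have [<- <-] := sab j; split; apply: H'.
Qed.

Lemma symbol_bound_rsymb m M F : symbol_bound e eps m M F ->
  rsymb u wt m M (cRe F) /\ rsymb u wt m M (cIm F).
Proof.
move=> [_ _ H'].
have main s : wle m s -> [/\ derivable_word e s F, ccontinuous (derive_word e s F) &
    forall X, Normc.normc (derive_word e s F X) <= M * wprod wt s].
  move=> ws; have wo := word_of_count s.
  by have [] := H' _ _ ((word_of_wle m wo).2 ws) s wo; rewrite (word_of_prod wo).
split=> s /main [/derivable_wordE [dr di] [cr ci] b]; rewrite derive_wordE /= in cr ci b.
- by split=> // X; apply: le_trans (b X); exact: (normc_Re (_ +i* _)).
- by split=> // X; apply: le_trans (b X); exact: (normc_Im (_ +i* _)).
Qed.

(** The factor 2 is the price of bounding the modulus by the real and imaginary parts. It affects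
    neither continuity of operators nor convergence to 0. *)
Lemma rsymb_symbol_bound m M F : rsymb u wt m M (cRe F) -> rsymb u wt m M (cIm F) ->
  symbol_bound e eps m (2 * M) F.
Proof.
move=> Hr Hi; have M0 := rsymb_M_ge0 Hr.
have main s : wle m s -> [/\ derivable_word e s F, ccontinuous (derive_word e s F) &
    forall X, Normc.normc (derive_word e s F X) <= 2 * M * wprod wt s].
  move=> ws; have [dr cr br] := Hr _ ws; have [di ci bi] := Hi _ ws.
  split; first exact/derivable_wordE.
    by rewrite derive_wordE.
  by move=> X; rewrite -mulrA derive_wordE; apply: normc_le; [exact: br | exact: bi].
have [_ c0 b0] := main [::] (@wle_nil _ m).
split => //; first by exists (2 * M * wprod wt [::]).
move=> al be abm s wo; have [d c b] := main s ((word_of_wle m wo).1 abm).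
by split => // X; rewrite (word_of_prod wo).
Qed.

Lemma symbolP m F : symbol e eps m F <->
  exists M, rsymb u wt m M (cRe F) /\ rsymb u wt m M (cIm F).
Proof.
split=> [[M _ /symbol_bound_rsymb H']|[M [Hr Hi]]]; first by exists M.
exists (2 * M); first by rewrite mulr_ge0 // (rsymb_M_ge0 Hr).
exact: rsymb_symbol_bound.
Qed.

Lemma rsymb_le m M M' f : M <= M' -> rsymb u wt m M f -> rsymb u wt m M' f.
Proof.
move=> MM H' s /H' [d c b]; split => // x; apply: le_trans (b x) _.
by apply: ler_wpM2r => //; apply: wprod_ge0; exact: wt_ge0.
Qed.

Lemma rsymb_lin m M M' a b f g : rsymb u wt m M f -> rsymb u wt m M' g ->
  rsymb u wt m (`|a| * M + `|b| * M') (fun x => a * f x + b * g x).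
Proof.
move=> Hf Hg s ws; have [df cf Bf] := Hf s ws; have [dg cg Bg] := Hg s ws.
have [d00 E00] := dwordD (-1) dg dg.
have Z0 : (fun x => -1 * g x + g x) = (fun=> 0) by apply/funext => x; ring.
have [db Eb] := dwordD b dg d00; have [d E] := dwordD a df db.
have X0 : (fun x => a * f x + (b * g x + (-1 * g x + g x))) = (fun x => a * f x + b * g x).
  by apply/funext => x; ring.
rewrite Eb E00 X0 in d E.
have E' : dword u s (fun x => a * f x + b * g x) =
   (fun x => a * dword u s f x + b * dword u s g x).
  by rewrite E; apply/funext => x; ring.
rewrite E'; split; first exact: d.
  move=> x; apply: cvgD; apply: cvgM; [exact: cvg_cst | exact: cf | exact: cvg_cst | exact: cg].
move=> x; apply: (le_trans (ler_normD _ _)); rewrite !normrM mulrDl -!mulrA.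
by apply: lerD; apply: ler_wpM2l.
Qed.

Lemma symbol_lin m (a b : R) F G : symbol e eps m F -> symbol e eps m G ->
  symbol e eps m (fun X => a%:C * F X + b%:C * G X).
Proof.
move=> /symbolP [M [Fr Fi]] /symbolP [M' [Gr Gi]]; apply/symbolP.
exists (`|a| * M + `|b| * M'); split.
  have := rsymb_lin a b Fr Gr; congr rsymb; apply/funext => X.
  by rewrite /cRe; case: (F X) (G X) => [x y] [x' y'] /=; ring.
have := rsymb_lin a b Fi Gi; congr rsymb; apply/funext => X.
by rewrite /cIm; case: (F X) (G X) => [x y] [x' y'] /=; ring.
Qed.

Lemma symbol_sub m F G : symbol e eps m F -> symbol e eps m G -> symbol e eps m (F \- G).
Proof.
move=> Fs Gs; have := symbol_lin 1 (-1) Fs Gs; congr symbol; apply/funext => X /=.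
by case: (F X) (G X) => [x y] [x' y']; simpc.
Qed.

Lemma symbol_norm_le m M F : rsymb u wt m M (cRe F) -> rsymb u wt m M (cIm F) ->
  0 <= symbol_norm e eps m F <= 2 * M.
Proof.
move=> Hr Hi; have M0 := rsymb_M_ge0 Hr.
have lb : has_lbound [set M | 0 <= M /\ symbol_bound e eps m M F].
  by exists 0 => x [].
apply/andP; split.
  apply: lb_le_inf; last by move=> x [].
  by exists (2 * M); split; [exact: mulr_ge0 | exact: rsymb_symbol_bound].
apply: ge_inf => //; split; first exact: mulr_ge0.
exact: rsymb_symbol_bound.
Qed.

Lemma symbol_norm_lt m (d : R) F : symbol e eps m F -> symbol_norm e eps m F < d ->
  exists M, M < d /\ rsymb u wt m M (cRe F) /\ rsymb u wt m M (cIm F).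
Proof.
move=> [M0 M0p Fs] /inf_lt => Hd.
have [|M [_ FM] Md] := Hd _; first by exists M0.
by exists M; split => //; exact: symbol_bound_rsymb.
Qed.

End Words.

Section Laplace.
Variables (R : realType) (H : normedModType R) (J : countType) (e : J -> H) (eps : J -> R).
Hypothesis eps_ge0 : forall j, 0 <= eps j.
Variables (enJ : nat -> J) (S : R).
Hypothesis enJ_bij : bijective enJ.
Local Notation u := (dir e).
Local Notation w := (wt eps).
Local Notation en := (enK enJ).
Hypothesis nsq_cvg : nsq w en n @[n --> \oo] --> S.

(** The unordered sum over [J] and the limit of partial sums over [J + J] are compared along the
    even indices [n.*2]. *)
Lemma rsum_lapl M (f : H * H -> R) X : rsymb u w 2 M f ->
  rsum (fun j => dword u [:: inl j; inl j] f X + dword u [:: inr j; inr j] f X) =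
  lapl u en f X.
Proof.
move=> Hf.
pose a k := dword u [:: k; k] f X.
pose c i := M * wt eps (inl (enJ i)) ^+ 2 + M * wt eps (inr (enJ i)) ^+ 2.
have aM k : `|a k| <= M * w k ^+ 2.
  have [_ _ /(_ X)] := Hf _ (@wle_pair _ k).
  by rewrite /wprod big_cons big_seq1 expr2.
have dbl : (fun n => n.*2) @ \oo --> \oo.
  move=> A [N _ NA]; exists N => // n /= Nn; apply: NA => /=.
  by rewrite -addnn; apply: leq_trans Nn (leq_addr _ _).
have cS : \sum_(i < n) c i @[n --> \oo] --> M * S.
  have -> : (fun n => \sum_(i < n) c i) = (fun n => M * nsq w en n.*2).
    apply/funext => n; rewrite /nsq (sum_enK enJ (fun k => w k ^+ 2)) mulr_sumr.
    by apply: eq_bigr => i _; rewrite mulrDr.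
  apply: cvgM; first exact: cvg_cst.
  exact: (cvg_comp (fun n => n.*2) (nsq w en) dbl nsq_cvg).
have fc i : `|a (inl (enJ i)) + a (inr (enJ i))| <= c i.
  by apply: (le_trans (ler_normD _ _)); apply: lerD; exact: aM.
have cv := @rsum_cvg _ _ enJ (fun j => a (inl j) + a (inr j)) c (M * S) enJ_bij fc cS.
have MS : \sum_(i < n) M * w (en i) ^+ 2 @[n --> \oo] --> M * S.
  have -> : (fun n => \sum_(i < n) M * w (en i) ^+ 2) = (fun n => M * nsq w en n).
    by apply/funext => n; rewrite mulr_sumr.
  by apply: cvgM; [exact: cvg_cst | exact: nsq_cvg].
have [cl _] := series_tail (fun i => aM (en i)) MS.
have cl2 := cvg_comp (fun n => n.*2) (fun n => \sum_(i < n) a (en i)) dbl cl.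
have E : (fun n => \sum_(i < n) a (en i)) \o (fun n => n.*2) =
    (fun n => \sum_(i < n) (a (inl (enJ i)) + a (inr (enJ i)))).
  by apply/funext => n /=; rewrite (sum_enK enJ a).
rewrite E in cl2.
exact: (cvg_unique _ cv cl2).
Qed.

Lemma laplaceE F : symbol e eps 2 F ->
  laplace e F = (fun X => (lapl u en (cRe F) X) +i* (lapl u en (cIm F) X)).
Proof.
move=> Fs; have [M [Fr Fi]] := (@symbolP _ _ _ e eps 2 F).1 Fs; apply/funext => X.
rewrite /laplace /csum -(rsum_lapl X Fr) -(rsum_lapl X Fi).
by congr (rsum _ +i* rsum _); apply/funext => j; rewrite !derive_wordE.
Qed.

End Laplace.

(** * Finite dimensional Gaussian marginals *)

Section CaratheodoryFunctions.
Variables (R : realType) (d : measure_display) (T : measurableType d).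

Lemma measurable_caratheodory (g : R -> T -> R) (l : T -> R) :
  (forall s, measurable_fun setT (g s)) -> (forall t, continuous (g^~ t)) ->
  measurable_fun setT l -> measurable_fun setT (fun t => g (l t) t).
Proof.
move=> mg cg ml.
pose m (k : nat) t : int := Num.floor (k.+1%:R * l t).
apply: (@measurable_fun_cvg _ _ _ _ (fun k t => g ((m k t)%:~R / k.+1%:R) t)); last first.
  move=> t _; apply: (cvg_comp (fun k => (m k t)%:~R / k.+1%:R : R) (g^~ t)); last exact: cg.
  apply/cvgrPdist_le => e e0.
  near=> k.
  have k0 : (0 : R) < k.+1%:R by rewrite ltr0n.
  have -> : l t - (m k t)%:~R / k.+1%:R = (k.+1%:R * l t - (m k t)%:~R) / k.+1%:R.
    by field; exact: lt0r_neq0.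
  have /andP[f1 f2] := floor_itv (k.+1%:R * l t).
  rewrite ger0_norm; last by rewrite divr_ge0 ?subr_ge0 // ltW.
  rewrite ler_pdivrMr //.
  apply: (@le_trans _ _ 1); first by rewrite /m; rewrite intrD in f2; lra.
  rewrite mulrC -ler_pdivrMr //.
  apply: (@le_trans _ _ k%:R); last by rewrite ler_nat.
  by near: k; exact: nbhs_infty_ger.
move=> k _ B mB; rewrite setTI.
have -> : (fun t => g ((m k t)%:~R / k.+1%:R) t) @^-1` B =
    \bigcup_(z in [set: int]) ((fun t => k.+1%:R * l t) @^-1` `[z%:~R, (z + 1)%:~R[ `&`
       (g (z%:~R / k.+1%:R) @^-1` B)).
  apply/seteqP; split=> [t /= Bt|t [z _ [/=]]].
    exists (m k t) => //; split => //=; rewrite in_itv /=; exact: floor_itv.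
  rewrite in_itv /= => zt; suff -> : m k t = z by [].
  exact: floor_def.
apply: countable_bigcupT_measurable => [|z]; first exact: countableP.
apply: measurableI.
  by rewrite -[X in measurable X]setTI; apply: measurable_funM.
by rewrite -[X in measurable X]setTI; exact: mg.
Unshelve. all: by end_near.
Qed.

(** Peeling off the last coordinate leaves a function that is continuous in a real parameter and, by
    induction, measurable for each fixed value of it. *)
Lemma measurable_lincomb (W : normedModType R) (f : W -> R) n (l : 'I_n -> T -> R)
    (w : 'I_n -> W) (a : W) : continuous f ->
  (forall i, measurable_fun setT (l i)) ->
  measurable_fun setT (fun t => f (a + \sum_i l i t *: w i)).
Proof.
elim: n f l w => [|n IH] f l w cf ml.
  under eq_fun do rewrite big_ord0 addr0.
  exact: measurable_cst.
under eq_fun do rewrite big_ord_recr /= addrA.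
apply: (@measurable_caratheodory (fun s t => f (a +
   \sum_(i < n) l (widen_ord (leqnSn n) i) t *: w (widen_ord (leqnSn n) i) + s *: w ord_max))
   (l ord_max)) => // [s|t].
  apply: (IH (fun x => f (x + s *: w ord_max))) => // x.
  apply: (cvg_comp (fun x => x + s *: w ord_max) f); last exact: cf.
  by apply: cvgD; [exact: cvg_id | exact: cvg_cst].
exact: line_continuous.
Qed.

End CaratheodoryFunctions.

(** * Product structure of the finite dimensional Gaussian measures *)

Section IteratedLebesgue.
Variable R : realType.
Local Notation leb := (@lebesgue_measure R).
Local Open Scope ereal_scope.

Lemma lebesgue_int_ge0 n (g : n.-tuple R -> \bar R) : (forall v, 0 <= g v) ->
  0 <= lebesgue_int g.
Proof.
by elim: n g => [|n IH] g g0 //=; apply: integral_ge0 => x _; exact: IH.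
Qed.

Lemma measurable_lebesgue_int n d (T : measurableType d) (g : T -> n.-tuple R -> \bar R) :
  measurable_fun setT (fun p : T * n.-tuple R => g p.1 p.2) ->
  (forall t v, 0 <= g t v) -> measurable_fun setT (fun t => lebesgue_int (g t)).
Proof.
elim: n d T g => [|n IH] d T g mg g0 /=.
  apply: (@measurableT_comp _ _ _ _ _ _ (fun p : T * 0.-tuple R => g p.1 p.2) _
    (fun t => (t, [tuple]))) => //.
apply: (@measurable_fun_fubini_tonelli_F _ _ _ _ _ leb
  (fun p : T * R => lebesgue_int (fun v : n.-tuple R => g p.1 [tuple of p.2 :: v]))).
  2: by move=> p; exact: lebesgue_int_ge0.
apply: (IH _ _ (fun (p : T * R) (v : n.-tuple R) => g p.1 [tuple of p.2 :: v])) => //.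
apply: (@measurableT_comp _ _ _ _ _ _ (fun p : T * n.+1.-tuple R => g p.1 p.2) _
  (fun p : (T * R) * n.-tuple R => (p.1.1, [tuple of p.1.2 :: p.2]))) => //.
apply: measurable_fun_pair.
  by apply: measurableT_comp; exact: measurable_fst.
apply: measurable_cons; last exact: measurable_snd.
by apply: measurableT_comp; [exact: measurable_snd | exact: measurable_fst].
Qed.

Lemma measurable_lebesgue_int_cons n (g : n.+1.-tuple R -> \bar R) :
  measurable_fun setT g -> (forall v, 0 <= g v) ->
  measurable_fun setT (fun x : R => lebesgue_int (fun v : n.-tuple R => g [tuple of x :: v])).
Proof.
move=> mg g0; apply: measurable_lebesgue_int => //.
by apply: (measurableT_comp mg); apply: measurable_cons; [exact: measurable_fst | exact: measurable_snd].
Qed.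

Lemma lebesgue_intZ n (k : R) (g : n.-tuple R -> \bar R) : (0 <= k)%R ->
  measurable_fun setT g -> (forall v, 0 <= g v) ->
  lebesgue_int (fun v => k%:E * g v) = k%:E * lebesgue_int g.
Proof.
move=> k0; elim: n g => [|n IH] g mg g0 //=.
rewrite -ge0_integralZl //.
- apply: eq_integral => x _; rewrite IH //.
  apply: (measurableT_comp mg); apply: measurable_cons => //; exact: measurable_cst.
- exact: measurable_lebesgue_int_cons.
- by move=> x _; exact: lebesgue_int_ge0.
Qed.

Lemma gauss_density_cons n (h x : R) (v : n.-tuple R) : (0 < h)%R ->
  gauss_density h [tuple of x :: v] = (normal_pdf 0 (Num.sqrt h) x * gauss_density h v)%R.
Proof.
move=> h0; have s0 : (Num.sqrt h != 0)%R by rewrite gt_eqF // sqrtr_gt0.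
rewrite /gauss_density normal_pdfE // /normal_fun /normal_peak subr0 sqr_sqrtr ?ltW //.
have c0 : (0 < 2 * pi * h)%R by rewrite !mulr_gt0 // pi_gt0.
have -> : (h * pi *+ 2 = 2 * pi * h)%R by rewrite -mulr_natl; ring.
rewrite -[(- (n.+1%:R / 2))%R](_ : (- (1 / 2) + - (n%:R / 2) = _)%R); last first.
  by rewrite -natr1; field.
rewrite powRD; last by apply/implyP => _; rewrite gt_eqF.
rewrite powRN div1r powR12_sqrt ?ltW //.
have -> : (\sum_(i < n.+1) tnth [tuple of x :: v] i ^+ 2 = x ^+ 2 + \sum_(i < n) tnth v i ^+ 2)%R.
  by rewrite big_ord_recl; congr (_ + _)%R; apply: eq_bigr => i _; rewrite tnthS.
have -> : (- (x ^+ 2 + \sum_(i < n) tnth v i ^+ 2) / (2 * h) =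
   - x ^+ 2 / (h *+ 2) + - (\sum_(i < n) tnth v i ^+ 2) / (2 * h))%R.
  by rewrite -[(h *+ 2)%R]mulr_natl; field; exact: lt0r_neq0.
by rewrite expRD; ring.
Qed.

Lemma measurable_gauss_density n (h : R) : measurable_fun setT (@gauss_density R n h).
Proof.
apply: measurable_funM; first exact: measurable_cst.
apply: measurableT_comp => //; apply: measurable_funM; last exact: measurable_cst.
apply: measurableT_comp => //; apply: measurable_sum => i.
by apply: measurable_funX; exact: measurable_tnth.
Qed.

Lemma gauss_density_ge0 n (h : R) (v : n.-tuple R) : (0 <= gauss_density h v)%R.
Proof. by rewrite mulr_ge0 ?powR_ge0 ?expR_ge0. Qed.

Lemma gauss_cons n (h : R) (A : set R) (C : set (n.-tuple R)) : (0 < h)%R ->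
  measurable A -> measurable C ->
  gauss h [set v : n.+1.-tuple R | A (thead v) /\ C [tuple of behead v]] =
  normal_prob 0 (Num.sqrt h) A * gauss h C.
Proof.
move=> h0 mA mC.
have s0 : (Num.sqrt h != 0)%R by rewrite gt_eqF // sqrtr_gt0.
rewrite /gauss /=.
pose k x := (normal_pdf 0 (Num.sqrt h) x * \1_A x)%R.
have k0 x : (0 <= k x)%R by rewrite mulr_ge0 // normal_pdf_ge0.
have mI : measurable_fun setT (fun v : n.-tuple R => (gauss_density h v * \1_C v)%:E).
  apply/measurable_EFinP; apply: measurable_funM; first exact: measurable_gauss_density.
  exact: measurable_indic.
have I0 (v : n.-tuple R) : 0 <= (gauss_density h v * \1_C v)%:E.
  by rewrite lee_fin mulr_ge0 // gauss_density_ge0.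
transitivity (\int[leb]_x ((k x)%:E * gauss h C)).
  apply: eq_integral => x _; rewrite -lebesgue_intZ //.
  congr lebesgue_int; apply/funext => v; rewrite -EFinM gauss_density_cons // /k.
  have -> : \1_[set v : n.+1.-tuple R | A (thead v) /\ C [tuple of behead v]] [tuple of x :: v] =
     (\1_A x * \1_C v)%R :> R.
    have tb : [tuple of behead [tuple of x :: v]] = v by apply: val_inj.
    rewrite !indicE; have [Ax|nAx] := boolP (x \in A); have [Cv|nCv] := boolP (v \in C).
    - by rewrite mul1r; rewrite mem_set //= tb theadE; split; exact: set_mem.
    - by rewrite mulr0 memNset //= tb theadE => -[_ /mem_set]; rewrite (negbTE nCv).
    - by rewrite mul0r memNset //= tb theadE => -[/mem_set]; rewrite (negbTE nAx).
    - by rewrite mul0r memNset //= tb theadE => -[/mem_set]; rewrite (negbTE nAx).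
  by congr EFin; ring.
rewrite ge0_integralZr //.
- congr (_ * _); rewrite /normal_prob [RHS]integral_mkcond; apply: eq_integral => x _.
  by rewrite /k patchE indicE; case: ifP => _; rewrite ?mulr1 ?mulr0.
- apply/measurable_EFinP; apply: measurable_funM; first exact: measurable_normal_pdf.
  exact: measurable_indic.
- by move=> x _; rewrite lee_fin.
- exact: lebesgue_int_ge0.
Qed.

End IteratedLebesgue.

(** * Independence of orthogonal coordinates *)

Section GaussianSplit.
Variables (R : realType) (W V : normedModType R) (q : W -> W -> R) (E : W -> V).
Variables (mu : probability (borel V) R) (h : R).
Hypothesis h0 : 0 < h.
Hypothesis mu_gauss : gaussian_measure q E h mu.
Local Notation gamh := (normal_prob (0 : R) (Num.sqrt h)).

Lemma continuous_borel (y : V -> R) : continuous y ->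
  measurable_fun setT (y : borel V -> R).
Proof.
move=> /continuousP cy.
apply: (@measurability _ _ _ _ _ _ (@RGenOpens.G R)); first exact: RGenOpens.measurableE.
move=> _ [A [a [b ->]] <-]; rewrite setTI; apply: sub_sigma_algebra.
by apply: cy; exact: interval_open.
Qed.

Lemma dual_measurable y b : dual_elt q E y b -> measurable_fun setT (y : borel V -> R).
Proof. by case=> _ cy _; exact: continuous_borel. Qed.

Lemma measurable_mktuple n (y : 'I_n -> V -> R) :
  (forall i, measurable_fun setT (y i : borel V -> R)) ->
  measurable_fun setT (fun x : borel V => [tuple y i x | i < n]).
Proof.
move=> my; apply/measurable_fun_tnthP => i.
rewrite (_ : _ \o _ = y i); first exact: my.
by apply/funext => x /=; rewrite tnth_mktuple.
Qed.

Definition orthonormal_dual n (y : 'I_n -> V -> R) (b : 'I_n -> W) :=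
  (forall i, dual_elt q E (y i) (b i)) /\ forall i j, q (b i) (b j) = (i == j)%:R.

Lemma gauss_law n (y : 'I_n -> V -> R) b : orthonormal_dual y b ->
  forall A : set (n.-tuple R), measurable A ->
   mu [set x | A [tuple y i x | i < n]] = gauss h A.
Proof.
move=> [dy ob] A mA; apply: (mu_gauss (b := [tuple b i | i < n])) => //.
  by move=> i; rewrite tnth_mktuple.
by move=> i j; rewrite !tnth_mktuple.
Qed.

(** Independence of [y0] from the forms orthogonal to it: with [y0] placed in front they form an
    orthonormal system of size [n.+1], whose law factors by [gauss_cons]. *)
Lemma gauss_split n (y : 'I_n -> V -> R) b (y0 : V -> R) (b0 : W) :
  orthonormal_dual y b -> dual_elt q E y0 b0 -> q b0 b0 = 1 ->
  (forall i, q b0 (b i) = 0 /\ q (b i) b0 = 0) ->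
  forall (A : set R) (C : set (n.-tuple R)), measurable A -> measurable C ->
  mu [set x | A (y0 x) /\ C [tuple y i x | i < n]] =
    (gamh A * mu [set x | C [tuple y i x | i < n]])%E.
Proof.
move=> [dy ob] d0 q0 q0i A C mA mC.
rewrite (gauss_law (conj dy ob)) // -gauss_cons //.
pose y' (i : 'I_n.+1) := if unlift ord0 i is Some j then y j else y0.
pose b' (i : 'I_n.+1) := if unlift ord0 i is Some j then b j else b0.
rewrite -(@gauss_law _ y' b'); last 2 first.
- split=> [i|i j]; rewrite /y' /b'; first by case: unliftP.
  case: (unliftP ord0 i) => [i' ->|->]; case: (unliftP ord0 j) => [j' ->|->].
  + by rewrite ob (inj_eq lift_inj).
  + by rewrite (q0i _).2 eq_sym (negbTE (neq_lift _ _)).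
  + by rewrite (q0i _).1 (negbTE (neq_lift _ _)).
  + by rewrite q0 eqxx.
- have mth : measurable_fun setT (fun v : n.+1.-tuple R => thead v).
    exact: measurable_tnth.
  have mbh := @measurable_behead _ R n.
  rewrite (_ : [set v | _] = (fun v : n.+1.-tuple R => thead v) @^-1` A `&`
    (fun v : n.+1.-tuple R => [tuple of behead v]) @^-1` C) //.
  by apply: measurableI; rewrite -[X in measurable X]setTI; [exact: mth | exact: mbh].
congr (mu _); apply/funext => x /=; congr (A _ /\ C _).
  by rewrite /thead tnth_mktuple /y' unlift_none.
apply: eq_from_tnth => i; rewrite tnth_mktuple [RHS]tnth_behead tnth_mktuple /y'.
by rewrite (_ : inord i.+1 = lift ord0 i) ?liftK //; apply: val_inj; rewrite /= inordK // ltnS.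
Qed.

Lemma gauss_split_integral n (y : 'I_n -> V -> R) b (y0 : V -> R) (b0 : W)
   (g : R * n.-tuple R -> \bar R) :
  orthonormal_dual y b -> dual_elt q E y0 b0 -> q b0 b0 = 1 ->
  (forall i, q b0 (b i) = 0 /\ q (b i) b0 = 0) ->
  measurable_fun setT g -> (forall p, 0 <= g p)%E ->
  (\int[mu]_x g (y0 x, [tuple y i x | i < n]) =
   \int[gamh]_z \int[mu]_x g (z, [tuple y i x | i < n]))%E.
Proof.
move=> yb d0 q0 q0i mg g0.
have m0 := dual_measurable d0.
have mY : measurable_fun setT (fun x : borel V => [tuple y i x | i < n]).
  by apply: measurable_mktuple => i; exact: dual_measurable (yb.1 i).
pose Phi (x : borel V) := (y0 x, [tuple y i x | i < n]).
have mPhi : measurable_fun setT Phi by apply: measurable_fun_pair.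
pose YY : {mfun borel V >-> n.-tuple R} :=
  HB.pack (fun x : borel V => [tuple y i x | i < n]) (isMeasurableFun.Build _ _ _ _ _ mY).
pose TR := g_sigma_algebraType R.-ocitv.-measurable.
have mPhi' : measurable_fun setT (Phi : borel V -> (TR * n.-tuple R)%type) by exact: mPhi.
have mg' : measurable_fun setT (g : TR * n.-tuple R -> \bar R) by exact: mg.
pose PP : {mfun borel V >-> (TR * n.-tuple R)%type} :=
  HB.pack (Phi : borel V -> (TR * n.-tuple R)%type) (isMeasurableFun.Build _ _ _ _ _ mPhi').
(* The joint law is the product measure, since both agree on rectangles by [gauss_split]; Tonelli
   then gives the iterated integral. *)
have prodE A : measurable A -> (gamh \x distribution mu YY)%E A = distribution mu PP A.
  move=> mA; apply: product_measure_unique => // B C mB mC.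
  by rewrite /distribution /pushforward /=; exact: (gauss_split yb d0 q0 q0i mB mC).
transitivity (\int[distribution mu PP]_p g p)%E.
  by rewrite ge0_integral_distribution.
transitivity (\int[gamh \x distribution mu YY]_p g p)%E.
  by apply: eq_measure_integral => A mA _; exact/esym/prodE.
rewrite fubini_tonelli1 //; apply: eq_integral => z _.
rewrite /fubini_F ge0_integral_distribution //.
by apply: measurableT_comp => //; exact: measurable_pair1.
Qed.

Local Notation gam := (normal_prob (0 : R) 1).
Local Notation leb := (@lebesgue_measure R).
Local Notation sd := (Num.sqrt h).

Let sd_gt0 : 0 < sd. Proof. by rewrite sqrtr_gt0. Qed.
Let sd_neq0 : sd != 0. Proof. by rewrite gt_eqF. Qed.

Lemma normal_pdf_scale (z : R) : normal_pdf 0 sd (sd * z) * sd = normal_pdf 0 1 z.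
Proof.
rewrite (normal_pdfE 0 sd_neq0) (normal_pdfE 0 (oner_neq0 _)) /normal_peak /normal_fun !subr0 expr1n mul1r.
rewrite exprMn -mulrnAr sqrtrM ?sqr_ge0 // sqrtr_sqr gtr0_norm //.
have p0 : 0 < Num.sqrt (pi *+ 2 : R) by rewrite sqrtr_gt0 mulrn_wgt0 // pi_gt0.
have -> : - (sd ^+ 2 * z ^+ 2) / (sd ^+ 2 *+ 2) = - z ^+ 2 / (1 *+ 2).
  by rewrite -(mulr_natl (sd ^+ 2)) -(mulr_natl 1); field.
by field; rewrite sd_neq0 (gt_eqF p0).
Qed.

Lemma normal_scale_ge0 (f : R -> R) : continuous f -> (forall x, 0 <= f x) ->
  (\int[gamh]_x (f x)%:E = \int[gam]_z (f (sd * z))%:E)%E.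
Proof.
move=> cf f0.
have mf : measurable_fun setT f by exact: continuous_measurable_fun.
have cs : continuous (fun z : R => f (sd * z)).
  by move=> z; apply: (cvg_comp (fun z => sd * z) f); [apply: cvgM; [exact: cvg_cst | exact: cvg_id] | exact: cf].
have mE : measurable_fun setT (EFin \o f) by exact/measurable_EFinP.
have mEs : measurable_fun setT (EFin \o (fun z : R => f (sd * z))).
  by apply/measurable_EFinP; exact: continuous_measurable_fun.
have E0 x : (0 <= (EFin \o f) x)%E by rewrite lee_fin.
have E0s (x : R) : (0 <= (f (sd * x)%R)%:E)%E by rewrite lee_fin.
rewrite (@normal_prob_ge0_integral _ 0 sd _ sd_neq0 mE E0).
rewrite (@normal_prob_ge0_integral _ 0 1 _ (oner_neq0 _) mEs E0s).
pose F (z : R) : R := sd * z.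
have DF (z : R) : is_derive z 1 F sd.
  by apply: is_derive_eq; rewrite /GRing.scale /= mulr1.
have F' : derive1 F = cst sd by apply/funext => z; rewrite derive1E; case: (DF z).
have -> : (\int[leb]_x ((f x)%:E * (normal_pdf 0 sd x)%:E) =
    \int[leb]_x (f x * normal_pdf 0 sd x)%:E)%E by [].
rewrite (@increasing_ge0_integration_by_substitutionT _ F (fun x => f x * normal_pdf 0 sd x)).
- apply: eq_integral => z _; rewrite F' /= -!EFinM; congr EFin.
  rewrite /F -[LHS]/(f (sd * z) * normal_pdf 0 sd (sd * z) * sd) -mulrA; congr (_ * _).
  exact: normal_pdf_scale.
- by move=> x y xy; rewrite /F ltr_pM2l.
- by rewrite F' => x; exact: cvg_cst.
- by rewrite F'; exact: is_cvg_cst.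
- by rewrite F'; exact: is_cvg_cst.
- by move=> z; case: (DF z).
- rewrite (_ : F = fun x => x * sd); last by apply/funext => x; rewrite /F mulrC.
  by apply/gt0_cvgMlNy => //; exact: cvg_id.
- rewrite (_ : F = fun x => x * sd); last by apply/funext => x; rewrite /F mulrC.
  by apply/gt0_cvgMly => //; exact: cvg_id.
- by move=> x; apply: cvgM; [exact: cf | exact: continuous_normal_pdf].
- by move=> x; rewrite mulr_ge0 // normal_pdf_ge0.
Qed.

Lemma norm_le_addr_ge0 (a C : R) : `|a| <= C -> 0 <= a + C.
Proof. by rewrite ler_norml => /andP[]; lra. Qed.

(** Adding the bound [C] makes the integrand nonnegative, which carries Tonelli and the substitution
    formula over to bounded signed functions. *)
Lemma bounded_ge0_shift d' (T : measurableType d') (P : probability T R) (f : T -> R) C :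
  measurable_fun setT f -> (forall x, `|f x| <= C) ->
  \int[P]_x f x = fine (\int[P]_x (f x + C)%:E)%E - C.
Proof.
move=> mf fC; have If := bounded_integrable P mf fC.
have Ic : P.-integrable setT (EFin \o (fun=> C)).
  by apply: (@bounded_integrable _ _ _ _ _ `|C|).
by rewrite -[fine _]/(\int[P]_x (f x + C)) RintegralD // Rintegral_prob_cst addrK.
Qed.

Lemma normal_scale (f : R -> R) C : continuous f -> (forall x, `|f x| <= C) ->
  \int[gamh]_x f x = gauss_mean f sd.
Proof.
move=> cf fC.
have cs : continuous (fun z : R => f (sd * z)).
  by move=> z; apply: (cvg_comp (fun z => sd * z) f); [apply: cvgM; [exact: cvg_cst | exact: cvg_id] | exact: cf].
have mf : measurable_fun setT f by exact: continuous_measurable_fun.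
have ms : measurable_fun setT (fun z : R => f (sd * z)) by exact: continuous_measurable_fun.
rewrite /gauss_mean (bounded_ge0_shift gamh mf fC) (bounded_ge0_shift gam ms (fun z => fC _)).
have <- : (\int[gamh]_x (f x + C)%:E = \int[gam]_z (f (sd * z) + C)%:E)%E; last by [].
apply: (@normal_scale_ge0 (fun x => f x + C)).
  by move=> x; apply: cvgD; [exact: cf | exact: cvg_cst].
by move=> x; exact: norm_le_addr_ge0.
Qed.

Lemma gauss_split_Rintegral n (y : 'I_n -> V -> R) b (y0 : V -> R) (b0 : W)
   (g : R -> n.-tuple R -> R) C :
  orthonormal_dual y b -> dual_elt q E y0 b0 -> q b0 b0 = 1 ->
  (forall i, q b0 (b i) = 0 /\ q (b i) b0 = 0) ->
  measurable_fun setT (fun p : R * n.-tuple R => g p.1 p.2) ->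
  (forall z v, `|g z v| <= C) ->
  \int[mu]_x g (y0 x) [tuple y i x | i < n] =
   \int[gamh]_z \int[mu]_x g z [tuple y i x | i < n].
Proof.
move=> yb d0 q0 q0i mg gC.
have m0 := dual_measurable d0.
have mY : measurable_fun setT (fun x : borel V => [tuple y i x | i < n]).
  by apply: measurable_mktuple => i; exact: dual_measurable (yb.1 i).
have mgz z : measurable_fun setT (fun v => g z v).
  apply: (@measurableT_comp _ _ _ _ _ _ (fun p : R * n.-tuple R => g p.1 p.2) _ (fun v => (z, v))) => //.
  exact: measurable_pair1.
have m1 : measurable_fun setT (fun x : borel V => g (y0 x) [tuple y i x | i < n]).
  apply: (@measurableT_comp _ _ _ _ _ _ (fun p : R * n.-tuple R => g p.1 p.2) _
    (fun x : borel V => (y0 x, [tuple y i x | i < n]))) => //.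
  exact: measurable_fun_pair.
have m2 z : measurable_fun setT (fun x : borel V => g z [tuple y i x | i < n]).
  exact: (measurableT_comp (mgz z) mY).
pose g' (p : R * n.-tuple R) : \bar R := (g p.1 p.2 + C)%:E.
have g'0 p : (0 <= g' p)%E.
  by rewrite lee_fin norm_le_addr_ge0.
have mg' : measurable_fun setT g'.
  by apply/measurable_EFinP; apply: measurable_funD => //; exact: measurable_cst.
have Eg := gauss_split_integral yb d0 q0 q0i mg' g'0.
have Eg' : (\int[mu]_x (g (y0 x) [tuple y i x | i < n] + C)%:E =
    \int[gamh]_z \int[mu]_x g' (z, [tuple y i x | i < n]))%E := Eg.
rewrite (bounded_ge0_shift mu m1 (fun x => gC _ _)) Eg'.
have Ez z : (\int[mu]_x g' (z, [tuple y i x | i < n]) =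
    (\int[mu]_x g z [tuple y i x | i < n] + C)%:E)%E.
  rewrite (bounded_ge0_shift mu (m2 z) (fun x => gC _ _)) subrK fineK //.
  apply: integrable_fin_num => //.
  apply: (EFin_integrableD (bounded_integrable mu (m2 z) (fun x => gC z _))).
  by apply: (@bounded_integrable _ _ _ _ _ `|C|).
under eq_integral do rewrite Ez.
pose I z := \int[mu]_x g z [tuple y i x | i < n].
have mI : measurable_fun setT I.
  have mF : measurable_fun setT (fun z => \int[mu]_x g' (z, [tuple y i x | i < n]))%E.
    apply: (@measurable_fun_fubini_tonelli_F _ _ _ (borel V) R mu
      (fun p => g' (p.1, [tuple y i p.2 | i < n]))) => //.
    have mp : measurable_fun setT (fun p : R * borel V => (p.1, [tuple y i p.2 | i < n])).
      apply: measurable_fun_pair; first exact: measurable_fst.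
      by apply: (measurableT_comp mY); exact: measurable_snd.
    exact: (measurableT_comp mg' mp).
  have -> : I = (fun z => (I z + C) - C) by apply/funext => z; rewrite addrK.
  apply: measurable_funB; last exact: measurable_cst.
  apply/measurable_EFinP; rewrite (_ : EFin \o _ =
    (fun z => \int[mu]_x g' (z, [tuple y i x | i < n]))%E) //.
  by apply/funext => z; rewrite Ez.
rewrite -(bounded_ge0_shift gamh mI (C := C)) // => z.
by apply: Rintegral_norm_le => //; exact: m2.
Qed.

(** The last coordinate is independent of the others: freezing it leaves [navg n] at a translated
    point, and integrating it out is one more [gavg]. *)
Lemma navg_gauss (u : nat -> W) (Y : nat -> V -> R) (w : nat -> R) (f : W -> R) n X :
  (forall i, dual_elt q E (Y i) (u i)) -> (forall i j, q (u i) (u j) = (i == j)%:R) ->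
  BL u w f ->
  \int[mu]_x f (X + \sum_(i < n) Y i x *: u i) = navg u id n sd f X.
Proof.
move=> dY ou Bf; have [C [L [fC _]]] := Bf; have cf := BL_cont Bf.
elim: n X => [|n IH] X.
  under eq_Rintegral do rewrite big_ord0 addr0.
  by rewrite Rintegral_prob_cst.
pose g (z : R) (v : n.-tuple R) := f (X + z *: u n + \sum_(i < n) tnth v i *: u i).
have yb : orthonormal_dual (fun i : 'I_n => Y i) (fun i => u i).
  by split=> [i|i j]; [exact: dY | exact: ou].
have q0i (i : 'I_n) : q (u n) (u i) = 0 /\ q (u i) (u n) = 0.
  by rewrite !ou eq_sym (_ : (i == n :> nat) = false) //; apply/negbTE; rewrite neq_ltn ltn_ord.
have mg : measurable_fun setT (fun p : R * n.-tuple R => g p.1 p.2).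
  apply: (@measurable_caratheodory R _ _ (fun z (p : R * n.-tuple R) => g z p.2) fst).
  - move=> z; apply: (@measurable_lincomb R _ _ W f n (fun i p => tnth p.2 i)) => // i.
    by apply: (@measurableT_comp _ _ _ _ _ _ (fun v : n.-tuple R => tnth v i)) => //;
      exact: measurable_tnth.
  - move=> p z; rewrite /g.
    apply: (@cvg_trans _ ((fun z => f ((X + \sum_(i < n) tnth p.2 i *: u i) + z *: u n)) @ z)).
      by apply: near_eq_cvg; apply: nearW => r; rewrite addrAC.
    by rewrite addrAC; exact: line_continuous.
  - exact: measurable_fst.
have E1 : \int[mu]_x f (X + \sum_(i < n.+1) Y i x *: u i) =
    \int[mu]_x g (Y n x) [tuple Y i x | i < n].
  apply: eq_Rintegral => x _; rewrite /g big_ord_recr /= addrA addrAC.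
  by congr (f (_ + _)); apply: eq_bigr => i _; rewrite tnth_mktuple.
have qn : q (u n) (u n) = 1 by rewrite ou eqxx.
have gC z v : `|g z v| <= C by exact: fC.
rewrite E1 (gauss_split_Rintegral yb (dY n) qn q0i mg gC).
have E2 z : \int[mu]_x g z [tuple Y i x | i < n] = navg u id n sd f (X + z *: u n).
  rewrite -IH; apply: eq_Rintegral => x _; rewrite /g.
  by congr (f (_ + _)); apply: eq_bigr => i _; rewrite tnth_mktuple.
under eq_Rintegral do rewrite E2.
have aN : averaging u w (navg u id n sd) by exact: averaging_navg.
rewrite (normal_scale (C := C)) //.
  by apply: line_continuous; exact: BL_cont (avg_BL aN Bf).
by move=> z; exact: (avg_bound aN).
Qed.

Hypothesis q_scalar : forall y, scalar (q^~ y).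
Hypothesis qC : forall x y, q x y = q y x.
Hypothesis q_lo : forall x, `|x| ^+ 2 <= q x x.
Hypothesis E_dense : dense (range E).

Lemma dual_lin (a c : R) y b y' b' : dual_elt q E y b -> dual_elt q E y' b' ->
  dual_elt q E (fun x => a * y x + c * y' x) (a *: b + c *: b').
Proof.
move=> [ly cy yE] [ly' cy' yE']; split.
- move=> k x x'; rewrite ly ly' /GRing.scale /=; ring.
- by move=> x; apply: cvgD; apply: cvgM; [exact: cvg_cst | exact: cy | exact: cvg_cst | exact: cy'].
- by move=> x; rewrite yE yE' (qDl q_scalar) !(qZl q_scalar).
Qed.

Lemma dual_zero y : dual_elt q E y 0 -> forall x, y x = 0.
Proof.
move=> [_ cy yE] x; apply/eqP; rewrite -normr_le0; apply/ler_addgt0Pr => e e0.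
have : \forall z \near x, `|y x - y z| <= e by move/cvgrPdist_le : (cy x) => /(_ e e0).
move=> /nbhs_ballP [r /= r0 Br].
have [] := @E_dense (ball x r); [by exists x; exact: ballxx | exact: ball_open |].
move=> v [xr [z _ zv]]; have := Br _ xr.
by rewrite /= -zv yE (q0l q_scalar) subr0 add0r.
Qed.

Lemma gauss_sqr_fin : ((\int[gam]_z (z ^+ 2))%:E = \int[gam]_z (z ^+ 2)%:E)%E.
Proof.
exact: (fineK (integrable_fin_num measurableT (@std_normal_integrable_sqr R))).
Qed.

(** The variance of a normalised coordinate, with the second moment of the standard normal law left
    unevaluated. *)
Definition gvar := h * \int[gam]_z (z ^+ 2).

Lemma gvar_ge0 : 0 <= gvar.
Proof.
by apply: mulr_ge0; [exact: ltW | apply: Rintegral_ge0 => z _; exact: sqr_ge0].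
Qed.

Lemma second_moment y b : dual_elt q E y b ->
  (\int[mu]_x ((y x) ^+ 2)%:E = (gvar * q b b)%:E)%E.
Proof.
move=> dy; have [b0|b0] := eqVneq b 0.
  rewrite b0 in dy *; rewrite (q0l q_scalar) mulr0.
  by under eq_integral do rewrite (dual_zero dy) expr0n /=; rewrite integral0.
have qb : 0 < q b b by apply: lt_le_trans (q_lo b); rewrite exprn_gt0 // normr_gt0.
pose s := Num.sqrt (q b b); have s0 : 0 < s by rewrite sqrtr_gt0.
have d1 := dual_lin s^-1 0 dy dy.
have q1 : q (s^-1 *: b + 0 *: b) (s^-1 *: b + 0 *: b) = 1.
  rewrite scale0r addr0 (qZl q_scalar) (qZr qC q_scalar) mulrA -invfM -expr2 sqr_sqrtr ?ltW //.
  by rewrite mulVf // gt_eqF.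
(* With an empty family of other coordinates, the splitting identity yields the law of the
   normalised form alone. *)
have yb0 : orthonormal_dual (fun i : 'I_0 => y) (fun i : 'I_0 => b) by split=> -[].
have q0i (i : 'I_0) : q (s^-1 *: b + 0 *: b) b = 0 /\ q b (s^-1 *: b + 0 *: b) = 0 by case: i.
have msq : measurable_fun setT (fun p : R * 0.-tuple R => (p.1 ^+ 2)%:E).
  by apply/measurable_EFinP; apply: measurable_funX; exact: measurable_fst.
have sq0 (p : R * 0.-tuple R) : (0 <= (p.1 ^+ 2)%:E)%E by rewrite lee_fin sqr_ge0.
have Eg := gauss_split_integral yb0 d1 q1 q0i msq sq0.
have E1 z : (\int[mu]_x (((z : R), [tuple y x | i < 0]).1 ^+ 2)%:E = (z ^+ 2)%:E)%E.
  by rewrite /= integral_cst //= probability_setT mule1.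
have E3 : (\int[gamh]_z \int[mu]_x (((z : R), [tuple y x | i < 0]).1 ^+ 2)%:E =
    \int[gamh]_z (z ^+ 2)%:E)%E by apply: eq_integral => z _; exact: E1.
rewrite E3 in Eg.
have csq : continuous (fun x : R => x ^+ 2) by move=> x; exact: exprn_continuous.
rewrite (normal_scale_ge0 csq (fun x => sqr_ge0 x)) in Eg.
have E2 : (\int[gam]_z ((sd * z) ^+ 2)%:E = gvar%:E)%E.
  under eq_integral do rewrite exprMn sqr_sqrtr ?ltW // EFinM.
  rewrite integralZl //; last exact: std_normal_integrable_sqr.
  have <- : ((\int[gam]_z (z ^+ 2))%:E = \int[gam]_z (z ^+ 2)%:E)%E.
    exact: gauss_sqr_fin.
  by rewrite -EFinM.
rewrite E2 in Eg.
have -> : (fun x => (y x ^+ 2)%:E) = (fun x => (s ^+ 2)%:E * ((s^-1 * y x + 0 * y x) ^+ 2)%:E)%E.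
  apply/funext => x; rewrite -EFinM mul0r addr0 exprMn mulrA -exprMn mulfV ?gt_eqF //.
  by rewrite expr1n mul1r.
rewrite ge0_integralZl //.
- by rewrite Eg -EFinM sqr_sqrtr ?ltW // mulrC.
- by apply/measurable_EFinP; apply: measurable_funX; exact: dual_measurable d1.
- by move=> x _; rewrite lee_fin sqr_ge0.
- by rewrite lee_fin sqr_ge0.
Qed.

End GaussianSplit.

(** * Hahn-Banach and the Borel sets of a separable space *)

Section HahnBanach.
Variables (R : realType) (V : normedModType R).

Definition sublinear (p : V -> R) :=
  (forall x y, p (x + y) <= p x + p y) /\
  (forall t x, 0 <= t -> p (t *: x) <= t * p x).

Lemma sublinear0 p : sublinear p -> p 0 = 0.
Proof.
move=> [pD pZ]; apply/eqP; rewrite eq_le; apply/andP; split.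
  by have := pZ 0 0 (lexx _); rewrite scale0r mul0r.
by have := pD 0 0; rewrite addr0; lra.
Qed.

Lemma sublinear_oppr_ge p x : sublinear p -> 0 <= p x + p (- x).
Proof. by move=> sp; rewrite -(sublinear0 sp) -(subrr x); exact: sp.1. Qed.

(* The largest sublinear form below p whose value at -x is at most -p x. *)
Definition tilt (p : V -> R) (x y : V) : R :=
  inf [set p (y + t *: x) - t * p x | t in [set t | 0 <= t]].

Lemma tilt_lb p x y : sublinear p ->
  lbound [set p (y + t *: x) - t * p x | t in [set t | 0 <= t]] (- p (- y)).
Proof.
move=> sp _ [t /= t0 <-].
have := sp.1 (y + t *: x) (- y); rewrite addrAC subrr add0r.
have [->|tn0] := eqVneq t 0.
  by rewrite scale0r addr0 mul0r (sublinear0 sp); lra.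
have tp : 0 < t by rewrite lt_neqAle eq_sym tn0.
have := sp.2 t^-1 (t *: x); rewrite invr_ge0 scalerA mulVf // scale1r => /(_ t0).
rewrite mulrC ler_pdivlMr // mulrC; lra.
Qed.

Lemma tilt_le p x y t : sublinear p -> 0 <= t -> tilt p x y <= p (y + t *: x) - t * p x.
Proof.
move=> sp t0; apply: ge_inf; first by exists (- p (- y)); exact: tilt_lb.
by exists t.
Qed.

Lemma tilt_ge (p : V -> R) x y (c : R) :
  (forall t, 0 <= t -> c <= p (y + t *: x) - t * p x) -> c <= tilt p x y.
Proof.
move=> cp; apply: lb_le_inf; last by move=> _ [t /= t0 <-]; exact: cp.
by exists (p (y + 0 *: x) - 0 * p x); exists 0 => //=.
Qed.

Lemma tilt_le_self p x y : sublinear p -> tilt p x y <= p y.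
Proof.
by move=> sp; have := tilt_le x y sp (lexx 0); rewrite scale0r addr0 mul0r subr0.
Qed.

Lemma tilt_opp p x : sublinear p -> tilt p x (- x) <= - p x.
Proof.
move=> sp; have := tilt_le x (- x) sp (ler01 : 0 <= 1).
by rewrite scale1r addNr (sublinear0 sp) mul1r sub0r.
Qed.

Lemma sublinear_tilt p x : sublinear p -> sublinear (tilt p x).
Proof.
move=> sp; split=> [y z|s y s0].
  rewrite -lerBlDr; apply: tilt_ge => t t0; rewrite lerBlDr -lerBlDl.
  apply: tilt_ge => t' t'0; rewrite lerBlDl.
  apply: (le_trans (tilt_le x _ sp (addr_ge0 t0 t'0))).
  have := sp.1 (y + t *: x) (z + t' *: x).
  by rewrite addrACA -scalerDl; lra.
have [->|sn0] := eqVneq s 0.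
  by rewrite scale0r mul0r -(sublinear0 sp); exact: tilt_le_self.
have sp0 : 0 < s by rewrite lt_neqAle eq_sym sn0.
rewrite -ler_pdivrMl //; apply: tilt_ge => t t0; rewrite ler_pdivrMl //.
apply: (le_trans (tilt_le x _ sp (mulr_ge0 s0 t0))).
have := sp.2 s (y + t *: x) s0; rewrite scalerDr scalerA; lra.
Qed.

(** A minimal [p] equals all its tilts, and the tilt at [x] gives [p (- x) <= - p x]; the reverse
    inequality is sublinearity. *)
Lemma minimal_sublinear_opp p x : sublinear p ->
  (forall p', sublinear p' -> (forall y, p' y <= p y) -> p' = p) -> p (- x) = - p x.
Proof.
move=> sp pmin.
have e : tilt p x = p.
  by apply: pmin; [exact: sublinear_tilt | move=> y; exact: tilt_le_self].
have := tilt_opp x sp; rewrite e.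
have := sublinear_oppr_ge x sp; lra.
Qed.

Lemma minimal_sublinear p0 : sublinear p0 ->
  exists p, [/\ sublinear p, forall y, p y <= p0 y &
   forall p', sublinear p' -> (forall y, p' y <= p y) -> p' = p].
Proof.
move=> sp0.
pose P p := sublinear p /\ forall y, p y <= p0 y.
pose T := {p : V -> R | P p}.
(* The order is reversed, so that a maximal element in Zorn's lemma is a pointwise minimal form. *)
pose leT (s t : T) := `[< forall y, sval t y <= sval s y >].
have [||s t /asboolP st /asboolP ts|A totA|[p [sp pp0]] pmin] := @Zorn T leT.
- by move=> t; apply/asboolP.
- by move=> r s t /asboolP rs /asboolP st; apply/asboolP => y; exact: le_trans (st y) (rs y).
- case: s t st ts => [s Ps] [t Pt] /= st ts.
  have e : s = t by apply/funext => y; apply/eqP; rewrite eq_le ts st.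
  by case: _ / e Pt {st ts} => Pt; congr exist; exact: Prop_irrelevance.
- have [[a0 Aa0]|A0] := pselect (exists a, A a); last first.
    by exists (exist _ p0 (conj sp0 (fun y => lexx _))) => s As; case: A0; exists s.
  (* The pointwise infimum is finite by the bound [- p0 (- y)]. It is subadditive because, of two
     members of the chain, the smaller one serves for both arguments. *)
  pose S y := [set sval a y | a in A].
  have lbS y : lbound (S y) (- p0 (- y)).
    move=> _ [[a [sa ap]] _ <-] /=; have := sublinear_oppr_ge y sa; have := ap (- y); lra.
  have inf_le a y : A a -> inf (S y) <= sval a y.
    by move=> Aa; apply: ge_inf; [exists (- p0 (- y)) | exists a].
  have inf_ge c y : (forall a, A a -> c <= sval a y) -> c <= inf (S y).
    move=> ca; apply: lb_le_inf; first by exists (sval a0 y), a0.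
    by move=> _ [a Aa <-]; exact: ca.
  have Pinf : P (fun y => inf (S y)).
    split; last first.
      by move=> y; apply: le_trans (inf_le a0 y Aa0) _; exact: (svalP a0).2.
    split=> [y z|t y t0].
      rewrite -lerBlDr; apply: (inf_ge) => a Aa; rewrite lerBlDr -lerBlDl.
      apply: (inf_ge) => b Ab; rewrite lerBlDl.
      have [/asboolP ab|/asboolP ba] := totA a b Aa Ab.
        apply: le_trans (inf_le b _ Ab) _; apply: le_trans ((svalP b).1.1 y z) _.
        by rewrite lerD2r.
      apply: le_trans (inf_le a _ Aa) _; apply: le_trans ((svalP a).1.1 y z) _.
      by rewrite lerD2l.
    have [->|tn0] := eqVneq t 0.
      rewrite scale0r mul0r; apply: le_trans (inf_le a0 _ Aa0) _.
      by rewrite (sublinear0 (svalP a0).1).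
    have tp : 0 < t by rewrite lt_neqAle eq_sym tn0.
    rewrite -ler_pdivrMl //; apply: (inf_ge) => a Aa; rewrite ler_pdivrMl //.
    by apply: le_trans (inf_le a _ Aa) _; exact: (svalP a).1.2.
  exists (exist _ _ Pinf) => a Aa; apply/asboolP => y /=; exact: inf_le.
- exists p; split=> // p' sp' p'p.
  have Pp' : P p' by split=> // y; exact: le_trans (p'p y) (pp0 y).
  have := pmin (exist _ p' Pp'); rewrite /leT /=.
  by move=> /(_ (asboolT p'p)) [].
Qed.

(** A minimal sublinear form is odd, and an odd sublinear form is linear. *)
Lemma hahn_banach p0 : sublinear p0 -> exists2 f : V -> R, scalar f & forall y, f y <= p0 y.
Proof.
move=> /minimal_sublinear [p [sp pp0 pmin]]; exists p => //.
have pN x : p (- x) = - p x by exact: minimal_sublinear_opp.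
have pD x y : p (x + y) = p x + p y.
  apply/eqP; rewrite eq_le sp.1 /=.
  have := sp.1 (- x) (- y); rewrite -opprD !pN; lra.
have pZ0 t x : 0 <= t -> p (t *: x) = t * p x.
  move=> t0; apply/eqP; rewrite eq_le sp.2 //=.
  have := sp.2 t (- x) t0; rewrite scalerN !pN; lra.
move=> k x y; rewrite pD; congr (_ + _).
have [k0|k0] := leP 0 k; first exact: pZ0.
rewrite -[k in LHS]opprK scaleNr pN pZ0 ?oppr_ge0 1?ltW //.
by rewrite mulNr opprK.
Qed.

Lemma scalar_addr (f : V -> R) x y : scalar f -> f (x + y) = f x + f y.
Proof. by move=> sf; have := sf 1 x y; rewrite scale1r /GRing.scale /= mul1r. Qed.

Lemma scalar_zero (f : V -> R) : scalar f -> f 0 = 0.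
Proof. by move=> sf; have := scalar_addr 0 0 sf; rewrite addr0; lra. Qed.

Lemma scalar_scale (f : V -> R) k x : scalar f -> f (k *: x) = k * f x.
Proof. by move=> sf; rewrite -[k *: x]addr0 sf (scalar_zero sf) addr0. Qed.

Lemma scalar_subr (f : V -> R) x y : scalar f -> f (x - y) = f x - f y.
Proof. by move=> sf; rewrite (scalar_addr _ _ sf) -scaleN1r (scalar_scale _ _ sf) mulN1r. Qed.

Lemma bounded_scalar_continuous (f : V -> R) (C : R) : scalar f ->
  (forall x, `|f x| <= C * `|x|) -> continuous f.
Proof.
move=> sf fC x; apply/cvgrPdist_le => e e0.
have C0 : 0 < `|C| + 1 by rewrite ltr_wpDl.
near=> y; rewrite -(scalar_subr _ _ sf); apply: (le_trans (fC _)).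
apply: (@le_trans _ _ ((`|C| + 1) * `|x - y|)).
  by rewrite ler_wpM2r //; have := ler_norm C; lra.
rewrite -ler_pdivlMl //; near: y.
by apply: cvgr_dist_le; [exact: cvg_id | rewrite mulr_gt0 ?invr_gt0].
Unshelve. all: by end_near.
Qed.

(** Apply the previous theorem to the tilt of the norm at [d]: its value at [- d] is at most
    [- |d|], which forces [f d = |d|]. *)
Lemma norming_functional (d : V) : exists f : V -> R,
  [/\ scalar f, forall x, `|f x| <= `|x| & f d = `|d|].
Proof.
have sn : sublinear (fun x : V => `|x|).
  split=> [x y|t x t0]; first exact: ler_normD.
  by rewrite normrZ ger0_norm.
have [f sf fle] := hahn_banach (sublinear_tilt d sn).
have fn x : f x <= `|x| by apply: le_trans (fle x) (tilt_le_self _ _ sn).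
have fN x : f (- x) = - f x by rewrite -scaleN1r (scalar_scale _ _ sf) mulN1r.
exists f; split=> //.
  by move=> x; rewrite ler_norml fn andbT; have := fn (- x); rewrite normrN fN; lra.
apply/eqP; rewrite eq_le fn /=.
have := le_trans (fle (- d)) (tilt_opp d sn); rewrite fN; lra.
Qed.

End HahnBanach.

(** * Half-spaces generate the Borel sets of a separable normed space *)

Section BorelGenerated.
Variables (R : realType) (V : normedModType R) (D : nat -> V) (y : nat -> V -> R).
Hypothesis D_dense : dense (range D).
Hypothesis y_scalar : forall n, scalar (y n).
Hypothesis y_le : forall n x, `|y n x| <= `|x|.
Hypothesis y_norm : forall n, y n (D n) = `|D n|.

Lemma dense_approx (x : V) (r : R) : 0 < r -> exists n, `|x - D n| < r.
Proof.
move=> r0; have [z [xz [n _ nz]]] := D_dense (ex_intro _ x (ballxx x r0)) (ball_open x r).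
have xz' : ball x r z := xz; exists n; rewrite nz.
by move: xz'; rewrite -ball_normE.
Qed.

(** The form that norms [D n] almost norms every point close to [D n], so countably many forms
    recover the norm of [x - c]. *)
Lemma norming_ball (c : V) (r : R) :
  [set x | `|x - c| <= r] = \bigcap_n [set x | y n x <= r + y n c].
Proof.
apply/seteqP; split=> [x /= xr n _|x /= xr].
  rewrite /= -lerBlDr -(scalar_subr _ _ (@y_scalar n)).
  exact: le_trans (ler_norm _) (le_trans (y_le _ _) xr).
apply/ler_addgt0Pr => e e0; have [n xn] := dense_approx (x - c) (divr_gt0 e0 (ltr0Sn _ 1)).
have := xr n I; rewrite /= -lerBlDr -(scalar_subr _ _ (@y_scalar n)) => yr.
have : `|x - c| <= `|D n| + `|x - c - D n|.
  by rewrite -[in X in X <= _](subrK (D n) (x - c)) addrC; exact: ler_normD.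
have : y n (D n - (x - c)) <= `|x - c - D n|.
  by rewrite distrC; exact: le_trans (ler_norm _) (y_le _ _).
rewrite (scalar_subr _ _ (@y_scalar n)) y_norm; lra.
Qed.

(** Every open set is a countable union of closed balls with centres [D n] and radii [k.+1%:R^-1],
    and each ball is a countable intersection of half-spaces. *)
Lemma borel_generated (G : set (set V)) : sigma_algebra setT G ->
  (forall n (r : R), G [set x | y n x <= r]) -> (@open V) `<=` G.
Proof.
move=> [G0 GC GU] Gy U oU.
have GI (A : nat -> set V) : (forall n, G (A n)) -> G (\bigcap_n A n).
  move=> GA; rewrite -[X in G X]setCK -setTD; apply: (GC).
  by rewrite setC_bigcap; apply: (GU) => n; rewrite -setTD; exact: GC.
have GT : G setT by rewrite -setC0 -setTD; exact: GC.
have Gball c r : G [set x | `|x - c| <= r].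
  by rewrite norming_ball; apply: GI => n; exact: Gy.
pose A (n k : nat) : set V := [set x | `|x - D n| <= k.+1%:R^-1].
pose A' n k := if `[< A n k `<=` U >] then A n k else set0.
have -> : U = \bigcup_n \bigcup_k A' n k.
  apply/seteqP; split=> [x Ux|x [n _ [k _]]]; last first.
    by rewrite /A'; case: asboolP => // AU; exact: AU.
  have /nbhs_ballP [r /= r0 rU] : nbhs x U by rewrite nbhsE; exists U.
  have [k kr] : exists k : nat, k.+1%:R^-1 < r / 2.
    have [k _ /(_ _ (leqnn _)) hk] := near_infty_natSinv_lt (PosNum (divr_gt0 r0 (ltr0Sn _ 1))).
    by exists k.
  have k0 : (0 : R) < k.+1%:R^-1 by rewrite invr_gt0 ltr0n.
  have [n xn] := dense_approx x k0.
  exists n => //; exists k => //; rewrite /A' asboolT; first exact: ltW.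
  move=> z /= zn; apply: rU; rewrite -ball_normE /=.
  have zn' : `|z - D n| <= k.+1%:R^-1 by [].
  apply: (le_lt_trans (ler_distD (D n) x z)); rewrite (distrC (D n) z) (splitr r).
  exact: ltrD (lt_trans xn kr) (le_lt_trans zn' kr).
apply: (GU) => n; apply: (GU) => k; rewrite /A'; case: asboolP => // _; exact: Gball.
Qed.

End BorelGenerated.

(** * Quasi-invariance under the shifts of H *)

Section GramSchmidt.
Variables (R : realType) (W V : normedModType R) (q : W -> W -> R) (E : W -> V).
Hypothesis q_scalar : forall y, scalar (q^~ y).
Hypothesis qC : forall x y, q x y = q y x.
Hypothesis q_lo : forall x, `|x| ^+ 2 <= q x x.
Hypothesis E_dense : dense (range E).
Implicit Types (y z : nat -> V -> R) (b c : nat -> W).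

Lemma dual_elt0 : dual_elt q E (fun=> 0) 0.
Proof.
split=> [k x x'||x]; first by rewrite /GRing.scale /= mulr0 addr0.
- exact: cst_continuous.
- by rewrite (q0l q_scalar).
Qed.

Lemma dual_elt_sum n y b (a : nat -> R) : (forall i, (i < n)%N -> dual_elt q E (y i) (b i)) ->
  dual_elt q E (fun x => \sum_(i < n) a i * y i x) (\sum_(i < n) a i *: b i).
Proof.
elim: n => [|n IH] dy.
  rewrite big_ord0 (_ : (fun x => _) = fun=> 0); first exact: dual_elt0.
  by apply/funext => x; rewrite big_ord0.
have := dual_lin q_scalar 1 (a n) (IH (fun i ni => dy i (ltnW ni))) (dy n (ltnSn n)).
rewrite big_ord_recr /= scale1r (_ : (fun x => 1 * _ + _) =
  (fun x => \sum_(i < n.+1) a i * y i x)) //.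
by apply/funext => x; rewrite big_ord_recr /= mul1r.
Qed.

Definition orthonormal_upto k z c :=
  (forall j, (j < k)%N -> dual_elt q E (z j) (c j)) /\
  (forall i j, (i < k)%N -> (j < k)%N -> q (c i) (c j) = (i == j)%:R).

Lemma q_sum_onb k z c (a : nat -> R) j : orthonormal_upto k z c -> (j < k)%N ->
  q (\sum_(i < k) a i *: c i) (c j) = a j.
Proof.
move=> [_ oc] jk; rewrite (q_suml q_scalar (fun i : 'I_k => a i)).
rewrite (bigD1 (Ordinal jk)) //= oc // eqxx mulr1 big1 ?addr0 // => i ij.
by rewrite oc // -val_eqE /= in ij *; rewrite (negbTE ij) mulr0.
Qed.

(** The size [k] may be less than [n]: when the remainder [r] vanishes, the form it represents
    vanishes too by [dual_zero], and nothing is added. The last clause, orthogonality to the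
    original vectors passing to the new ones, is what isolates the direction of a translation
    later. *)
Lemma gram_schmidt n y b : (forall i, (i < n)%N -> dual_elt q E (y i) (b i)) ->
  exists k z c, [/\ orthonormal_upto k z c,
    forall i, (i < n)%N -> exists a : nat -> R,
      (forall x, y i x = \sum_(j < k) a j * z j x) /\ b i = \sum_(j < k) a j *: c j &
    forall v, (forall i, (i < n)%N -> q v (b i) = 0) -> forall j, (j < k)%N -> q v (c j) = 0].
Proof.
elim: n => [|n IH] dy.
  by exists 0%N, (fun _ _ => 0), (fun=> 0); split.
have [k [z [c [[dz oc] yz vc]]]] := IH (fun i ni => dy i (ltnW ni)).
pose a0 j := q (b n) (c j).
pose r := b n - \sum_(j < k) a0 j *: c j.
pose yr x := y n x - \sum_(j < k) a0 j * z j x.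
have dr : dual_elt q E yr r.
  have := dual_lin q_scalar 1 (-1) (dy n (ltnSn n)) (dual_elt_sum a0 dz).
  rewrite scale1r scaleN1r (_ : (fun x => _) = yr) //.
  by apply/funext => x; rewrite mul1r mulN1r.
have rc j : (j < k)%N -> q r (c j) = 0.
  by move=> jk; rewrite (qBl q_scalar) (q_sum_onb _ (conj dz oc)) // subrr.
have vr v : (forall i, (i < n.+1)%N -> q v (b i) = 0) -> q v r = 0.
  move=> vb; rewrite (qBr qC q_scalar) vb // qC (q_suml q_scalar (fun j : 'I_k => a0 j)).
  rewrite big1 ?subr0 // => j _; rewrite qC (vc v) ?mulr0 // => i ni.
  by apply: vb; exact: ltnW.
have [r0|r0] := eqVneq r 0.
  exists k, z, c; split=> // [i|v vb j jk].
    rewrite ltnS leq_eqVlt => /orP[/eqP ->|/yz //]; exists a0; split.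
      move=> x; apply/eqP; rewrite -subr_eq0; apply/eqP.
      by rewrite r0 in dr; exact: (dual_zero q_scalar E_dense dr x).
    by apply/eqP; rewrite -subr_eq0; exact/eqP.
  by apply: vc => // i ni; apply: vb; exact: ltnW.
have qr : 0 < q r r by apply: lt_le_trans (q_lo r); rewrite exprn_gt0 // normr_gt0.
pose s := Num.sqrt (q r r); have s0 : 0 < s by rewrite sqrtr_gt0.
have sn0 : s != 0 by rewrite gt_eqF.
pose z' j := if j == k then (fun x => s^-1 * yr x) else z j.
pose c' j := if j == k then s^-1 *: r else c j.
have z'k j : (j < k)%N -> z' j = z j by move=> jk; rewrite /z' ltn_eqF.
have c'k j : (j < k)%N -> c' j = c j by move=> jk; rewrite /c' ltn_eqF.
have sumz (a : nat -> R) x : \sum_(j < k.+1) a j * z' j x =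
    \sum_(j < k) a j * z j x + a k * (s^-1 * yr x).
  rewrite big_ord_recr /= /z' eqxx; congr (_ + _); apply: eq_bigr => j _.
  by rewrite ltn_eqF.
have sumc (a : nat -> R) : \sum_(j < k.+1) a j *: c' j =
    \sum_(j < k) a j *: c j + a k *: (s^-1 *: r).
  rewrite big_ord_recr /= /c' eqxx; congr (_ + _); apply: eq_bigr => j _.
  by rewrite ltn_eqF.
exists k.+1, z', c'; split.
- split=> [j|i j].
    rewrite ltnS leq_eqVlt => /orP[/eqP ->|jk]; last by rewrite z'k // c'k //; exact: dz.
    rewrite /z' /c' eqxx; have := dual_lin q_scalar s^-1 0 dr dr.
    rewrite scale0r addr0 (_ : (fun x => _) = (fun x => s^-1 * yr x)) //.
    by apply/funext => x; rewrite mul0r addr0.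
  have lt_split (l : nat) : (l < k.+1)%N -> l = k \/ (l < k)%N.
    by rewrite ltnS leq_eqVlt => /orP[/eqP|]; [left | right].
  move=> /lt_split[->|ik] /lt_split[->|jk].
  + rewrite /c' !eqxx (qZl q_scalar) (qZr qC q_scalar) mulrA -invfM -expr2.
    by rewrite sqr_sqrtr ?ltW // mulVf // gt_eqF.
  + by rewrite (c'k _ jk) /c' eqxx (qZl q_scalar) rc // mulr0 gtn_eqF.
  + by rewrite (c'k _ ik) /c' eqxx (qZr qC q_scalar) qC rc // mulr0 ltn_eqF.
  + by rewrite !c'k // oc.
- move=> i; rewrite ltnS leq_eqVlt => /orP[/eqP ->|/yz [a [ya ba]]].
    exists (fun j => if j == k then s else a0 j); split.
      move=> x; rewrite (sumz (fun j => if j == k then s else a0 j) x) /= eqxx mulVKf //.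
      under eq_bigr => j _ do rewrite ltn_eqF //.
      by rewrite /yr addrC subrK.
    rewrite (sumc (fun j => if j == k then s else a0 j)) /= eqxx scalerA mulfV // scale1r.
    under eq_bigr => j _ do rewrite ltn_eqF //.
    by rewrite /r addrC subrK.
  exists (fun j => if j == k then 0 else a j); split.
    move=> x; rewrite (sumz (fun j => if j == k then 0 else a j) x) /= eqxx mul0r addr0 ya.
    by apply: eq_bigr => j _; rewrite ltn_eqF.
  rewrite (sumc (fun j => if j == k then 0 else a j)) /= eqxx scale0r addr0 ba.
  by apply: eq_bigr => j _; rewrite ltn_eqF.
- move=> v vb j; rewrite ltnS leq_eqVlt => /orP[/eqP ->|jk].
    by rewrite /c' eqxx (qZr qC q_scalar) vr // mulr0.
  by rewrite c'k //; apply: vc => // i ni; apply: vb; exact: ltnW.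
Qed.

End GramSchmidt.

Lemma sum_ord_sub (U : zmodType) (g : nat -> U) m n : (n <= m)%N ->
  \sum_(i < m) g i - \sum_(i < n) g i = \sum_(i < m) (if (i < n)%N then 0 else g i).
Proof.
move=> /subnK <-; elim: (m - n)%N => [|d IH].
  by rewrite add0n subrr big1 // => i _; rewrite ltn_ord.
rewrite addSn !big_ord_recr /= addrAC IH ltnNge leq_addl //.
Qed.

(** * Riesz representation along an orthonormal basis *)

Section Riesz.
Variables (R : realType) (W : normedModType R) (q : W -> W -> R) (u : nat -> W).
Hypothesis qC : forall x y, q x y = q y x.
Hypothesis q_scalar : forall y, scalar (q^~ y).
Hypothesis q_lo : forall x, `|x| ^+ 2 <= q x x.
Hypothesis q_hi : forall x, q x x <= 2 * `|x| ^+ 2.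
Hypothesis u_on : forall i j, q (u i) (u j) = (i == j)%:R.
Hypothesis u_dense : dense (linspan (range u)).
Hypothesis W_complete : forall b : nat -> W,
  (forall e : R, 0 < e -> exists N, forall m n, (N <= n)%N -> (n <= m)%N -> `|b m - b n| <= e) ->
  cvgn b.

(** With [bn n] the partial sum of coefficients [f (u i)], one has [f (bn n) = s n] and
    [|bn n| ^+ 2 <= s n], so [s n <= |C| ^+ 2]. The coefficients are thus square summable and [bn]
    is Cauchy; its limit has the right products with every [u j]. *)
Lemma riesz (f : W -> R) (C : R) : scalar f -> (forall x, `|f x| <= C * `|x|) ->
  exists b, forall x, f x = q x b.
Proof.
move=> sf fC; have cf := bounded_scalar_continuous sf fC.
have C0 : 0 <= `|C| by [].
have {}fC x : `|f x| <= `|C| * `|x|.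
  by apply: le_trans (fC x) _; rewrite ler_wpM2r // ler_norm.
pose c i := f (u i).
pose bn n := \sum_(i < n) c i *: u i.
pose s n := \sum_(i < n) c i ^+ 2.
have fsum (a : nat -> R) n : f (\sum_(i < n) a i *: u i) = \sum_(i < n) a i * c i.
  elim: n => [|n IH]; first by rewrite !big_ord0 (scalar_zero sf).
  by rewrite !big_ord_recr /= (scalar_addr _ _ sf) (scalar_scale _ _ sf) IH.
have fbn n : f (bn n) = s n.
  by rewrite /bn fsum; apply: eq_bigr => i _; rewrite expr2.
have qu (a : nat -> R) n j : q (\sum_(i < n) a i *: u i) (u j) = if (j < n)%N then a j else 0.
  rewrite (q_suml q_scalar (fun i : 'I_n => a i)); case: ifP => jn.
    rewrite (bigD1 (Ordinal jn)) //= u_on eqxx mulr1 big1 ?addr0 // => i ij.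
    by rewrite u_on -val_eqE /= in ij *; rewrite (negbTE ij) mulr0.
  rewrite big1 // => i _; rewrite u_on; case: eqP => [ij|]; last by rewrite mulr0.
  by move: jn; rewrite -ij ltn_ord.
have qsum (a : nat -> R) n : q (\sum_(i < n) a i *: u i) (\sum_(i < n) a i *: u i) =
    \sum_(i < n) a i ^+ 2.
  rewrite (q_suml q_scalar (fun i : 'I_n => a i)); apply: eq_bigr => i _.
  by rewrite qC qu ltn_ord expr2.
have s0 n : 0 <= s n by apply: sumr_ge0 => i _; exact: sqr_ge0.
have bn_le n : `|bn n| ^+ 2 <= s n by apply: le_trans (q_lo _) _; rewrite qsum.
have sC n : s n <= `|C| ^+ 2.
  have [->|sn0] := eqVneq (s n) 0; first exact: sqr_ge0.
  have sp : 0 < s n by rewrite lt_neqAle eq_sym sn0 s0.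
  rewrite -(ler_pM2r sp) -expr2; apply: (@le_trans _ _ (`|C| ^+ 2 * `|bn n| ^+ 2)).
    rewrite -exprMn ler_sqr ?nnegrE ?mulr_ge0 //.
    by have := fC (bn n); rewrite fbn ger0_norm.
  by rewrite ler_wpM2l ?sqr_ge0.
have s_nd : nondecreasing_seq s.
  by apply/nondecreasing_seqP => n; rewrite /s big_ord_recr /= lerDl sqr_ge0.
have s_cvg : cvgn s.
  by apply: nondecreasing_is_cvgn => //; exists (`|C| ^+ 2) => _ [n _ <-].
have sub_bn m n : (n <= m)%N -> `|bn m - bn n| ^+ 2 <= s m - s n.
  move=> nm; pose a i := if (i < n)%N then 0 else c i.
  have -> : bn m - bn n = \sum_(i < m) a i *: u i.
    rewrite /bn (sum_ord_sub (fun i => c i *: u i) nm); apply: eq_bigr => i _.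
    by rewrite /a; case: ifP; rewrite ?scale0r.
  apply: le_trans (q_lo _) _; rewrite qsum.
  have -> : s m - s n = \sum_(i < m) a i ^+ 2; last by [].
  rewrite /s (sum_ord_sub (fun i => c i ^+ 2) nm); apply: eq_bigr => i _.
  by rewrite /a; case: ifP; rewrite ?expr0n.
have bn_cvg : cvgn bn.
  apply: W_complete => e e0.
  have /cvgrPdist_le /(_ (e ^+ 2)) := s_cvg; rewrite exprn_gt0 // => /(_ isT) [N _ hN].
  exists N => m n Nn nm; rewrite -ler_sqr ?nnegrE ?(ltW e0) //.
  apply: le_trans (sub_bn _ _ nm) _.
  have := hN n Nn; rewrite /= ger0_norm; last first.
    by rewrite subr_ge0; exact: nondecreasing_cvgn_le.
  by have := nondecreasing_cvgn_le s_nd s_cvg m; lra.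
pose b := limn bn; exists b => x.
have cqx z : continuous (fun y => q y z).
  apply: (@bounded_scalar_continuous _ _ _ (2 * `|z|)) => // y.
  by rewrite mulrAC; exact: q_le.
have qub j : q (u j) b = c j.
  have h1 : q (bn n) (u j) @[n --> \oo] --> q b (u j).
    by apply: (cvg_comp bn (fun y => q y (u j))); [exact: bn_cvg | exact: cqx].
  have h2 : q (bn n) (u j) @[n --> \oo] --> c j.
    apply: cvg_near_cst; exists j.+1 => // n /= jn; by rewrite /bn qu jn.
  by rewrite qC; exact: (cvg_unique _ h1 h2).
have fp := fproj_cvg qC q_scalar q_lo q_hi u_on u_dense (z := x).
have h1 : f (fproj q u n x) @[n --> \oo] --> f x.
  by apply: (cvg_comp (fun n => fproj q u n x) f); [exact: fp | exact: cf].
have h2 : q (fproj q u n x) b @[n --> \oo] --> q x b.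
  by apply: (cvg_comp (fun n => fproj q u n x) (fun y => q y b)); [exact: fp | exact: cqx].
have e n : f (fproj q u n x) = q (fproj q u n x) b.
  rewrite /fproj (fsum (fun i => q x (u i))) (q_suml q_scalar (fun i : 'I_n => q x (u i))).
  by apply: eq_bigr => i _; rewrite qub.
have h3 : f (fproj q u n x) @[n --> \oo] --> q x b by under eq_fun do rewrite e.
exact: (cvg_unique _ h1 h3).
Qed.

End Riesz.

(** * Translations of one dimensional normal laws *)

Section LebesgueShift.
Variable R : realType.
Local Notation leb := (@lebesgue_measure R).
Local Open Scope ereal_scope.

Lemma lebesgue_shift (g : R -> \bar R) (c : R) : measurable_fun setT g -> (forall x, 0 <= g x) ->
  \int[leb]_x g (x + c)%R = \int[leb]_x g x.
Proof.
move=> mg g0.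
pose TR := g_sigma_algebraType R.-ocitv.-measurable.
have ms : measurable_fun setT (fun x : TR => (x + c)%R : TR).
  have h : measurable_fun setT (fun x : R => (x + c)%R).
    by apply: measurable_funD => //; exact: measurable_cst.
  exact: h.
have h := @ge0_integral_pushforward _ _ TR TR R _ ms leb setT g measurableT mg
  (fun x _ => g0 x).
rewrite preimage_setT in h.
transitivity (\int[pushforward leb (fun x : TR => (x + c)%R : TR)]_x g x); first by rewrite h.
apply: eq_measure_integral => A mA _; apply/esym.
apply: (@lebesgue_measure_unique R (pushforward leb (fun x : TR => (x + c)%R : TR))) => //.
move=> _ [[a b] _ <-] /=; rewrite /pushforward.
rewrite (_ : _ @^-1` _ = [set` `](a - c)%R, (b - c)%R] ]); last first.
  by apply/seteqP; split=> x /=; rewrite !in_itv /= ltrBlDr lerBrDr.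
by rewrite !lebesgue_measure_itv /= !lte_fin ltrD2r -!EFinD; case: ifP => // _; congr EFin; ring.
Qed.

Variables (h : R).
Hypothesis h0 : (0 < h)%R.
Local Notation sd := (Num.sqrt h).
Local Notation gamh := (normal_prob (0 : R) sd).

Let sd_gt0 : (0 < sd)%R. Proof. by rewrite sqrtr_gt0. Qed.
Let sd_neq0 : (sd != 0)%R. Proof. by rewrite gt_eqF. Qed.

(* AM-GM on the density of the shifted law, whose square has integral expR (c ^+ 2 / h). *)
Lemma normal_pdf_shift_le (c K x : R) : (0 < K)%R ->
  (normal_pdf c sd x <= K * normal_pdf 0 sd x +
     expR (c ^+ 2 / h) / K * normal_pdf (2 * c) sd x)%R.
Proof.
move=> K0; rewrite !(normal_pdfE _ sd_neq0) /normal_fun sqr_sqrtr ?(ltW h0) // subr0.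
rewrite !(mulrCA _ (normal_peak sd)) -mulrDr; apply: ler_wpM2l; first exact: normal_peak_ge0.
have h2 : (h *+ 2 = 2 * h)%R by rewrite [RHS]mulr_natl.
rewrite h2.
pose A := expR (- x ^+ 2 / (4 * h)); pose B := expR ((- (x - 2 * c) ^+ 2 + 2 * c ^+ 2) / (4 * h)).
have -> : (expR (- (x - c) ^+ 2 / (2 * h)) = A * B)%R.
  by rewrite /A /B -expRD; congr expR; field; exact: lt0r_neq0.
have -> : (expR (- x ^+ 2 / (2 * h)) = A ^+ 2)%R.
  by rewrite [RHS]expr2 /A -expRD; congr expR; field; exact: lt0r_neq0.
have -> : (expR (c ^+ 2 / h) / K * expR (- (x - 2 * c) ^+ 2 / (2 * h)) = B ^+ 2 / K)%R.
  rewrite mulrAC -expRD [X in _ = (X / K)%R]expr2 /B -expRD; congr (expR _ / _)%R.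
  by field; exact: lt0r_neq0.
have A0 : (0 < A)%R by exact: expR_gt0.
have B0 : (0 < B)%R by exact: expR_gt0.
rewrite -(ler_pM2r K0) mulrDl divfK ?lt0r_neq0 //.
have := sqr_ge0 (K * A - B)%R; have := sqr_ge0 (K * A)%R; have := sqr_ge0 B.
have : (0 <= K * A * B)%R by rewrite !mulr_ge0 ?ltW.
rewrite sqrrB; nra.
Qed.

(** Invariance of Lebesgue measure moves the translation onto the density, where
    [normal_pdf_shift_le] applies; in the error term [G] is replaced by 1 and the density centred at
    [2 * c] integrates to 1. *)
Lemma normal_shift_le (G : R -> \bar R) (c K : R) : (0 < K)%R ->
  measurable_fun setT G -> (forall x, 0 <= G x <= 1) ->
  \int[gamh]_z G (z + c)%R <= K%:E * \int[gamh]_z G z + (expR (c ^+ 2 / h) / K)%:E.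
Proof.
move=> K0 mG G01; have G0 x : 0 <= G x by have /andP[] := G01 x.
have mGc : measurable_fun setT (fun x : R => G (x + c)%R).
  apply: (measurableT_comp mG); apply: measurable_funD => //; exact: measurable_cst.
rewrite (@normal_prob_ge0_integral _ 0 sd _ sd_neq0 mGc (fun x => G0 _)).
rewrite (@normal_prob_ge0_integral _ 0 sd _ sd_neq0 mG G0).
have mpdf m : measurable_fun setT (fun x : R => (normal_pdf m sd x)%:E).
  by apply/measurable_EFinP; exact: measurable_normal_pdf.
have pdf0 m x : 0 <= (normal_pdf m sd x)%:E by rewrite lee_fin normal_pdf_ge0.
have -> : \int[leb]_x (G (x + c)%R * (normal_pdf 0 sd x)%:E) =
   \int[leb]_x (G x * (normal_pdf c sd x)%:E).
  rewrite -(@lebesgue_shift (fun x => G x * (normal_pdf c sd x)%:E) c).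
  - apply: eq_integral => x _; congr (_ * _%:E).
    by rewrite !(normal_pdfE _ sd_neq0) /normal_fun subr0 addrK.
  - exact: emeasurable_funM.
  - by move=> x; exact: mule_ge0.
pose e := (expR (c ^+ 2 / h) / K)%R.
have e0 : (0 <= e)%R by rewrite divr_ge0 ?expR_ge0 ?ltW.
have m1 : measurable_fun setT (fun x => K%:E * (G x * (normal_pdf 0 sd x)%:E)).
  by apply: emeasurable_funM; [exact: measurable_cst | exact: emeasurable_funM].
have m2 : measurable_fun setT (fun x : R => e%:E * (normal_pdf (2 * c) sd x)%:E).
  by apply: emeasurable_funM; [exact: measurable_cst |].
have m12 : measurable_fun setT (fun x : R => K%:E * (G x * (normal_pdf 0 sd x)%:E) +
    e%:E * (normal_pdf (2 * c) sd x)%:E) by exact: emeasurable_funD.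
have mG' m : measurable_fun setT (fun x : R => G x * (normal_pdf m sd x)%:E).
  exact: emeasurable_funM.
have p1 x : 0 <= K%:E * (G x * (normal_pdf 0 sd x)%:E).
  by apply: mule_ge0; [rewrite lee_fin ltW | exact: mule_ge0].
have p2 x : 0 <= e%:E * (normal_pdf (2 * c) sd x)%:E by apply: mule_ge0 => //; rewrite lee_fin.
apply: (@le_trans _ _ (\int[leb]_x (K%:E * (G x * (normal_pdf 0 sd x)%:E) +
    e%:E * (normal_pdf (2 * c) sd x)%:E))).
  apply: ge0_le_integral => //.
  - by move=> x _; exact: mule_ge0.
  - exact: mG'.
  - move=> x _; have /andP[_ G1] := G01 x.
    have : G x \is a fin_num by rewrite ge0_fin_numE // (le_lt_trans G1) ?ltry.
    case: (G x) (G0 x) G1 => [g||] //; rewrite !lee_fin => g0 g1 _.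
    have := normal_pdf_shift_le c x K0; have := normal_pdf_ge0 (2 * c) sd x; rewrite -/e.
    set a := normal_pdf c sd x; set b := normal_pdf 0 sd x; set d := normal_pdf _ _ _.
    move=> d0 abd; apply: (@le_trans _ _ (g * (K * b + e * d))%R); first exact: ler_wpM2l.
    rewrite mulrDr mulrCA lerD2l; apply: ler_piMl => //; exact: mulr_ge0.
rewrite ge0_integralD // ge0_integralZl //; last 3 first.
- exact: mG'.
- by move=> x _; exact: mule_ge0.
- by rewrite lee_fin ltW.
have hI : \int[leb]_x (normal_pdf (2 * c) sd x)%:E = 1 by exact: integral_normal_pdf.
have -> : \int[leb]_x (e%:E * (normal_pdf (2 * c) sd x)%:E) = e%:E.
  by rewrite -[RHS]mule1 -hI; apply: ge0_integralZl => //; exact: mpdf.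
by [].
Qed.

End LebesgueShift.

Section QuasiInvariance.
Variables (R : realType) (W V : normedModType R) (q : W -> W -> R) (E : W -> V).
Variables (mu : probability (borel V) R) (h : R).
Hypothesis h0 : 0 < h.
Hypothesis mu_gauss : gaussian_measure q E h mu.
Hypothesis q_scalar : forall y, scalar (q^~ y).
Hypothesis qC : forall x y, q x y = q y x.
Hypothesis q_lo : forall x, `|x| ^+ 2 <= q x x.
Hypothesis E_dense : dense (range E).
Local Notation gamh := (normal_prob (0 : R) (Num.sqrt h)).

Lemma dual_shift y b x X : dual_elt q E y b -> y (x + E X) = y x + q X b.
Proof. by move=> [sy _ yE]; rewrite (scalar_addr _ _ sy) yE qC. Qed.

(** For [K >= 1] the first term suffices; for [K < 1] the second is at least 1. *)
Lemma mu_le_trivial (A : set V) (K : R) (e : R) : (measurable (A : set (borel V))) ->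
  0 < K -> 1 <= e -> (mu A <= K%:E * mu A + (e / K)%:E)%E.
Proof.
move=> mA K0 e1; have := probability_le1 mu mA; have : (0 <= mu A)%E by [].
case: (mu A) => [a||] //; rewrite !lee_fin => a0 a1.
have [K1|K1] := leP 1 K.
  apply: (@le_trans _ _ (K * a)); first exact: ler_peMl.
  by rewrite lerDl divr_ge0 ?ltW // (lt_le_trans ltr01).
apply: (@le_trans _ _ (e / K)); last by rewrite lerDr mulr_ge0 // ltW.
rewrite ler_pdivlMr //; apply: le_trans e1.
by rewrite -[leRHS]mulr1; apply: ler_pM => //; exact: ltW.
Qed.

(** The cylinder feels only the projection [bs] of [X] onto the span of the [b i]. Along the unit
    vector [b0] of [bs] the translation is by [s], the norm of [bs], and the coordinates orthogonal
    to [b0] do not move; by independence the estimate is the one dimensional one. *)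
Lemma cylinder_shift_le n (y : nat -> V -> R) (b : nat -> W) (C : set (n.-tuple R)) (X : W) (K : R) :
  (forall i, dual_elt q E (y i) (b i)) -> measurable C -> 0 < K ->
  (mu [set x : V | C [tuple y i (x + E X)%R | i < n]] <=
   K%:E * mu [set x | C [tuple y i x | i < n]] + (expR (q X X / h) / K)%:E)%E.
Proof.
move=> dy mC K0.
have my m (z : 'I_m -> V -> R) : (forall i, exists c, dual_elt q E (z i) c) ->
    measurable_fun setT (fun x : borel V => [tuple z i x | i < m]).
  by move=> dz; apply: measurable_mktuple => i; have [c] := dz i; exact: dual_measurable.
have [k [z [c [[dz oc] yz _]]]] := gram_schmidt q_scalar qC q_lo E_dense
  (fun i (_ : (i < n)%N) => dy i).
pose bs := \sum_(j < k) q X (c j) *: c j.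
pose ys x := \sum_(j < k) q X (c j) * z j x.
have ds : dual_elt q E ys bs by exact: (dual_elt_sum q_scalar (fun j => q X (c j)) dz).
have bsc j : (j < k)%N -> q bs (c j) = q X (c j).
  by move=> jk; exact: (q_sum_onb q_scalar (fun j => q X (c j)) (conj dz oc) jk).
have q_sumr v m (a : nat -> R) (d : nat -> W) :
    q v (\sum_(j < m) a j *: d j) = \sum_(j < m) a j * q v (d j).
  rewrite qC (q_suml q_scalar (fun j : 'I_m => a j)); apply: eq_bigr => j _.
  by rewrite qC.
have bsb i : (i < n)%N -> q X (b i) = q bs (b i).
  move=> ni; have [a [_ ->]] := yz i ni; rewrite !q_sumr; apply: eq_bigr => j _.
  by rewrite bsc.
have qbsX : q X bs = q bs bs.
  have e v : q v bs = \sum_(j < k) q X (c j) * q v (c j) := q_sumr v k (fun j => q X (c j)) c.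
  by rewrite !e; apply: eq_bigr => j _; rewrite bsc.
have eX1 : 1 <= expR (q X X / h).
  by rewrite -expR0 ler_expR divr_ge0 ?(q_ge0 q_lo) // ltW.
have [bs0|bs0] := eqVneq bs 0.
  have -> : [set x | C [tuple y i (x + E X) | i < n]] = [set x | C [tuple y i x | i < n]].
    apply/funext => x /=; congr C; apply: eq_from_tnth => i; rewrite !tnth_mktuple.
    by rewrite (dual_shift _ _ (dy i)) bsb // bs0 (q0l q_scalar) addr0.
  apply: mu_le_trivial => //; rewrite -[X in measurable X]setTI.
  by apply: (my n (fun i => y i)) => // i; exists (b i).
have qb : 0 < q bs bs by apply: lt_le_trans (q_lo bs); rewrite exprn_gt0 // normr_gt0.
pose s := Num.sqrt (q bs bs); have s0 : 0 < s by rewrite sqrtr_gt0.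
have ss : s ^+ 2 = q bs bs by rewrite sqr_sqrtr // ltW.
pose b0 := s^-1 *: bs + 0 *: bs; pose y0 x := s^-1 * ys x + 0 * ys x.
have d0 : dual_elt q E y0 b0 by exact: (dual_lin q_scalar s^-1 0 ds ds).
have b0E : b0 = s^-1 *: bs by rewrite /b0 scale0r addr0.
have q0 : q b0 b0 = 1.
  by rewrite b0E (qZl q_scalar) (qZr qC q_scalar) mulrA -invfM -expr2 ss mulVf // gt_eqF.
have qX0 : q X b0 = s.
  by rewrite b0E (qZr qC q_scalar) qbsX -ss expr2 mulKf // gt_eqF.
(* Remove from each form its component along [b0]. The remainders are orthogonal to both [b0] and
   [X], and a second Gram-Schmidt makes them orthonormal; [T] below recovers the original
   coordinates. *)
pose b1 i := 1 *: b i + (- q (b i) b0) *: b0.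
pose y1 i x := 1 * y i x + (- q (b i) b0) * y0 x.
have d1 i : dual_elt q E (y1 i) (b1 i) by exact: (dual_lin q_scalar 1 _ (dy i) d0).
have [k' [z' [c' [[dz' oc'] yz' vc']]]] := gram_schmidt q_scalar qC q_lo E_dense
  (fun i (_ : (i < n)%N) => d1 i).
have q01 i : q b0 (b1 i) = 0.
  by rewrite (qDr qC q_scalar) !(qZr qC q_scalar) q0 mulr1 mul1r qC subrr.
have qX1 i : (i < n)%N -> q X (b1 i) = 0.
  move=> ni; rewrite (qDr qC q_scalar) !(qZr qC q_scalar) qX0 mul1r bsb //.
  by rewrite b0E (qZr qC q_scalar) mulNr mulrAC mulVf ?gt_eqF // mul1r qC subrr.
have q0c j : (j < k')%N -> q b0 (c' j) = 0 by apply: vc' => i _.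
have qXc j : (j < k')%N -> q X (c' j) = 0 by apply: vc'.
have /choice [a ya] : forall i : 'I_n, exists a : nat -> R,
    forall x, y1 i x = \sum_(j < k') a j * z' j x.
  by move=> i; have [a [ya _]] := yz' i (ltn_ord i); exists a.
pose Z x := [tuple z' (j : 'I_k') x | j < k'].
pose T (p : R * k'.-tuple R) :=
  [tuple q (b i) b0 * p.1 + \sum_(j < k') a i j * tnth p.2 j | i < n].
have yT x : [tuple y i x | i < n] = T (y0 x, Z x).
  apply: eq_from_tnth => i; rewrite !tnth_mktuple /=.
  under eq_bigr do rewrite tnth_mktuple.
  by rewrite -ya /y1; ring.
have mT : measurable_fun setT T.
  apply/measurable_fun_tnthP => i.
  rewrite (_ : _ \o _ = (fun p : R * k'.-tuple R =>
    q (b i) b0 * p.1 + \sum_(j < k') a i j * tnth p.2 j)); last first.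
    by apply/funext => p /=; rewrite tnth_mktuple.
  apply: measurable_funD.
    by apply: measurable_funM; [exact: measurable_cst | exact: measurable_fst].
  apply: measurable_sum => j; apply: measurable_funM; first exact: measurable_cst.
  by apply: (measurableT_comp (measurable_tnth j)); exact: measurable_snd.
pose D := T @^-1` C.
have mD : measurable D by rewrite /D -[X in measurable X]setTI; exact: mT.
pose g (p : R * k'.-tuple R) : \bar R := (\1_D p)%:E.
have mg : measurable_fun setT g by apply/measurable_EFinP; exact: measurable_indic.
have g0 p : (0 <= g p)%E by rewrite lee_fin.
have g1 p : (g p <= 1)%E by rewrite lee_fin indicE; case: (_ \in _); rewrite ?lexx ?ler01.
have yb : orthonormal_dual q E (fun j : 'I_k' => z' j) (fun j => c' j).
  by split=> [j|i j]; [exact: dz' | exact: oc'].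
have q0i (j : 'I_k') : q b0 (c' j) = 0 /\ q (c' j) b0 = 0.
  by rewrite [X in _ /\ X = _]qC q0c.
have mZ : measurable_fun setT (Z : borel V -> k'.-tuple R).
  by apply: (my k' (fun j => z' j)) => j; exists (c' j); exact: dz'.
have my0 : measurable_fun setT (y0 : borel V -> R) by exact: dual_measurable d0.
have muD (r : R) : mu [set x | D (y0 x + r, Z x)] =
    (\int[gamh]_t \int[mu]_x g ((t + r)%R, Z x))%E.
  have mr : measurable_fun setT (fun p : R * k'.-tuple R => (p.1 + r, p.2)).
    apply: measurable_fun_pair; last exact: measurable_snd.
    by apply: measurable_funD; [exact: measurable_fst | exact: measurable_cst].
  have mgr : measurable_fun setT (fun p : R * k'.-tuple R => g (p.1 + r, p.2)).
    exact: (measurableT_comp mg mr).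
  have := gauss_split_integral h0 mu_gauss yb d0 q0 q0i mgr (fun p => g0 _).
  move=> /= <-; rewrite -[LHS]mule1.
  have mP : measurable_fun setT (fun x : borel V => (y0 x + r, Z x)).
    apply: measurable_fun_pair => //.
    by apply: measurable_funD => //; exact: measurable_cst.
  have mDr : measurable ([set x | D (y0 x + r, Z x)] : set (borel V)).
    by rewrite -[X in measurable X]setTI; exact: mP.
  by have := integral_indic mu measurableT mDr; rewrite setIT mule1 => <-.
pose G t := (\int[mu]_x g (t, Z x))%E.
have mG : measurable_fun setT G.
  apply: (@measurable_fun_fubini_tonelli_F _ _ _ (borel V) R mu
    (fun p => g (p.1, Z p.2))) => //.
  have mp : measurable_fun setT (fun p : R * borel V => (p.1, Z p.2)).
    apply: measurable_fun_pair; first exact: measurable_fst.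
    by apply: (measurableT_comp mZ); exact: measurable_snd.
  exact: (measurableT_comp mg mp).
have mgt t : measurable_fun setT (fun x : borel V => g (t, Z x)).
  have mp : measurable_fun setT (fun x : borel V => (t, Z x)).
    by apply: measurable_fun_pair => //; exact: measurable_cst.
  exact: (measurableT_comp mg mp).
have G01 t : (0 <= G t <= 1)%E.
  apply/andP; split; first by apply: integral_ge0.
  apply: (@le_trans _ _ (\int[mu]_x cst 1%E x)%E).
    by apply: ge0_le_integral => //; exact: measurable_cst.
  by rewrite integral_cst // mul1e probability_le1.
have e1 : [set x | C [tuple y i (x + E X) | i < n]] = [set x | D (y0 x + s, Z x)].
  apply/funext => x /=; rewrite /D /= yT (dual_shift _ _ d0) qX0.
  congr (C (T (_, _))); apply: eq_from_tnth => j; rewrite !tnth_mktuple.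
  by rewrite (dual_shift _ _ (dz' _ (ltn_ord j))) qXc // addr0.
have e2 : [set x | C [tuple y i x | i < n]] = [set x | D (y0 x + 0, Z x)].
  by apply/funext => x /=; rewrite /D /= yT addr0.
rewrite e1 e2 !muD.
have e3 : (\int[gamh]_t \int[mu]_x g ((t + 0)%R, Z x) = \int[gamh]_t G t)%E.
  by apply: eq_integral => t _; rewrite addr0.
(* Cauchy-Schwarz bounds the projected shift by [q X X], which makes the constant the same for all
   cylinders. *)
have sX : s ^+ 2 <= q X X.
  by rewrite ss; have := q_cauchy qC q_scalar q_lo X bs; rewrite qbsX expr2 ler_pM2r.
have eK : expR (s ^+ 2 / h) / K <= expR (q X X / h) / K.
  by rewrite ler_pM2r ?invr_gt0 // ler_expR ler_pM2r ?invr_gt0.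
rewrite e3; apply: (le_trans (normal_shift_le h0 s K0 mG G01)).
by rewrite -lee_fin in eK; exact: (leeD2l _ eK).
Qed.

Variable y : nat -> V -> R.
Variable b : nat -> W.
Hypothesis dy : forall i, dual_elt q E (y i) (b i).
Hypothesis y_generate : forall G : set (set V), sigma_algebra setT G ->
  (forall n (r : R), G [set x | y n x <= r]) -> (@open V) `<=` G.

Definition cylinders : set (set V) :=
  [set A | exists n (C : set (n.-tuple R)), measurable C /\ A = [set x | C [tuple y i x | i < n]]].

Lemma cylinder_widen n m (C : set (n.-tuple R)) : (n <= m)%N -> measurable C ->
  exists C' : set (m.-tuple R), measurable C' /\
    [set x | C [tuple y i x | i < n]] = [set x | C' [tuple y i x | i < m]].
Proof.
move=> nm mC.
pose F (v : m.-tuple R) := [tuple tnth v (widen_ord nm i) | i < n].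
exists (F @^-1` C); split.
  rewrite -[X in measurable X]setTI; have mF : measurable_fun setT F; last exact: mF.
  apply/measurable_fun_tnthP => i.
  rewrite (_ : _ \o _ = (fun v : m.-tuple R => tnth v (widen_ord nm i))).
    exact: measurable_tnth.
  by apply/funext => v /=; rewrite tnth_mktuple.
apply/funext => x /=; congr C; apply: eq_from_tnth => i.
by rewrite !tnth_mktuple.
Qed.

Lemma cylinder2 A B : cylinders A -> cylinders B -> exists n (C D : set (n.-tuple R)),
  [/\ measurable C, measurable D, A = [set x | C [tuple y i x | i < n]] &
      B = [set x | D [tuple y i x | i < n]]].
Proof.
move=> [n [C [mC ->]]] [m [D [mD ->]]]; exists (maxn n m).
have [C' [mC' ->]] := cylinder_widen (leq_maxl n m) mC.
have [D' [mD' ->]] := cylinder_widen (leq_maxr n m) mD.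
by exists C', D'.
Qed.

Lemma cylinders_setring : setring cylinders.
Proof.
split.
- by exists 0%N, set0; split=> //; exact: measurable0.
- move=> A B cA cB; have [n [C [D [mC mD -> ->]]]] := cylinder2 cA cB.
  by exists n, (C `|` D); split=> //; exact: measurableU.
- move=> A B cA cB; have [n [C [D [mC mD -> ->]]]] := cylinder2 cA cB.
  by exists n, (C `\` D); split=> //; exact: measurableD.
Qed.

(** The ring of cylinders contains the whole space, so the sigma-ring it generates is a
    sigma-algebra; it contains the half-spaces of [y_generate]. *)
Lemma borel_sub_cylinders (A : set (borel V)) : measurable A -> <<sr cylinders >> A.
Proof.
have srT : <<sr cylinders >> [set: V].
  by apply: sub_g_sigma_ring; exists 0%N, setT; split=> //; exact: measurableT.
have [sr0 srD srU] := @smallest_sigma_ring _ cylinders.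
have sa : sigma_algebra setT <<sr cylinders >>.
  by split=> // B sB; exact: srD.
move=> mA; apply: mA; split => //.
apply: y_generate => // n r; apply: sub_g_sigma_ring.
exists n.+1, [set v | tnth v ord_max <= r]; split.
  have := @measurable_tnth _ R n.+1 ord_max measurableT `]-oo, r]%classic (measurable_itv _).
  by rewrite setTI; congr measurable; apply/seteqP; split=> v /=; rewrite in_itv.
by apply/funext => x /=; rewrite tnth_mktuple.
Qed.

Lemma measurable_addr (c : V) : measurable_fun setT (fun x : borel V => x + c : borel V).
Proof.
apply: (@measurability _ _ (borel V) (borel V) _ _ (@open V)) => // _ [A oA <-].
rewrite setTI; apply: sub_sigma_algebra.
have /continuousP cc : continuous (fun x : V => x + c).
  by move=> x; apply: cvgD; [exact: cvg_id | exact: cvg_cst].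
exact: cc.
Qed.

(* Cylinders satisfy mu (A - E X) <= K * mu A + c / K for all K > 0, an inequality
   stable under monotone limits; take mu A = 0 and let K tend to infinity. *)
Lemma quasi_invariance (X : W) (A : set (borel V)) : measurable A -> mu A = 0%E ->
  mu [set x | A (x + E X)] = 0%E.
Proof.
move=> mA A0.
pose sh (B : set V) := [set x | B (x + E X)].
have msh (B : set (borel V)) : measurable B -> measurable (sh B : set (borel V)).
  by move=> mB; rewrite -[X in measurable X]setTI; exact: (measurable_addr (E X)).
pose c := expR (q X X / h).
pose GG : set (set V) := [set B | measurable (B : set (borel V)) /\ forall K, 0 < K ->
   (mu (sh B) <= K%:E * mu B + (c / K)%:E)%E].
have fin (B : set (borel V)) : measurable B -> mu B \is a fin_num.
  by move=> mB; rewrite fin_num_measure.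
have lim_le (F : nat -> set V) (B : set V) K : 0 < K -> (forall n, GG (F n)) ->
    mu (F n) @[n --> \oo] --> mu B -> mu (sh (F n)) @[n --> \oo] --> mu (sh B) ->
    (mu (sh B) <= K%:E * mu B + (c / K)%:E)%E.
  move=> K0 GF c1 c2.
  have c3 : (K%:E * mu (F n) + (c / K)%:E)%E @[n --> \oo] --> (K%:E * mu B + (c / K)%:E)%E.
    by apply: cvgeD => //; [exact: fin_num_adde_defl | exact: cvgeZl | exact: cvg_cst].
  by apply: (lee_cvg_to c2 c3); apply: nearW => n; exact: (GF n).2.
have mono : monotone GG.
  split=> F ndF GF.
  - have mF n : measurable (F n : set (borel V)) := (GF n).1.
    have mU : measurable (\bigcup_n F n : set (borel V)) by exact: bigcup_measurable.
    split=> // K K0; apply: (lim_le F) => //; first exact: nondecreasing_cvg_mu.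
    have -> : sh (\bigcup_n F n) = \bigcup_n sh (F n) by [].
    apply: nondecreasing_cvg_mu => [n||n m nm].
    + exact: msh.
    + by apply: bigcup_measurable => n _; exact: msh.
    + by apply/subsetPset => x /=; have /subsetPset := ndF _ _ nm; exact.
  - have mF n : measurable (F n : set (borel V)) := (GF n).1.
    have mI : measurable (\bigcap_n F n : set (borel V)) by exact: bigcap_measurable.
    split=> // K K0; apply: (lim_le F) => //.
      apply: nonincreasing_cvg_mu => //.
      by rewrite -ge0_fin_numE // fin.
    have -> : sh (\bigcap_n F n) = \bigcap_n sh (F n) by [].
    apply: nonincreasing_cvg_mu => [|n||n m nm].
    + by rewrite -ge0_fin_numE // fin //; exact: msh.
    + exact: msh.
    + by apply: bigcap_measurable => // n _; exact: msh.
    + by apply/subsetPset => x /=; have /subsetPset := ndF _ _ nm; exact.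
have cylG : cylinders `<=` GG.
  move=> _ [n [C [mC ->]]]; split=> [|K K0].
    rewrite -[X in measurable X]setTI.
    have mY : measurable_fun setT (fun x : borel V => [tuple y i x | i < n]).
      by apply: measurable_mktuple => i; exact: dual_measurable (dy i).
    exact: mY.
  exact: (cylinder_shift_le X dy mC K0).
have [_ GA] := monotone_setring_sub_g_sigma_ring mono cylinders_setring cylG (borel_sub_cylinders mA).
have muge : (0 <= mu (sh A))%E by [].
apply/eqP; rewrite eq_le muge andbT.
have : mu (sh A) \is a fin_num by apply: fin; exact: msh.
have GA' K : 0 < K -> (mu (sh A) <= (c / K)%:E)%E.
  by move=> K0; have := GA K K0; rewrite A0 mule0 add0e.
rewrite -/(sh A); case: (mu (sh A)) muge GA' => [r||] //; rewrite lee_fin => r0 GA' _.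
rewrite lee_fin leNgt; apply/negP => rp.
have c0 : 0 < c by exact: expR_gt0.
(* This value of [K] turns the bound into [r <= r / 2]. *)
have := GA' (2 * c / r); rewrite !divr_gt0 ?mulr_gt0 // => /(_ isT).
have -> : c / (2 * c / r) = r / 2.
  by field; rewrite !gt_eqF.
by rewrite lee_fin; lra.
Qed.

End QuasiInvariance.

(** * Almost sure limits and Lp norms *)

Section AlmostEverywhere.
Variables (R : realType) (d : measure_display) (T : measurableType d) (P : probability T R).

Lemma partial_sums_cvg (a : nat -> R) (s : R) : (forall n, \sum_(i < n) `|a i| <= s) ->
  cvgn (series a).
Proof.
move=> as_; apply: normed_cvg; apply: nondecreasing_is_cvgn.
  by apply: (@nondecreasing_series _ (fun n => `|a n|) xpredT 0%N).
exists s => _ [n _ <-]; apply: le_trans (as_ n).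
by rewrite -(big_mkord xpredT (fun i => `|a i|)).
Qed.

(** The sum of the absolute values has integral at most [S], hence is finite almost everywhere. *)
Lemma ae_bounded_sums (f : nat -> T -> R) (c : nat -> R) (S : R) :
  (forall n, measurable_fun setT (f n)) ->
  (forall n, (\int[P]_x `|f n x|%:E <= (c n)%:E)%E) -> (forall n, \sum_(i < n) c i <= S) ->
  {ae P, forall x, exists s : R, forall n, \sum_(i < n) `|f i x| <= s}.
Proof.
move=> mf fc cS.
have mf' n : measurable_fun setT (fun x => (`|f n x|)%:E).
  by apply/measurable_EFinP; exact: measurableT_comp.
pose g x := (\sum_(n <oo) (`|f n x|)%:E)%E.
have g0 x : (0 <= g x)%E by apply: nneseries_ge0.
have mg : measurable_fun setT g by apply: ge0_emeasurable_sum.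
have Ig : (\int[P]_x g x <= S%:E)%E.
  rewrite integral_nneseries //; apply: lime_le.
    by apply: is_cvg_nneseries => n _ _; apply: integral_ge0.
  apply: nearW => n; apply: (@le_trans _ _ (\sum_(0 <= i < n) (c i)%:E)%E).
    by apply: lee_sum => i _; exact: fc.
  by rewrite sumEFin lee_fin big_mkord.
have integ : P.-integrable setT g.
  apply/integrableP; split=> //; apply: le_lt_trans (ltry S).
  by under eq_integral do rewrite gee0_abs //.
have := integrable_ae measurableT integ.
apply: filterS => x /(_ I) gx; exists (fine (g x)) => n.
rewrite -lee_fin fineK // -sumEFin -(big_mkord xpredT (fun i => (`|f i x|)%:E)).
exact: nneseries_lim_ge.
Qed.

(* The pointwise limit, extended by a superior limit (cut off at infinite values). *)
Definition limfun (g : nat -> T -> R) (x : T) : R := fine (limn_esup (fun n => (g n x)%:E)).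

Lemma measurable_limfun g : (forall n, measurable_fun setT (g n)) ->
  measurable_fun setT (limfun g).
Proof.
move=> mg; apply: (measurableT_comp (fine_measurable measurableT)).
by apply: (@measurable_fun_limn_esup _ _ _ setT (fun n x => (g n x)%:E)) => n;
  exact/measurable_EFinP.
Qed.

Lemma limfunE g x l : g n x @[n --> \oo] --> l -> limfun g x = l.
Proof.
move=> gl; rewrite /limfun (_ : limn_esup _ = l%:E) //.
have gl' : (g n x)%:E @[n --> \oo] --> l%:E by apply: cvg_EFin => //; exact: nearW.
by have [_ ->] := cvg_limn_einf_sup gl'.
Qed.

Lemma limfun_le g x C : (forall n, `|g n x| <= C) -> `|limfun g x| <= C.
Proof.
move=> gC; have h n : (((- C)%:E <= (g n x)%:E) && ((g n x)%:E <= C%:E))%E.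
  by rewrite !lee_fin -ler_norml.
pose v n : \bar R := (g n x)%:E.
have cv := @is_cvg_esups _ v.
have up : (limn (esups v) <= C%:E)%E.
  apply: (lime_le cv); apply: nearW => n.
  by apply: ub_ereal_sup => _ [k _ <-]; have /andP[] := h k.
have lo : ((- C)%:E <= limn (esups v))%E.
  apply: (lime_ge cv); apply: nearW => n.
  by apply: (@le_trans _ _ (v n)); [have /andP[] := h n | apply: ereal_sup_ubound; exists n => /=].
rewrite /limfun -/v limn_esup_lim; case: (limn (esups v)) up lo => [r||] //=.
by rewrite !lee_fin => up lo; rewrite ler_norml lo.
Qed.

Lemma fatou_ae (F : nat -> T -> R) (f : T -> R) (a : nat -> R) (A : R) :
  (forall n, measurable_fun setT (F n)) -> measurable_fun setT f ->
  (forall n x, 0 <= F n x) -> (forall x, 0 <= f x) ->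
  {ae P, forall x, F n x @[n --> \oo] --> f x} ->
  (forall n, (\int[P]_x (F n x)%:E <= (a n)%:E)%E) -> a n @[n --> \oo] --> A ->
  (\int[P]_x (f x)%:E <= A%:E)%E.
Proof.
move=> mF mf F0 f0 Ff Fa aA.
have mF' n : measurable_fun setT (fun x => (F n x)%:E) by exact/measurable_EFinP.
have mf' : measurable_fun setT (fun x => (f x)%:E) by exact/measurable_EFinP.
have F0' n x : setT x -> (0 <= (F n x)%:E)%E by rewrite lee_fin.
have mlim : measurable_fun setT (fun x => limn_einf (fun n => (F n x)%:E)).
  have -> : (fun x => limn_einf (fun n => (F n x)%:E)) =
      (fun x => - limn_esup (fun n => - (F n x)%:E))%E.
    by apply/funext => x; rewrite -[X in _ = (- X)%E]/(limn_esup (-%E \o _)) limn_esupN oppeK.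
  apply: measurableT_comp => //.
  apply: (@measurable_fun_limn_esup _ _ _ setT (fun n x => - (F n x)%:E)%E) => n.
  exact: measurableT_comp.
have lim0 x : (0 <= limn_einf (fun n => (F n x)%:E))%E.
  rewrite limn_einf_lim; apply: lime_ge; first exact: is_cvg_einfs.
  by apply: nearW => n; apply: le_ereal_inf_tmp => _ [k _ <-]; rewrite lee_fin.
have -> : (\int[P]_x (f x)%:E = \int[P]_x limn_einf (fun n => (F n x)%:E))%E.
  apply: ge0_ae_eq_integral => //; first by move=> x _; rewrite lee_fin.
  apply: filterS Ff => x Fx _.
  have Fx' : (F n x)%:E @[n --> \oo] --> (f x)%:E by apply: cvg_EFin => //; exact: nearW.
  by have [-> _] := cvg_limn_einf_sup Fx'.
apply: (le_trans (fatou P measurableT mF' F0')).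
rewrite limn_einf_lim; set u := (fun n => _).
have c2 : (a n)%:E @[n --> \oo] --> A%:E by apply: cvg_EFin => //; exact: nearW.
apply: (lee_cvg_to (@is_cvg_einfs _ u) c2); apply: nearW => n.
apply: le_trans (Fa n); rewrite -[leRHS]/(u n); apply: ereal_inf_lbound.
by exists n => /=.
Qed.

Definition int_sqr (f : T -> R) : \bar R := (\int[P]_x ((f x) ^+ 2)%:E)%E.

Lemma int_sqr_ge0 f : (0 <= int_sqr f)%E.
Proof. by apply: integral_ge0 => x _; rewrite lee_fin sqr_ge0. Qed.

Lemma measurable_sqr (f : T -> R) : measurable_fun setT f -> measurable_fun setT (fun x => ((f x) ^+ 2)%:E).
Proof. by move=> mf; apply/measurable_EFinP; exact: measurable_funX. Qed.

Lemma int_sqrZ (c : R) (f : T -> R) : measurable_fun setT f ->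
  int_sqr (fun x => c * f x) = ((c ^+ 2)%:E * int_sqr f)%E.
Proof.
move=> mf; rewrite /int_sqr.
under eq_integral do rewrite exprMn EFinM.
apply: ge0_integralZl => //; first exact: measurable_sqr.
  by move=> x _; rewrite lee_fin sqr_ge0.
by rewrite lee_fin sqr_ge0.
Qed.

Lemma int_sqrZ_le (c : R) (f : T -> R) (e : R) : measurable_fun setT f ->
  (int_sqr f <= e%:E)%E -> (int_sqr (fun x => (c * f x)%R) <= (c ^+ 2 * e)%:E)%E.
Proof.
move=> mf fe; rewrite int_sqrZ // (EFinM (c ^+ 2) e).
by apply: lee_wpmul2l; rewrite ?lee_fin ?sqr_ge0.
Qed.

Lemma int_sqrD (f g : T -> R) (a b : R) : measurable_fun setT f -> measurable_fun setT g ->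
  (int_sqr f <= a%:E)%E -> (int_sqr g <= b%:E)%E ->
  (int_sqr (fun x => (f x + g x)%R) <= (2 * a + 2 * b)%:E)%E.
Proof.
move=> mf mg fa gb.
have m2f : measurable_fun setT (fun x => (2%:E * ((f x) ^+ 2)%:E)%E).
  by apply: emeasurable_funM; [exact: measurable_cst | exact: measurable_sqr].
have m2g : measurable_fun setT (fun x => (2%:E * ((g x) ^+ 2)%:E)%E).
  by apply: emeasurable_funM; [exact: measurable_cst | exact: measurable_sqr].
have s0 (h : T -> R) x : (0 <= (h x ^+ 2)%:E)%E by rewrite lee_fin sqr_ge0.
have p0 (h : T -> R) x : (0 <= 2%:E * (h x ^+ 2)%:E)%E.
  by rewrite -EFinM lee_fin mulr_ge0 // sqr_ge0.
apply: (@le_trans _ _ (\int[P]_x (2%:E * ((f x) ^+ 2)%:E + 2%:E * ((g x) ^+ 2)%:E))%E).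
  apply: ge0_le_integral => //.
  - by move=> x _; exact: (s0 (fun x => f x + g x)).
  - by apply: measurable_sqr; exact: measurable_funD.
  - exact: emeasurable_funD.
  - move=> x _; rewrite -!EFinM -EFinD lee_fin.
    by have := sqr_ge0 (f x - g x); rewrite sqrrB sqrrD; lra.
rewrite ge0_integralD // !ge0_integralZl //; try exact: measurable_sqr.
have -> : (2 * a + 2 * b)%:E = (2%:E * a%:E + 2%:E * b%:E)%E by [].
by apply: leeD; apply: lee_wpmul2l => //; rewrite lee_fin.
Qed.

(** Cauchy-Schwarz from [|f| <= t / 2 + f ^+ 2 / (2 * t)]. Taking [t] slightly above [Num.sqrt A]
    keeps it positive when [A = 0]. *)
Lemma int_abs_le_sqrt (f : T -> R) (A : R) : measurable_fun setT f -> 0 <= A -> (int_sqr f <= A%:E)%E ->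
  (\int[P]_x `|f x|%:E <= (Num.sqrt A)%:E)%E.
Proof.
move=> mf A0 fA; apply/lee_addgt0Pr => e e0.
pose t := Num.sqrt A + e; have t0 : 0 < t by rewrite ltr_wpDl ?sqrtr_ge0.
have ti0 : 0 <= (2 * t)^-1 by rewrite invr_ge0 mulr_ge0 // ltW.
have m1 : measurable_fun setT (fun x => ((2 * t)^-1%:E * (f x ^+ 2)%:E)%E).
  by apply: emeasurable_funM; [exact: measurable_cst | exact: measurable_sqr].
have p1 x : (0 <= (2 * t)^-1%:E * (f x ^+ 2)%:E)%E.
  by rewrite -EFinM lee_fin mulr_ge0 // sqr_ge0.
apply: (@le_trans _ _ (\int[P]_x ((t / 2)%:E + (2 * t)^-1%:E * (f x ^+ 2)%:E))%E).
  apply: ge0_le_integral => //.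
  - by apply/measurable_EFinP; exact: measurableT_comp.
  - by apply: emeasurable_funD => //; exact: measurable_cst.
  - move=> x _; rewrite -EFinM -EFinD lee_fin.
    have -> : t / 2 + (2 * t)^-1 * f x ^+ 2 = (t ^+ 2 + `|f x| ^+ 2) / (2 * t).
      by rewrite real_normK ?num_real //; field; exact: lt0r_neq0.
    rewrite ler_pdivlMr ?mulr_gt0 //.
    by have := sqr_ge0 (`|f x| - t); rewrite sqrrB; lra.
rewrite ge0_integralD //; last by move=> x _; rewrite lee_fin divr_ge0 // ltW.
have -> : (\int[P]_x (t / 2)%:E = (t / 2)%:E)%E.
  by rewrite integral_cst //= probability_setT mule1.
rewrite ge0_integralZl //; last 2 first.
- exact: measurable_sqr.
- by move=> x _; rewrite lee_fin sqr_ge0.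
apply: (@le_trans _ _ ((t / 2)%:E + ((2 * t)^-1 * A)%:E)%E).
  by apply: leeD2l; rewrite EFinM; apply: lee_wpmul2l.
rewrite -!EFinD lee_fin -/t.
have -> : t / 2 + (2 * t)^-1 * A = (t ^+ 2 + A) / (2 * t) by field; exact: lt0r_neq0.
rewrite ler_pdivrMr ?mulr_gt0 //.
have : A <= t ^+ 2.
  have st : Num.sqrt A <= t by rewrite lerDl ltW.
  by rewrite -[X in X <= _](sqr_sqrtr A0) ler_sqr ?nnegrE ?sqrtr_ge0 // (le_trans _ st) ?sqrtr_ge0.
lra.
Qed.

Lemma ae_eq0_of_int (f : T -> R) : measurable_fun setT f -> (forall x, 0 <= f x) ->
  (\int[P]_x (f x)%:E <= 0)%E -> {ae P, forall x, f x = 0}.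
Proof.
move=> mf f0 If.
have mf' : measurable_fun setT (fun x => (f x)%:E) by exact/measurable_EFinP.
have : (\int[P]_x `|(f x)%:E| = 0)%E.
  apply/eqP; rewrite eq_le; apply/andP; split; last exact: integral_ge0.
  by under eq_integral do rewrite gee0_abs ?lee_fin //.
move=> /(ae_eq_integral_abs P measurableT mf').
by apply: filterS => x /(_ I) [].
Qed.

Lemma int_sqrE (f : T -> R) : (\int[P]_x `|(f x)%:E| `^ 2 = int_sqr f)%E.
Proof.
apply: eq_integral => x _; rewrite /= powR_mulrn // real_normK //.
exact: num_real.
Qed.

Lemma Lnorm2_le (f : T -> R) (A : R) : 0 <= A -> (int_sqr f <= A%:E)%E ->
  (Lnorm P 2%:E (fun x => (f x)%:E) <= (Num.sqrt A)%:E)%E.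
Proof.
move=> A0 fA; rewrite unlock -powR12_sqrt // -poweR_EFin.
rewrite int_sqrE.
apply: gt0_ler_poweR fA; first by rewrite invr_ge0.
  by rewrite in_itv /= int_sqr_ge0 leey.
by rewrite in_itv /= lee_fin A0 leey.
Qed.

(** For [0 < e <= 1 <= p] one has [e^p <= e], so smallness of the norm passes to the integral of the
    power with the same [e]. *)
Lemma int_powR_of_Lnorm (f : T -> \bar R) (p e : R) : 1 <= p -> 0 < e -> e <= 1 ->
  (Lnorm P p%:E f <= e%:E)%E -> (\int[P]_x (`|f x| `^ p) <= e%:E)%E.
Proof.
move=> p1 e0 e1 fe; have p0 : 0 < p by apply: lt_le_trans p1.
rewrite -poweR_Lnorm ?gt_eqF //.
apply: (@le_trans _ _ (e%:E `^ p)%E).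
  apply: gt0_ler_poweR; rewrite ?(ltW p0) // ?in_itv /= ?andbT ?leey ?Lnorm_ge0 ?lee_fin ?(ltW e0) //.
by rewrite poweR_EFin lee_fin; apply: ge1r_powR => //; rewrite e0.
Qed.

End AlmostEverywhere.

(** * The Wiener functionals ell *)

Lemma cvge_eventually_le (R : realType) (f : nat -> \bar R) (e : R) :
  f n @[n --> \oo] --> (0 : \bar R)%E -> 0 < e -> \forall n \near \oo, (f n <= e%:E)%E.
Proof.
move=> f0 e0; have : nbhs (0 : \bar R)%E [set y : \bar R | (y < e%:E)%E].
  by apply: nbhs_open_ereal_lt.
move=> /f0 fe; have : \forall n \near \oo, (f n < e%:E)%E by exact: fe.
by apply: filterS => n /ltW.
Qed.

Section EllExistence.
Variables (R : realType) (W V : normedModType R) (q : W -> W -> R) (E : W -> V).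
Variables (mu : probability (borel V) R) (h : R).
Hypothesis h0 : 0 < h.
Hypothesis mu_gauss : gaussian_measure q E h mu.
Hypothesis q_scalar : forall y, scalar (q^~ y).
Hypothesis qC : forall x y, q x y = q y x.
Hypothesis q_lo : forall x, `|x| ^+ 2 <= q x x.
Hypothesis q_hi : forall x, q x x <= 2 * `|x| ^+ 2.
Hypothesis E_dense : dense (range E).
Variables (u : nat -> W) (Y : nat -> V -> R).
Hypothesis u_on : forall i j, q (u i) (u j) = (i == j)%:R.
Hypothesis u_dense : dense (linspan (range u)).
Hypothesis Y_dual : forall i, dual_elt q E (Y i) (u i).
Local Notation g := (gvar h).

Lemma int_sqr_dual y b : dual_elt q E y b -> int_sqr mu y = (g * q b b)%:E.
Proof. exact: second_moment. Qed.

Lemma dual_eltB y b y' b' : dual_elt q E y b -> dual_elt q E y' b' ->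
  dual_elt q E (fun x => y x - y' x) (b - b').
Proof.
move=> dy dy'; have := dual_lin q_scalar 1 (-1) dy dy'.
rewrite scale1r scaleN1r (_ : (fun x => _) = (fun x => y x - y' x)) //.
by apply/funext => x; rewrite mul1r mulN1r.
Qed.

Lemma q_addr_le x y : q (x + y) (x + y) <= 2 * q x x + 2 * q y y.
Proof.
have := q_ge0 q_lo (x - y).
rewrite (qBl q_scalar) !(qBr qC q_scalar) (qDl q_scalar) !(qDr qC q_scalar) (qC y x); lra.
Qed.

(* l represents the continuous extension at a: it is an L^2 limit of continuous
   linear forms whose representatives tend to a. *)
Definition l2_value (a : W) (l : V -> R) :=
  measurable_fun setT (l : borel V -> R) /\
  forall e : R, 0 < e -> exists y b, [/\ dual_elt q E y b, `|b - a| <= e &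
    (int_sqr mu (fun x => (y x - l x)%R) <= e%:E)%E].

(** Compare [y] with a form [y'] close to [l], using the isometry of second moments. The 4 is a 2
    from [int_sqrD] times a 2 from [q_addr_le]; the leftover terms amount to [(8 * g + 2) * e'],
    hence the choice of [K]. *)
Lemma l2_value_dist a l y b : l2_value a l -> dual_elt q E y b ->
  (int_sqr mu (fun x => (y x - l x)%R) <= (4 * g * q (b - a) (b - a))%:E)%E.
Proof.
move=> [ml la] dy; apply/lee_addgt0Pr => e e0.
have g0 := gvar_ge0 h0.
pose K := 8 * g + 2; have K0 : 0 < K by rewrite /K; lra.
pose e' := Num.min 1 (e / K).
have e'0 : 0 < e' by rewrite lt_min ltr01 divr_gt0.
have e'1 : e' <= 1 by rewrite ge_min lexx.
have e'K : e' * K <= e by rewrite -ler_pdivlMr // ge_min lexx orbT.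
have [y' [b' [dy' b'a y'l]]] := la e' e'0.
have my := dual_measurable dy; have my' := dual_measurable dy'.
have I1 : (int_sqr mu (fun x => (y x - y' x)%R) <= (g * q (b - b') (b - b'))%:E)%E.
  by rewrite (int_sqr_dual (dual_eltB dy dy')).
have := int_sqrD (measurable_funB my my') (measurable_funB my' ml) I1 y'l.
have -> : (fun x => (y x - y' x + (y' x - l x))%R) = (fun x => (y x - l x)%R).
  by apply/funext => x; ring.
move=> H; apply: (le_trans H); rewrite -EFinD lee_fin.
have bb : b - b' = (b - a) + (a - b') by rewrite addrA subrK.
have q1 := q_addr_le (b - a) (a - b'); rewrite -bb in q1.
have q2 : q (a - b') (a - b') <= 2 * e'.
  apply: (le_trans (q_hi _)); rewrite distrC ler_pM2l //.
  apply: (@le_trans _ _ (e' ^+ 2)); first by rewrite ler_sqr ?nnegrE // ltW.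
  by rewrite expr2 ler_piMr // ltW.
have : g * q (b - b') (b - b') <= g * (2 * q (b - a) (b - a) + 2 * (2 * e')).
  by apply: ler_wpM2l => //; lra.
by move: e'K; rewrite /K; lra.
Qed.

Lemma l2_value_lin (c c' : R) a a' l l' : l2_value a l -> l2_value a' l' ->
  l2_value (c *: a + c' *: a') (fun x => c * l x + c' * l' x).
Proof.
move=> [ml la] [ml' la']; split.
  by apply: measurable_funD; apply: measurable_funM => //; exact: measurable_cst.
move=> e e0; pose K := `|c| + `|c'| + 2 * c ^+ 2 + 2 * c' ^+ 2 + 1.
have c20 := sqr_ge0 c; have c20' := sqr_ge0 c'.
have K0 : 0 < K by rewrite /K; have := normr_ge0 c; have := normr_ge0 c'; lra.
pose e' := e / K; have e'0 : 0 < e' by exact: divr_gt0.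
have e'K : e' * K = e by rewrite divfK // gt_eqF.
have [y [b [dy ba yl]]] := la e' e'0; have [y' [b' [dy' ba' yl']]] := la' e' e'0.
exists (fun x => c * y x + c' * y' x), (c *: b + c' *: b'); split.
- exact: dual_lin.
- rewrite opprD addrACA -!scalerBr; apply: (le_trans (ler_normD _ _)).
  rewrite !normrZ.
  have : `|c| * `|b - a| <= `|c| * e' by rewrite ler_wpM2l.
  have : `|c'| * `|b' - a'| <= `|c'| * e' by rewrite ler_wpM2l.
  have : 0 <= (2 * c ^+ 2 + 2 * c' ^+ 2 + 1) * e' by rewrite mulr_ge0 // ?(ltW e'0) //; lra.
  by move: e'K; rewrite /K; lra.
- have my := dual_measurable dy; have my' := dual_measurable dy'.
  have mB := measurable_funB my ml; have mB' := measurable_funB my' ml'.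
  have I1 : (int_sqr mu (fun x => (c * (y x - l x))%R) <= (c ^+ 2 * e')%:E)%E.
    exact: int_sqrZ_le.
  have I2 : (int_sqr mu (fun x => (c' * (y' x - l' x))%R) <= (c' ^+ 2 * e')%:E)%E.
    exact: int_sqrZ_le.
  have m1 : measurable_fun setT (fun x : borel V => c * (y x - l x)).
    by apply: measurable_funM => //; exact: measurable_cst.
  have m2 : measurable_fun setT (fun x : borel V => c' * (y' x - l' x)).
    by apply: measurable_funM => //; exact: measurable_cst.
  have := int_sqrD m1 m2 I1 I2.
  have -> : (fun x => (c * (y x - l x) + c' * (y' x - l' x))%R) =
      (fun x => (c * y x + c' * y' x - (c * l x + c' * l' x))%R).
    by apply/funext => x; ring.
  move=> H; apply: (le_trans H); rewrite lee_fin.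
  have : 0 <= (`|c| + `|c'| + 1) * e'.
    by rewrite mulr_ge0 // ?(ltW e'0) // !addr_ge0.
  by move: e'K; rewrite /K; lra.
Qed.

Lemma l2_value_dual y b : dual_elt q E y b -> l2_value b y.
Proof.
move=> dy; split=> [|e e0]; first exact: dual_measurable dy.
exists y, b; split=> //; first by rewrite subrr normr0 ltW.
rewrite /int_sqr; under eq_integral do rewrite subrr expr0n /=.
by rewrite integral0 lee_fin ltW.
Qed.

Lemma l2_value_sum n (c : 'I_n -> R) (a : 'I_n -> W) (l : 'I_n -> V -> R) :
  (forall i, l2_value (a i) (l i)) ->
  l2_value (\sum_i c i *: a i) (fun x => \sum_i c i * l i x).
Proof.
elim: n c a l => [|n IH] c a l la.
  rewrite big_ord0 (_ : (fun x => _) = fun=> 0).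
    exact: l2_value_dual (dual_elt0 E q_scalar).
  by apply/funext => x; rewrite big_ord0.
have := l2_value_lin 1 (c ord0) (IH (fun i => c (lift ord0 i)) _ _
  (fun i => la (lift ord0 i))) (la ord0).
rewrite big_ord_recl scale1r addrC (_ : (fun x => 1 * _ + _) = (fun x => \sum_i c i * l i x)) //.
by apply/funext => x; rewrite big_ord_recl mul1r addrC.
Qed.

Lemma dual_fproj n a : dual_elt q E (fun x => \sum_(i < n) q a (u i) * Y i x) (fproj q u n a).
Proof. exact: (dual_elt_sum q_scalar (fun i => q a (u i)) (fun i _ => Y_dual i)). Qed.

Lemma dual_approx a (e : R) : 0 < e -> exists n, `|fproj q u n a - a| <= e.
Proof.
move=> e0; have := fproj_cvg qC q_scalar q_lo q_hi u_on u_dense (z := a).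
move=> /cvgrPdist_le /(_ e e0) [n _ /(_ n (leqnn _))] /= H; exists n.
by rewrite distrC.
Qed.

Lemma sum_geometric_le n : \sum_(i < n) ((2^-1 : R) ^+ i) <= 2.
Proof.
suff -> : \sum_(i < n) ((2^-1 : R) ^+ i) = 2 - 2 * 2^-1 ^+ n.
  by rewrite lerBlDr lerDl mulr_ge0 // exprn_ge0 // invr_ge0.
elim: n => [|n IH]; first by rewrite big_ord0 expr0 mulr1 subrr.
by rewrite big_ord_recr /= IH exprS; field.
Qed.

(** Take Fourier sums within [2^-k] of [a]. The increments of the corresponding forms have summable
    integrals, so these forms converge almost everywhere, and Fatou's lemma bounds the squared
    distance to the limit. *)
Lemma l2_value_exists a : exists l, l2_value a l.
Proof.
have g0 := gvar_ge0 h0.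
pose r k : R := 2^-1 ^+ k.
have r0 k : 0 < r k by rewrite exprn_gt0 // invr_gt0.
have /choice [N bN] : forall k, exists n, `|fproj q u n a - a| <= r k.
  by move=> k; exact: dual_approx.
pose b k := fproj q u (N k) a.
pose y k x := \sum_(i < N k) q a (u i) * Y i x.
have dy k : dual_elt q E (y k) (b k) by exact: dual_fproj.
have my k : measurable_fun setT (y k : borel V -> R) by exact: dual_measurable (dy k).
have bb k m : q (b k - b m) (b k - b m) <= 2 * (r k + r m) ^+ 2.
  apply: (le_trans (q_hi _)); rewrite ler_pM2l // ler_sqr ?nnegrE ?addr_ge0 ?(ltW (r0 _)) //.
  have -> : b k - b m = (b k - a) - (b m - a) by rewrite opprB addrA subrK.
  by apply: (le_trans (ler_normB _ _)); apply: lerD; exact: bN.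
have Iy k m : int_sqr mu (fun x => (y k x - y m x)%R) = (g * q (b k - b m) (b k - b m))%:E.
  exact: int_sqr_dual (dual_eltB (dy k) (dy m)).
pose dd k x := y k.+1 x - y k x.
have mdd k : measurable_fun setT (dd k : borel V -> R) by exact: measurable_funB.
(* The squared increment is at most [g * (2 * (r k.+1 + r k) ^+ 2)], itself at most
   [8 * g * r k ^+ 2]. *)
pose K := Num.sqrt (8 * g).
have Idd k : (\int[mu]_x `|dd k x|%:E <= (K * r k)%:E)%E.
  have A0 : 0 <= 8 * g * r k ^+ 2 by apply: mulr_ge0; [exact: mulr_ge0 | exact: sqr_ge0].
  have : (int_sqr mu (dd k) <= (8 * g * r k ^+ 2)%:E)%E.
    rewrite Iy lee_fin; apply: (@le_trans _ _ (g * (2 * (r k.+1 + r k) ^+ 2))).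
      by rewrite ler_wpM2l.
    rewrite [X in _ <= X](_ : _ = g * (2 * (r k + r k) ^+ 2)); last by ring.
    apply: ler_wpM2l => //; rewrite ler_pM2l // ler_sqr ?nnegrE ?addr_ge0 ?(ltW (r0 _)) //.
    rewrite lerD2r /r exprS ler_piMl ?(ltW (r0 k)) //; lra.
  move=> /(int_abs_le_sqrt (mdd k) A0).
  have -> : Num.sqrt (8 * g * r k ^+ 2) = K * r k; last by [].
  rewrite (@sqrtrM _ (8 * g) (r k ^+ 2)); last exact: mulr_ge0.
  by congr (_ * _); rewrite sqrtr_sqr ger0_norm // ltW.
have KS n : \sum_(i < n) K * r i <= K * 2.
  by rewrite -mulr_sumr ler_wpM2l ?sqrtr_ge0 // sum_geometric_le.
have aeS := ae_bounded_sums mdd Idd KS.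
pose l := limfun (fun k (x : borel V) => y k x).
have ml : measurable_fun setT (l : borel V -> R) by exact: measurable_limfun.
have yl : {ae mu, forall x : borel V, y k x @[k --> \oo] --> l x}.
  apply: filterS aeS => x [s sx].
  have /cvg_ex [c hc] := @partial_sums_cvg R (fun i => dd i x) s sx.
  have yc : y k x @[k --> \oo] --> y 0%N x + c.
    have -> : (fun k => y k x) = (fun k => y 0%N x + series (fun k => dd k x) k).
      apply/funext => k; rewrite /series /= telescope_sumr //.
      by rewrite addrC subrK.
    by apply: cvgD; [exact: cvg_cst | exact: hc].
  have lx : l x = y 0%N x + c by exact: (@limfunE R _ (borel V) (fun k (x : borel V) => y k x) x _ yc).
  by rewrite lx.
exists l; split=> // e e0.
have [k kr] : exists k, r k <= Num.min e (e / (2 * g + 1)).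
  have m0 : 0 < Num.min e (e / (2 * g + 1)) by rewrite lt_min e0 divr_gt0 //; lra.
  have /cvgrPdist_le /(_ _ m0) [k _ /(_ k (leqnn _))] : r k @[k --> \oo] --> 0.
    by apply: cvg_expr; rewrite ger0_norm ?invr_ge0 // invf_lt1 // ltr1n.
  by rewrite /= sub0r normrN ger0_norm ?(ltW (r0 _)) // => H; exists k.
have [ke kg] : r k <= e /\ r k <= e / (2 * g + 1).
  by move: kr; rewrite le_min => /andP[].
exists (y k), (b k); split=> //; first exact: le_trans (bN k) ke.
apply: (@le_trans _ _ (2 * g * r k)%:E); last first.
  by rewrite lee_fin; move: kg; rewrite ler_pdivlMr; have := r0 k; lra.
apply: (@le_trans _ _ (g * (2 * (r k + 0) ^+ 2))%:E); last first.
  rewrite lee_fin addr0 mulrA (mulrC g); apply: ler_wpM2l; first exact: mulr_ge0.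
  rewrite expr2; apply: ler_piMr; first exact: ltW.
  by apply: exprn_ile1; rewrite ?invr_ge0 // invf_le1 // ler1n.
have ae2 : {ae mu, forall x : borel V, (y k x - y n x) ^+ 2 @[n --> \oo] --> (y k x - l x) ^+ 2}.
  apply: filterS yl => x yx.
  have c1 : y k x - y n x @[n --> \oo] --> y k x - l x.
    by apply: cvgB; [exact: cvg_cst | exact: yx].
  by rewrite expr2; under eq_fun do rewrite expr2; exact: cvgM.
apply: (@fatou_ae _ _ _ mu (fun n x => (y k x - y n x) ^+ 2) _
  (fun n => g * (2 * (r k + r n) ^+ 2))).
- by move=> n; apply: measurable_funX; exact: measurable_funB.
- by apply: measurable_funX; exact: measurable_funB.
- by move=> n x; exact: sqr_ge0.
- by move=> x; exact: sqr_ge0.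
- exact: ae2.
- by move=> n; rewrite -[X in (X <= _)%E]/(int_sqr mu (fun x => (y k x - y n x)%R)) Iy lee_fin ler_wpM2l.
- have rc : r n @[n --> \oo] --> 0.
    by apply: cvg_expr; rewrite ger0_norm ?invr_ge0 // invf_lt1 // ltr1n.
  have c1 : r k + r n @[n --> \oo] --> r k + 0 by apply: cvgD => //; exact: cvg_cst.
  apply: cvgM; first exact: cvg_cst.
  apply: cvgM; first exact: cvg_cst.
  by rewrite expr2; under eq_fun do rewrite expr2; exact: cvgM.
Qed.

(** [is_ell] quantifies over all sequences tending to [a], [l2_value] asks for one form at each
    precision. Fourier sums give one direction, the estimate [l2_value_dist] the other. *)
Lemma is_ell_l2_value a l : is_ell q E mu a l <-> l2_value a l.
Proof.
have g0 := gvar_ge0 h0.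
split=> [[lL la]|al].
  have ml : measurable_fun setT (l : borel V -> R).
    by have := sub_Lfun_mfun lL; rewrite inE.
  split=> // e e0.
  have H := la _ _ (fun n => dual_fproj n a)
    (fproj_cvg qC q_scalar q_lo q_hi u_on u_dense (z := a)).
  pose e1 := Num.min 1 e; have e10 : 0 < e1 by rewrite lt_min ltr01.
  have e1e : e1 <= e by rewrite ge_min lexx orbT.
  have e11 : e1 <= 1 by rewrite ge_min lexx.
  have /cvgrPdist_le /(_ e e0) N1 := fproj_cvg qC q_scalar q_lo q_hi u_on u_dense (z := a).
  have N2 : \forall n \near \oo, (Lnorm mu 2%:E
      (fun x => (\sum_(i < n) q a (u i) * Y i x - l x)%:E) <= e1%:E)%E.
    by apply: (cvge_eventually_le H).
  have [n [Hn1 Hn2]] : exists n, `|a - fproj q u n a| <= e /\ (Lnorm mu 2%:E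
      (fun x => (\sum_(i < n) q a (u i) * Y i x - l x)%:E) <= e1%:E)%E.
    by have [m [? ?]] := filter_ex (filterI N1 N2); exists m.
  exists (fun x => \sum_(i < n) q a (u i) * Y i x), (fproj q u n a); split.
  - exact: dual_fproj.
  - by rewrite distrC.
  - have := int_powR_of_Lnorm (ler1n R 2) e10 e11 Hn2.
    by rewrite int_sqrE => /le_trans; apply; rewrite lee_fin.
have [ml _] := al.
have dist y b : dual_elt q E y b ->
    (Lnorm mu 2%:E (fun x => (y x - l x)%:E) <= (Num.sqrt (8 * g) * `|b - a|)%:E)%E.
  move=> dy; have A0 : 0 <= 8 * g * `|b - a| ^+ 2 by apply: mulr_ge0; [exact: mulr_ge0 | exact: sqr_ge0].
  have I1 : (int_sqr mu (fun x => (y x - l x)%R) <= (8 * g * `|b - a| ^+ 2)%:E)%E.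
    apply: (le_trans (l2_value_dist al dy)); rewrite lee_fin.
    apply: (@le_trans _ _ (4 * g * (2 * `|b - a| ^+ 2))); last by rewrite le_eqVlt; apply/orP; left; apply/eqP; ring.
    by apply: ler_wpM2l; [exact: mulr_ge0 | exact: q_hi].
  have := Lnorm2_le A0 I1.
  have -> : Num.sqrt (8 * g * `|b - a| ^+ 2) = Num.sqrt (8 * g) * `|b - a|; last by [].
  rewrite (@sqrtrM _ (8 * g) (`|b - a| ^+ 2)); last exact: mulr_ge0.
  by rewrite sqrtr_sqr normr_id.
split.
  rewrite inE; apply/andP; split; rewrite inE //=.
  rewrite /finite_norm.
  have := dist _ _ (dual_elt0 E q_scalar).
  under eq_Lnorm do rewrite sub0r EFinN.
  by have := oppe_Lnorm mu (EFin \o l) 2%:E => -> /le_lt_trans; apply; exact: ltry.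
move=> y b dy ba.
have c1 : (Num.sqrt (8 * g) * `|b n - a|)%:E @[n --> \oo] --> 0%:E.
  apply: cvg_EFin; first exact: nearW.
  rewrite -[X in _ --> X](mulr0 (Num.sqrt (8 * g))); apply: cvgM; first exact: cvg_cst.
  rewrite -(normr0 W) -(subrr a); apply: cvg_norm; apply: cvgB => //; exact: cvg_cst.
apply: (squeeze_cvge _ (cvg_cst 0%E) c1); apply: nearW => n.
by rewrite Lnorm_ge0 dist.
Qed.

Lemma ell_l2_value a : l2_value a (ell q E mu a).
Proof.
apply/is_ell_l2_value; apply: (@xgetPex _ _ [set l | is_ell q E mu a l]).
by have [l la] := l2_value_exists a; exists l; apply/is_ell_l2_value.
Qed.

End EllExistence.

(** * Stochastic extensions *)

Lemma cvge0_of_le (R : realType) (f : nat -> \bar R) : (forall n, 0 <= f n)%E ->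
  (forall e : R, 0 < e -> \forall n \near \oo, (f n <= e%:E)%E) ->
  f n @[n --> \oo] --> (0 : \bar R)%E.
Proof.
move=> f0 fe; apply/fine_cvgP; split.
  apply: filterS (fe 1 ltr01) => n fn.
  by rewrite ge0_fin_numE // (le_lt_trans fn) ?ltry.
apply/cvgrPdist_le => e e0; apply: filterS (fe e e0) => n fn.
have fin : f n \is a fin_num by rewrite ge0_fin_numE // (le_lt_trans fn) ?ltry.
rewrite sub0r normrN ger0_norm /=; last exact: fine_ge0.
by rewrite -lee_fin fineK.
Qed.

Section StochasticExtension.
Variables (R : realType) (W V : normedModType R) (q : W -> W -> R) (E : W -> V).
Variables (mu : probability (borel V) R) (h : R).
Hypothesis h0 : 0 < h.
Hypothesis mu_gauss : gaussian_measure q E h mu.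
Hypothesis q_scalar : forall y, scalar (q^~ y).
Hypothesis qC : forall x y, q x y = q y x.
Hypothesis q_lo : forall x, `|x| ^+ 2 <= q x x.
Hypothesis q_hi : forall x, q x x <= 2 * `|x| ^+ 2.
Hypothesis E_dense : dense (range E).
Variables (u : nat -> W) (Y : nat -> V -> R).
Hypothesis u_on : forall i j, q (u i) (u j) = (i == j)%:R.
Hypothesis u_dense : dense (linspan (range u)).
Hypothesis Y_dual : forall i, dual_elt q E (Y i) (u i).
Variables (w : nat -> R) (Sw : R).
Hypothesis w_ge0 : forall k, 0 <= w k.
Hypothesis w_cvg : \sum_(i < n) w i @[n --> \oo] --> Sw.
Local Notation g := (gvar h).

Let g0 : 0 <= g. Proof. exact: gvar_ge0. Qed.

Lemma w_partial_le n : \sum_(i < n) w i <= Sw.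
Proof.
rewrite -(cvg_lim (@Rhausdorff R) w_cvg); apply: (nondecreasing_cvgn_le _ _ n).
  by apply/nondecreasing_seqP => k; rewrite big_ord_recr /= lerDl.
by apply/cvg_ex; exists Sw.
Qed.

(* This is what makes f (gsum n x) a Cauchy sequence for almost every x. *)
Definition slow (f : W -> R) (C D : R) :=
  [/\ forall x, `|f x| <= C, continuous f, 0 <= D &
      forall y z s, (forall n, \sum_(i < n) w i * `|q z (u i)| <= s) ->
        `|f (y + z) - f y| <= D * s].

Definition gsum n (x : V) : W := \sum_(i < n) Y i x *: u i.

Definition ext (f : W -> R) : borel V -> R := limfun (fun n (x : borel V) => f (gsum n x)).

(** A condition on [x] that does not mention [f]: a single set of full measure serves for all slow
    functions, in particular for both parts of a symbol. *)
Definition good (x : V) := exists s : R, forall n, \sum_(i < n) `|w i * Y i x| <= s.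

Let mY i : measurable_fun setT (Y i : borel V -> R).
Proof. exact: dual_measurable (Y_dual i). Qed.

Lemma ae_good : {ae mu, forall x : borel V, good x}.
Proof.
have mwY i : measurable_fun setT (fun x : borel V => w i * Y i x).
  by apply: measurable_funM => //; exact: measurable_cst.
apply: (ae_bounded_sums (c := fun i => Num.sqrt g * w i) (S := Num.sqrt g * Sw) mwY).
  move=> i; have A0 : 0 <= g * w i ^+ 2 by apply: mulr_ge0 => //; exact: sqr_ge0.
  have -> : Num.sqrt g * w i = Num.sqrt (g * w i ^+ 2).
    by rewrite (@sqrtrM _ g (w i ^+ 2)) // sqrtr_sqr ger0_norm.
  apply: int_abs_le_sqrt => //; rewrite (mulrC g); apply: int_sqrZ_le => //.
  rewrite (int_sqr_dual h0 mu_gauss q_scalar qC q_lo E_dense (Y_dual i)).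
  by rewrite u_on eqxx mulr1.
by move=> n; rewrite -mulr_sumr ler_wpM2l ?sqrtr_ge0 // w_partial_le.
Qed.

Lemma measurable_gsum (f : W -> R) n : continuous f ->
  measurable_fun setT (fun x : borel V => f (gsum n x)).
Proof.
move=> cf; have -> : (fun x => f (gsum n x)) = (fun x => f (0 + \sum_(i < n) Y i x *: u i)).
  by apply/funext => x; rewrite add0r.
exact: measurable_lincomb.
Qed.

Lemma measurable_ext (f : W -> R) : continuous f -> measurable_fun setT (ext f).
Proof. by move=> cf; apply: measurable_limfun => n; exact: measurable_gsum. Qed.

Lemma q_gsum n x k : q (gsum n x) (u k) = if (k < n)%N then Y k x else 0.
Proof.
rewrite /gsum (q_suml q_scalar (fun i : 'I_n => Y i x)); case: ifP => kn.
  rewrite (bigD1 (Ordinal kn)) //= u_on eqxx mulr1 big1 ?addr0 // => i ij.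
  by rewrite u_on -val_eqE /= in ij *; rewrite (negbTE ij) mulr0.
rewrite big1 // => i _; rewrite u_on; case: eqP => [ij|]; last by rewrite mulr0.
by move: kn; rewrite -ij ltn_ord.
Qed.

Lemma q_coord_le z i : `|q z (u i)| <= 2 * `|z|.
Proof.
apply: le_trans (q_le qC q_scalar q_lo q_hi _ _) _.
rewrite ler_piMr ?mulr_ge0 // -(@ler_sqr _ _ 1) ?nnegrE // expr1n.
by apply: le_trans (q_lo _) _; rewrite u_on eqxx.
Qed.

Section OneSymbol.
Variables (f : W -> R) (C D : R).
Hypothesis f_slow : slow f C D.

Lemma ext_le x : `|ext f x| <= C.
Proof. by apply: limfun_le => n; have [fC _ _ _] := f_slow; exact: fC. Qed.

Lemma ext_cvg x : good x -> f (gsum n x) @[n --> \oo] --> ext f x.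
Proof.
have [_ _ D0 fD] := f_slow; move=> [s sx].
pose dd n := f (gsum n.+1 x) - f (gsum n x).
have dle n : `|dd n| <= D * `|w n * Y n x|.
  rewrite /dd /gsum big_ord_recr /=; apply: fD => m.
  have -> : \sum_(i < m) w i * `|q (Y n x *: u n) (u i)| =
      \sum_(i < m) (if i == n :> nat then `|w n * Y n x| else 0).
    apply: eq_bigr => i _; rewrite (qZl q_scalar) u_on eq_sym.
    case: eqP => [->|]; last by rewrite mulr0 normr0 mulr0.
    by rewrite mulr1 normrM (ger0_norm (w_ge0 _)).
  rewrite -big_mkcond /=; have [nm|mn] := ltnP n m.
    rewrite (bigD1 (Ordinal nm)) //= big1 ?addr0 // => i /andP[/eqP ii].
    by rewrite -val_eqE /= ii eqxx.
  rewrite big_pred0 // => i; apply/negbTE; rewrite neq_ltn.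
  by rewrite (leq_trans (ltn_ord i) mn).
have ds n : \sum_(i < n) `|dd i| <= D * s.
  apply: (@le_trans _ _ (\sum_(i < n) D * `|w i * Y i x|)).
    by apply: ler_sum => i _; exact: dle.
  by rewrite -mulr_sumr ler_wpM2l.
have /cvg_ex [c hc] := partial_sums_cvg ds.
have fc : f (gsum n x) @[n --> \oo] --> f (gsum 0 x) + c.
  have -> : (fun n => f (gsum n x)) = (fun n => f (gsum 0 x) + series dd n).
    by apply/funext => n; rewrite /series /= telescope_sumr // addrC subrK.
  by apply: cvgD; [exact: cvg_cst | exact: hc].
have e : ext f x = f (gsum 0 x) + c.
  exact: (@limfunE R _ (borel V) (fun n (x : borel V) => f (gsum n x)) x _ fc).
by rewrite e.
Qed.

(** A genuine point [z] is compared with [x] through coordinates only. Replacing [x] by [gsum m x]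
    costs the tail of the weights times a bound for the coordinates of [z], and this vanishes as [m]
    grows. *)
Lemma ext_dist x z s : good x ->
  (forall n, \sum_(i < n) w i * `|q z (u i) - Y i x| <= s) -> `|f z - ext f x| <= D * s.
Proof.
have [_ _ D0 fD] := f_slow; move=> gx zs.
have step m : `|f z - f (gsum m x)| <= D * (s + 2 * `|z| * (Sw - \sum_(i < m) w i)).
  have {1}-> : z = gsum m x + (z - gsum m x) by rewrite addrC subrK.
  apply: fD => n.
  have le1 i : w i * `|q (z - gsum m x) (u i)| <=
      w i * `|q z (u i) - Y i x| + (if (i < m)%N then 0 else 2 * `|z| * w i).
    rewrite (qBl q_scalar) q_gsum; case: ifP => im; first by rewrite addr0.
    rewrite subr0 -[X in X <= _]add0r; apply: lerD; first by rewrite mulr_ge0.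
    by rewrite mulrC ler_wpM2r // q_coord_le.
  apply: (@le_trans _ _ (\sum_(i < n) (w i * `|q z (u i) - Y i x| +
      (if (i < m)%N then 0 else 2 * `|z| * w i)))); first by apply: ler_sum => i _.
  rewrite big_split /=; apply: lerD; first exact: zs.
  have [mn|nm] := leqP m n; last first.
    rewrite big1 ?mulr_ge0 ?subr_ge0 ?w_partial_le // => i _.
    by rewrite (ltn_trans (ltn_ord i) nm).
  rewrite -(sum_ord_sub (fun i => 2 * `|z| * w i) mn) -!mulr_sumr -mulrBr.
  by rewrite ler_wpM2l ?mulr_ge0 // lerD2r w_partial_le.
have c1 : f z - f (gsum n x) @[n --> \oo] --> f z - ext f x.
  by apply: cvgB; [exact: cvg_cst | exact: ext_cvg].
have c1' : `|f z - f (gsum n x)| @[n --> \oo] --> `|f z - ext f x| by exact: cvg_norm.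
have c2 : D * (s + 2 * `|z| * (Sw - \sum_(i < n) w i)) @[n --> \oo] -->
    D * (s + 2 * `|z| * (Sw - Sw)).
  apply: cvgM; first exact: cvg_cst.
  apply: cvgD; first exact: cvg_cst.
  apply: cvgM; first exact: cvg_cst.
  by apply: cvgB; [exact: cvg_cst | exact: w_cvg].
rewrite subrr mulr0 addr0 in c2.
by apply: (ler_cvg_to c1' c2); apply: nearW.
Qed.

End OneSymbol.

(** * Projection of the Wiener space onto a finite dimensional subspace *)

Section Projection.
Variables (n : nat) (t : n.-tuple W).
Hypothesis t_on : orthonormal_tuple q t.
Local Notation tp := (tpi q E mu t).

Definition oproj (v : W) : W := \sum_(j < n) q v (tnth t j) *: tnth t j.

(** The squared distance, for [q], from [v] to the span of [t]. *)
Definition defect (v : W) := q (v - oproj v) (v - oproj v).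

Lemma defect_ge0 v : 0 <= defect v. Proof. exact: q_ge0. Qed.

Lemma q_oproj v j : q (v - oproj v) (tnth t j) = 0.
Proof.
rewrite (qBl q_scalar) (q_suml q_scalar (fun j => q v (tnth t j)) (tnth t)).
rewrite (bigD1 j) //= t_on eqxx mulr1 big1 ?addr0 ?subrr // => i ij.
by rewrite t_on (negbTE ij) mulr0.
Qed.

Lemma q_oproj_span v x : linspan [set` t] x -> q (v - oproj v) x = 0.
Proof.
move=> [m [c [b [tb ->]]]]; rewrite qC (q_suml q_scalar) big1 // => i _.
have /tnthP [j ->] : b i \in t := tb i.
by rewrite qC q_oproj mulr0.
Qed.

Lemma oproj_span v : linspan [set` t] (oproj v).
Proof.
by exists n, (fun j => q v (tnth t j)), (tnth t); split=> // j; exact: mem_tnth.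
Qed.

Lemma defect_le v x : linspan [set` t] x -> defect v <= q (v - x) (v - x).
Proof.
have gen (a b : W) : q a b = 0 -> q a a <= q (a + b) (a + b).
  move=> ab; rewrite (qDl q_scalar) !(qDr qC q_scalar) (qC b a) ab addr0 add0r lerDl.
  exact: q_ge0.
move=> tx; have -> : v - x = (v - oproj v) + (oproj v - x) by rewrite addrA subrK.
by apply: gen; rewrite (qBr qC q_scalar) !q_oproj_span ?subrr //; exact: oproj_span.
Qed.

Lemma defect_le1 v : q v v = 1 -> defect v <= 1.
Proof.
move=> v1; have := @defect_le v 0; rewrite subr0 v1; apply.
by exists 0%N, (fun _ => 0), (fun _ => 0); split=> [[]//|]; rewrite big_ord0.
Qed.

Let ell_val a := ell_l2_value h0 mu_gauss q_scalar qC q_lo q_hi E_dense u_on u_dense Y_dual a.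

(** By linearity the coordinate [k] of the projected point is a functional of the projection of
    [u k]; its distance to [Y k] is therefore controlled by the defect of [u k]. *)
Lemma tpi_l2_value k : l2_value q E mu (oproj (u k)) (fun x => q (tp x) (u k)).
Proof.
have -> : (fun x => q (tp x) (u k)) =
    (fun x => \sum_(j < n) q (u k) (tnth t j) * ell q E mu (tnth t j) x).
  apply/funext => x; rewrite /tpi (q_suml q_scalar (fun j => ell q E mu (tnth t j) x)).
  by apply: eq_bigr => j _; rewrite mulrC (qC (u k)).
exact: (l2_value_sum q_scalar _ (fun j => ell_val (tnth t j))).
Qed.

Lemma measurable_tpi (f : W -> R) : continuous f -> measurable_fun setT (fun x : borel V => f (tp x)).
Proof.
move=> cf; have -> : (fun x => f (tp x)) =
   (fun x => f (0 + \sum_(j < n) ell q E mu (tnth t j) x *: tnth t j)).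
  by apply/funext => x; rewrite add0r.
by apply: measurable_lincomb => // j; have [] := ell_val (tnth t j).
Qed.

Definition coord_err k := Num.sqrt (4 * g * defect (u k)).

Lemma coord_err_le k : coord_err k <= Num.sqrt (4 * g).
Proof.
rewrite ler_wsqrtr // -[leRHS]mulr1; apply: ler_wpM2l; first exact: mulr_ge0.
by apply: defect_le1; rewrite u_on eqxx.
Qed.

Lemma tpi_coord k :
  (\int[mu]_x `|(w k * (q (tp x) (u k) - Y k x))%R|%:E <= (w k * coord_err k)%:E)%E.
Proof.
have [ml _] := tpi_l2_value k.
have A0 : 0 <= 4 * g * defect (u k).
  by apply: mulr_ge0; [exact: mulr_ge0 | exact: defect_ge0].
have := l2_value_dist h0 mu_gauss q_scalar qC q_lo q_hi E_dense (tpi_l2_value k) (Y_dual k).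
rewrite -/(defect (u k)) => I1.
have I2 : (int_sqr mu (fun x => (w k * (Y k x - q (tp x) (u k)))%R) <=
    (w k ^+ 2 * (4 * g * defect (u k)))%:E)%E.
  by apply: int_sqrZ_le => //; exact: measurable_funB.
have mm : measurable_fun setT (fun x : borel V => w k * (Y k x - q (tp x) (u k))).
  by apply: measurable_funM; [exact: measurable_cst | exact: measurable_funB].
have := int_abs_le_sqrt mm (mulr_ge0 (sqr_ge0 _) A0) I2.
have -> : Num.sqrt (w k ^+ 2 * (4 * g * defect (u k))) = w k * coord_err k.
  by rewrite (@sqrtrM _ (w k ^+ 2)) ?sqr_ge0 // sqrtr_sqr ger0_norm.
have -> : (\int[mu]_x `|(w k * (Y k x - q (tp x) (u k)))%R|%:E =
    \int[mu]_x `|(w k * (q (tp x) (u k) - Y k x))%R|%:E)%E; last by [].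
by apply: eq_integral => x _; rewrite -normrN -mulrN opprB.
Qed.

(** The first [N] coordinate errors are kept, since they vanish as the subspace grows. The others
    are at most [Num.sqrt (4 * g)] uniformly, so the tail of the weights controls them for every
    subspace at once. *)
Lemma ext_tpi_le f C D N : slow f C D ->
  (\int[mu]_x `|f (tp x) - ext f x|%:E <=
   (D * (\sum_(k < N) w k * coord_err k +
      Num.sqrt (4 * g) * (Sw - \sum_(k < N) w k)))%:E)%E.
Proof.
move=> fs; have [fC cf D0 fD] := fs.
pose zz k (x : borel V) := `|w k * (q (tp x) (u k) - Y k x)|.
have mzz k : measurable_fun setT (fun x : borel V => (zz k x)%:E).
  apply/measurable_EFinP; apply: measurableT_comp => //.
  apply: measurable_funM; first exact: measurable_cst.
  by apply: measurable_funB => //; have [] := tpi_l2_value k.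
have zz0 k x : (0 <= (zz k x)%:E)%E by rewrite lee_fin normr_ge0.
pose gg x := (\sum_(k <oo) (zz k x)%:E)%E.
have gg0 x : (0 <= gg x)%E by apply: nneseries_ge0.
have mgg : measurable_fun setT gg by apply: ge0_emeasurable_sum.
have mDgg : measurable_fun setT (fun x => D%:E * gg x)%E.
  by apply: emeasurable_funM => //; exact: measurable_cst.
have mfe : measurable_fun setT (fun x : borel V => `|f (tp x) - ext f x|%:E).
  apply/measurable_EFinP; apply: measurableT_comp => //.
  by apply: measurable_funB; [exact: measurable_tpi | exact: measurable_ext].
apply: (@le_trans _ _ (\int[mu]_x (D%:E * gg x))%E).
  apply: ae_ge0_le_integral => //.
  - by move=> x _; rewrite mule_ge0 // lee_fin.
  - apply: (@filterS (borel V) _ _ _ _ _ ae_good) => x gx _.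
    have [s0 sx] := gx.
    (* At a good point the sum is finite, being dominated by the coordinates of [tp x] and those of
       [x]; only then may it serve as the real number in [ext_dist]. *)
    have ggf : (gg x <= (2 * `|tp x| * Sw + s0)%:E)%E.
      apply: lime_le; first by apply: is_cvg_nneseries.
      apply: nearW => m; rewrite sumEFin lee_fin big_mkord.
      apply: (@le_trans _ _ (\sum_(i < m) (2 * `|tp x| * w i + `|w i * Y i x|))).
        apply: ler_sum => i _; rewrite /zz mulrBr; apply: le_trans (ler_normB _ _) _.
        by rewrite lerD2r normrM (ger0_norm (w_ge0 _)) mulrC ler_wpM2r // q_coord_le.
      rewrite big_split /= -mulr_sumr; apply: lerD; last exact: sx.
      by rewrite ler_wpM2l ?mulr_ge0 // w_partial_le.
    have fin : gg x \is a fin_num by rewrite ge0_fin_numE // (le_lt_trans ggf) ?ltry.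
    rewrite -(fineK fin) -EFinM lee_fin; apply: (ext_dist fs gx) => m.
    rewrite -lee_fin fineK //.
    have -> : \sum_(i < m) w i * `|q (tp x) (u i) - Y i x| = \sum_(0 <= i < m) zz i x.
      by rewrite big_mkord; apply: eq_bigr => i _; rewrite /zz normrM (ger0_norm (w_ge0 _)).
    by rewrite -sumEFin; exact: nneseries_lim_ge.
rewrite ge0_integralZl // integral_nneseries // EFinM; apply: lee_wpmul2l; first by rewrite lee_fin.
apply: lime_le; first by apply: is_cvg_nneseries => k _ _; exact: integral_ge0.
apply: nearW => m; apply: (@le_trans _ _ (\sum_(0 <= k < m) (w k * coord_err k)%:E)%E).
  by apply: lee_sum => k _; exact: tpi_coord.
rewrite sumEFin lee_fin big_mkord.
have ce0 k : 0 <= w k * coord_err k by rewrite mulr_ge0 // sqrtr_ge0.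
pose M := (N + m)%N.
apply: (@le_trans _ _ (\sum_(k < M) w k * coord_err k)).
  rewrite -(big_mkord xpredT (fun k => w k * coord_err k)).
  rewrite -(big_mkord xpredT (fun k => w k * coord_err k)) [leRHS](big_cat_nat (n := m)) ?leq_addl //=.
  by rewrite lerDl sumr_ge0.
have NM : (N <= M)%N by exact: leq_addr.
rewrite -lerBlDl (sum_ord_sub (fun k => w k * coord_err k) NM).
apply: (@le_trans _ _ (Num.sqrt (4 * g) * (\sum_(k < M) w k - \sum_(k < N) w k))); last first.
  by rewrite ler_wpM2l ?sqrtr_ge0 // lerD2r w_partial_le.
rewrite (sum_ord_sub w NM) mulr_sumr; apply: ler_sum => k _; case: ifP => _.
  by rewrite mulr0.
by rewrite mulrC ler_wpM2r // coord_err_le.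
Qed.

End Projection.

Section Approximation.
Variables (EE : nat -> set W) (d : nat -> nat) (ts : forall n, (d n).-tuple W).
Hypothesis ts_basis : forall n, orthonormal_basis q (EE n) (ts n).
Hypothesis EE_mono : forall n, EE n `<=` EE n.+1.
Hypothesis EE_dense : dense (\bigcup_n EE n).

Lemma defect_cvg v : defect (ts n) v @[n --> \oo] --> 0.
Proof.
apply/cvgrPdist_le => e e0.
(* A distance below [r] has [2 * r ^+ 2 <= 2 * r <= e]. *)
pose r := Num.min 1 (e / 2); have r0 : 0 < r by rewrite lt_min ltr01 divr_gt0.
have [x [vx [N _ Nx]]] := EE_dense (ex_intro _ v (ballxx v r0)) (ball_open v r).
have vx' : `|v - x| < r by have : ball v r x := vx; rewrite -ball_normE.
exists N => // n /= Nn.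
have nx : EE n x.
  elim: n Nn => [|n IH]; first by rewrite leqn0 => /eqP <-.
  by rewrite leq_eqVlt => /orP[/eqP <- //|/IH]; exact: EE_mono.
have tx : linspan [set` ts n] x by rewrite -(ts_basis n).2.
rewrite sub0r normrN ger0_norm; last exact: defect_ge0.
apply: le_trans (defect_le (ts_basis n).1 v tx) _; apply: le_trans (q_hi _) _.
rewrite -ler_pdivlMl // mulrC; apply: (@le_trans _ _ r); last by rewrite ge_min lexx orbT.
rewrite expr2; apply: (@le_trans _ _ (`|v - x| * 1)); last by rewrite mulr1 ltW.
by rewrite ler_wpM2l // (le_trans (ltW vx')) // ge_min lexx.
Qed.

Lemma coord_err_cvg k : coord_err (ts n) k @[n --> \oo] --> 0.
Proof.
have c1 : 4 * g * defect (ts n) (u k) @[n --> \oo] --> 4 * g * 0.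
  by apply: cvgM; [exact: cvg_cst | exact: defect_cvg].
rewrite mulr0 in c1; rewrite -[X in _ --> X](@sqrtr0 R).
exact: (cvg_comp _ (@Num.sqrt R) c1 (@sqrt_continuous R 0)).
Qed.

Lemma ext_tpi_cvg f C D (e : R) : slow f C D -> 0 < e ->
  \forall n \near \oo, (\int[mu]_x `|f (tpi q E mu (ts n) x) - ext f x|%:E <= e%:E)%E.
Proof.
move=> fs e0; have [_ _ D0 _] := fs.
pose K := Num.sqrt (4 * g); have K0 : 0 <= K by exact: sqrtr_ge0.
have [N HN] : exists N, D * (K * (Sw - \sum_(k < N) w k)) <= e / 2.
  have c1 : D * (K * (Sw - \sum_(k < N) w k)) @[N --> \oo] --> D * (K * (Sw - Sw)).
    apply: cvgM; first exact: cvg_cst.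
    apply: cvgM; first exact: cvg_cst.
    by apply: cvgB; [exact: cvg_cst | exact: w_cvg].
  rewrite subrr !mulr0 in c1.
  have /cvgrPdist_le /(_ _ (divr_gt0 e0 (ltr0Sn R 1))) [N _ /(_ N (leqnn _))] := c1.
  rewrite /= sub0r normrN => H; exists N; exact: le_trans (ler_norm _) H.
have c2 : \sum_(k < N) w k * coord_err (ts n) k @[n --> \oo] --> 0.
  elim: (N) => [|m IH].
    by under eq_fun do rewrite big_ord0; exact: cvg_cst.
  under eq_fun do rewrite big_ord_recr /=.
  have c0 : \sum_(k < m) w k * coord_err (ts n) k + w m * coord_err (ts n) m @[n --> \oo] -->
      0 + w m * 0.
    by apply: cvgD => //; apply: cvgM; [exact: cvg_cst | exact: coord_err_cvg].
  by rewrite mulr0 addr0 in c0.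
have c3 : D * (\sum_(k < N) w k * coord_err (ts n) k) @[n --> \oo] --> D * 0.
  by apply: cvgM => //; exact: cvg_cst.
rewrite mulr0 in c3.
have /cvgrPdist_le /(_ _ (divr_gt0 e0 (ltr0Sn R 1))) := c3.
apply: filterS => n; rewrite sub0r normrN => Hn.
apply: le_trans (ext_tpi_le (ts_basis n).1 N fs) _; rewrite lee_fin mulrDr -/K.
have := ler_norm (D * (\sum_(k < N) w k * coord_err (ts n) k)); lra.
Qed.

End Approximation.

(** * Existence, uniqueness and translation of the stochastic extension *)

Section ComplexSymbol.
Variables (F : W -> R[i]) (C D : R).
Let fr x := complex.Re (F x).
Let fi x := complex.Im (F x).
Hypothesis fr_slow : slow fr C D.
Hypothesis fi_slow : slow fi C D.

Lemma normc_sub_le (a b : R[i]) : Normc.normc (a - b) <=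
  `|complex.Re a - complex.Re b| + `|complex.Im a - complex.Im b|.
Proof.
case: a b => [a1 a2] [b1 b2] /=.
rewrite -(ger0_norm (_ : 0 <= `|a1 - b1| + `|a2 - b2|)) ?addr_ge0 // -sqrtr_sqr.
rewrite ler_sqrt ?sqr_ge0 // -(real_normK (num_real (a1 - b1))) -(real_normK (num_real (a2 - b2))) sqrrD.
by rewrite addrAC lerDl mulrn_wge0 // mulr_ge0.
Qed.

Lemma measurable_normc (c : borel V -> R[i]) : cmeasurable c ->
  measurable_fun setT (fun x => Normc.normc (c x)).
Proof.
move=> [mr mi].
have -> : (fun x => Normc.normc (c x)) =
   (fun x => Num.sqrt (complex.Re (c x) ^+ 2 + complex.Im (c x) ^+ 2)).
  by apply/funext => x; case: (c x).
have ms : measurable_fun setT (@Num.sqrt R).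
  by apply: continuous_measurable_fun; exact: sqrt_continuous.
apply: (measurableT_comp ms).
by apply: measurable_funD; apply: measurable_funX.
Qed.

Lemma cmeasurableB (a b : borel V -> R[i]) : cmeasurable a -> cmeasurable b ->
  cmeasurable (fun x => a x - b x).
Proof.
move=> [ar ai] [br bi]; split.
  rewrite (_ : (fun x => _) = (fun x => complex.Re (a x) - complex.Re (b x))).
    exact: measurable_funB.
  by apply/funext => x; case: (a x) (b x) => [? ?] [? ?].
rewrite (_ : (fun x => _) = (fun x => complex.Im (a x) - complex.Im (b x))).
  exact: measurable_funB.
by apply/funext => x; case: (a x) (b x) => [? ?] [? ?].
Qed.

Definition cext (x : borel V) : R[i] := ext fr x +i* ext fi x.

Let cr : continuous fr. Proof. by have [] := fr_slow. Qed.
Let ci : continuous fi. Proof. by have [] := fi_slow. Qed.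

Lemma cmeasurable_cext : cmeasurable cext.
Proof. by split; exact: measurable_ext. Qed.

Lemma cmeasurable_tpi n (t : n.-tuple W) : orthonormal_tuple q t ->
  cmeasurable ((F \o tpi q E mu t) : borel V -> R[i]).
Proof.
by move=> ot; split; [exact: (measurable_tpi t cr) | exact: (measurable_tpi t ci)].
Qed.

Lemma cLnorm1 (c : borel V -> R[i]) :
  (cLnorm mu 1 c = \int[mu]_x (Normc.normc (c x))%:E)%E.
Proof.
rewrite /cLnorm Lnorm1; apply: eq_integral => x _.
by rewrite gee0_abs // lee_fin; case: (c x) => a b; exact: sqrtr_ge0.
Qed.

Lemma cLnorm1_bounded (c : borel V -> R[i]) (K : R) : cmeasurable c ->
  (forall x, Normc.normc (c x) <= K) -> (cLnorm mu 1 c < +oo)%E.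
Proof.
move=> mc cK; rewrite cLnorm1; apply: (@le_lt_trans _ _ (\int[mu]_x (cst K%:E x))%E).
  apply: ge0_le_integral => //.
  - by move=> x _; rewrite lee_fin; case: (c x) => a b; exact: sqrtr_ge0.
  - by apply/measurable_EFinP; exact: measurable_normc.
  - by move=> x _; rewrite lee_fin.
by rewrite integral_cst //= probability_setT mule1 ltry.
Qed.

(** The modulus is at most the sum of the two real errors, so exponent 1 reduces the convergence to
    [ext_tpi_cvg] for each part. *)
Lemma stoch_ext_cext : stoch_ext q E mu 1 F cext.
Proof.
have [frC _ _ _] := fr_slow; have [fiC _ _ _] := fi_slow.
split.
- by split; exact: continuous_borel.
- split; first exact: cmeasurable_cext.
  apply: (@cLnorm1_bounded _ (2 * C)); first exact: cmeasurable_cext.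
  by move=> x; apply: normc_le; [exact: (ext_le fr_slow x) | exact: (ext_le fi_slow x)].
- move=> EE d ts tb Em Ed; split=> [n|].
    split; first exact: cmeasurable_tpi (tb n).1.
    apply: (@cLnorm1_bounded _ (2 * C)); first exact: cmeasurable_tpi (tb n).1.
    by move=> x; apply: normc_le; [exact: frC | exact: fiC].
  have mB n := cmeasurableB (cmeasurable_tpi (tb n).1) cmeasurable_cext.
  apply: cvge0_of_le => [n|e e0]; first exact: Lnorm_ge0.
  have e20 : 0 < e / 2 by rewrite divr_gt0.
  have hr := ext_tpi_cvg tb Em Ed fr_slow e20; have hi := ext_tpi_cvg tb Em Ed fi_slow e20.
  have md n (f : W -> R) : continuous f ->
      measurable_fun setT (fun x : borel V => `|f (tpi q E mu (ts n) x) - ext f x|%:E).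
    move=> cf; apply/measurable_EFinP; apply: measurableT_comp => //.
    by apply: measurable_funB; [exact: measurable_tpi | exact: measurable_ext].
  move: hr hi; apply: filterS2 => n hrn hin.
  rewrite cLnorm1; apply: (@le_trans _ _
    (\int[mu]_x (`|fr (tpi q E mu (ts n) x) - ext fr x|%:E +
       `|fi (tpi q E mu (ts n) x) - ext fi x|%:E))%E).
    apply: ge0_le_integral => //.
    - move=> x _; rewrite lee_fin.
      by case: (F (tpi q E mu (ts n) x) - cext x) => a b; exact: sqrtr_ge0.
    - by apply/measurable_EFinP; apply: measurable_normc; exact: mB.
    - by apply: emeasurable_funD; exact: md.
    - by move=> x _; rewrite -EFinD lee_fin; exact: normc_sub_le.
  rewrite ge0_integralD //; [|exact: md|exact: md].
  by rewrite (splitr e) EFinD; exact: (leeD hrn hin).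
Qed.

Lemma cLnorm1_le_cLnorm (c : borel V -> R[i]) (p : R) : cmeasurable c -> 1 <= p ->
  (cLnorm mu 1 c <= cLnorm mu p c)%E.
Proof.
move=> mc p1; have [-> //|pn1] := eqVneq p 1.
have {pn1}p1 : 1 < p by rewrite lt_neqAle eq_sym pn1.
have p0 : 0 < p by apply: lt_trans p1.
pose p' := p / (p - 1).
have pm : 0 < p - 1 by rewrite subr_gt0.
have p'0 : 0 < p' by exact: divr_gt0.
have pp : p^-1 + p'^-1 = 1 by rewrite /p' invf_div; field; rewrite gt_eqF.
have m1 : measurable_fun setT (cst 1 : borel V -> R) by exact: measurable_cst.
have := hoelder mu (measurable_normc mc) m1 p0 p'0 pp.
have -> : (Lnorm mu p'%:E (EFin \o (cst 1%R : borel V -> R)) = 1)%E.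
  apply: (etrans (Lnorm_cst1 mu p')).
  exact: (etrans (congr1 (fun z => poweR z p'^-1) (probability_setT mu)) (poweR1r _)).
rewrite mule1 /cLnorm; apply: le_trans; rewrite le_eqVlt; apply/orP; left; apply/eqP.
by apply: eq_Lnorm => x /=; rewrite mulr1.
Qed.

Definition utuple n : n.-tuple W := [tuple u i | i < n].

Lemma utuple_basis n : orthonormal_basis q (linspan [set` utuple n]) (utuple n).
Proof. by split=> // i j; rewrite !tnth_mktuple u_on. Qed.

Lemma utuple_mono n : linspan [set` utuple n] `<=` linspan [set` utuple n.+1].
Proof.
move=> x [m [c [b [tb ->]]]]; exists m, c, b; split=> // i.
have /mapP [j _ ->] : b i \in utuple n := tb i.
by apply/mapP; exists (widen_ord (leqnSn n) j) => //; rewrite mem_enum.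
Qed.

Lemma utuple_dense : dense (\bigcup_n linspan [set` utuple n]).
Proof.
have sub : linspan (range u) `<=` \bigcup_n linspan [set` utuple n].
  move=> x [m [c [b [ub ->]]]].
  have /choice [k bk] : forall i : 'I_m, exists k : nat, u k = b i.
    by move=> i; have [k _ ?] := ub i; exists k.
  exists (\max_i (k i).+1)%N => //; exists m, c, b; split=> // i.
  have ki : (k i < \max_i (k i).+1)%N.
    exact: (leq_bigmax (F := fun i => (k i).+1) i).
  by apply/mapP; exists (Ordinal ki); rewrite ?mem_enum //= bk.
move=> O O0 oO; have [x [Ox ux]] := u_dense O0 oO; exists x; split=> //; exact: sub.
Qed.

Lemma tpi_utuple : {ae mu, forall x : borel V, forall n, tpi q E mu (utuple n) x = gsum n x}.
Proof.
have ae1 : {ae mu, forall x : borel V, forall i, ell q E mu (u i) x = Y i x}.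
  apply: ae_foralln => i.
  have li := ell_l2_value h0 mu_gauss q_scalar qC q_lo q_hi E_dense u_on u_dense Y_dual (u i).
  have := l2_value_dist h0 mu_gauss q_scalar qC q_lo q_hi E_dense li (Y_dual i).
  rewrite subrr (q0l q_scalar) mulr0 => I0; have [ml _] := li.
  have msq : measurable_fun setT (fun x : borel V => (Y i x - ell q E mu (u i) x) ^+ 2).
    by apply: measurable_funX; exact: measurable_funB.
  have := ae_eq0_of_int msq (fun x => sqr_ge0 _) I0.
  apply: (@filterS (borel V)) => x /eqP.
  by rewrite sqrf_eq0 subr_eq0 => /eqP.
apply: (@filterS (borel V) _ _ _ _ _ ae1) => x ex n.
by rewrite /tpi /gsum; apply: eq_bigr => i _; rewrite tnth_mktuple ex.
Qed.

(** Test the definition on the spans of the first [u i], where the projection is almost surely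
    [gsum]. Along this sequence [F] converges to [ft] in [L^p], hence in [L^1], and to [cext] almost
    surely; Fatou's lemma identifies the limits. *)
Lemma stoch_ext_unique (p : R) (ft : borel V -> R[i]) : 1 <= p -> stoch_ext q E mu p F ft ->
  {ae mu, forall x : borel V, ft x = cext x}.
Proof.
move=> p1 [_ [mft _] /(_ _ _ _ utuple_basis utuple_mono utuple_dense) [_ cF]].
have mt n : cmeasurable ((F \o tpi q E mu (utuple n)) : borel V -> R[i]).
  exact: cmeasurable_tpi (utuple_basis n).1.
have mdn n : measurable_fun setT
    (fun x : borel V => Normc.normc (F (tpi q E mu (utuple n) x) - ft x)).
  exact: (measurable_normc (cmeasurableB (mt n) mft)).
have md : measurable_fun setT (fun x : borel V => Normc.normc (cext x - ft x)).
  exact: (measurable_normc (cmeasurableB cmeasurable_cext mft)).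
have n0 (z : R[i]) : 0 <= Normc.normc z by case: z => a b; exact: sqrtr_ge0.
have cae : {ae mu, forall x : borel V,
    Normc.normc (F (tpi q E mu (utuple n) x) - ft x) @[n --> \oo] --> Normc.normc (cext x - ft x)}.
  apply: (@filterS2 (borel V) _ _ _ _ _ _ ae_good tpi_utuple) => x gx tx.
  have cr' := ext_cvg fr_slow gx; have ci' := ext_cvg fi_slow gx.
  have e z : Normc.normc (z - ft x) = Num.sqrt ((complex.Re z - complex.Re (ft x)) ^+ 2 +
      (complex.Im z - complex.Im (ft x)) ^+ 2) by case: z (ft x) => [? ?] [? ?].
  under eq_fun do rewrite e tx; rewrite e /=.
  have c1 : (fr (gsum n x) - complex.Re (ft x)) @[n --> \oo] --> ext fr x - complex.Re (ft x).
    by apply: cvgB => //; exact: cvg_cst.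
  have c2 : (fi (gsum n x) - complex.Im (ft x)) @[n --> \oo] --> ext fi x - complex.Im (ft x).
    by apply: cvgB => //; exact: cvg_cst.
  have c3 : (fr (gsum n x) - complex.Re (ft x)) ^+ 2 + (fi (gsum n x) - complex.Im (ft x)) ^+ 2
     @[n --> \oo] --> (ext fr x - complex.Re (ft x)) ^+ 2 + (ext fi x - complex.Im (ft x)) ^+ 2.
    by apply: cvgD; rewrite expr2; under eq_fun do rewrite expr2; exact: cvgM.
  exact: (cvg_comp _ (@Num.sqrt R) c3 (@sqrt_continuous R _)).
have I0 : (\int[mu]_x (Normc.normc (cext x - ft x))%:E <= 0)%E.
  apply/lee_addgt0Pr => e e0; rewrite add0e.
  have [N _ HN] := cvge_eventually_le cF e0.
  apply: (@fatou_ae _ _ _ mu (fun n x => Normc.normc (F (tpi q E mu (utuple (n + N)) x) - ft x))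
    _ (fun=> e)) => //; last exact: cvg_cst.
    apply: (@filterS (borel V) _ _ _ _ _ cae) => x cx.
    by have := cx; rewrite -(cvg_shiftn N).
  move=> n; rewrite -cLnorm1; apply: le_trans (HN (n + N)%N (leq_addl _ _)).
  exact: (cLnorm1_le_cLnorm (cmeasurableB (mt _) mft) p1).
have := ae_eq0_of_int md (fun x => n0 _) I0.
apply: (@filterS (borel V)) => x nx.
have : cext x - ft x = 0 by apply/eqP; rewrite -[_ == 0]/(_ == 0); exact/eqP/Normc.eq0_normc.
by move/eqP; rewrite subr_eq0 => /eqP.
Qed.

Lemma the_stoch_ext_cext : cmeasurable (the_stoch_ext q E mu F) /\
  {ae mu, forall x : borel V, the_stoch_ext q E mu F x = cext x}.
Proof.
have [p p1 sp] : [set ft | exists2 p, 1 <= p & stoch_ext q E mu p F ft] (the_stoch_ext q E mu F).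
  by apply: xgetPex; exists cext, 1 => //; exact: stoch_ext_cext.
by have [_ [mft _] _] := sp; split=> //; exact: stoch_ext_unique sp.
Qed.

Hypothesis quasi_inv : forall X (A : set (borel V)), measurable A -> mu A = 0%E ->
  mu [set x | A (x + E X)] = 0%E.

Lemma ae_shift (P : borel V -> Prop) X : {ae mu, forall x : borel V, P x} ->
  {ae mu, forall x : borel V, P (x + E X)}.
Proof.
move=> [A [mA A0 PA]]; exists [set x | A (x + E X)]; split.
- by rewrite -[X in measurable X]setTI; exact: (measurable_addr (E X)).
- exact: quasi_inv.
- by move=> x /= nP; exact: PA.
Qed.

(** At the translated point [gsum n (x + E X)] equals [fproj q u n X + gsum n x]. Since
    [fproj q u n X] tends to [X], the Lipschitz bound allows [X] itself in its place, and
    [navg_gauss] evaluates the resulting integrals. The map [ff] is meant to be the real or the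
    imaginary part. *)
Lemma heat_navg_cvg (f : W -> R) (ff : R[i] -> R) X : BL u w f ->
  measurable_fun setT (fun x : borel V => ff (the_stoch_ext q E mu F x)) ->
  (forall x : borel V, good x -> f (gsum n x) @[n --> \oo] --> ff (cext x)) ->
  navg u id n (Num.sqrt h) f X @[n --> \oo] -->
    \int[mu]_x ff (the_stoch_ext q E mu F (E X + x)).
Proof.
move=> Bf mff fc; have [K [L [fK [fL _]]]] := Bf; have cf := BL_cont Bf.
have [_ ae1] := the_stoch_ext_cext.
have ae2 : {ae mu, forall x : borel V, f (X + gsum n x) @[n --> \oo] -->
    ff (the_stoch_ext q E mu F (E X + x))}.
  apply: (@filterS2 (borel V) _ _ _ _ _ _ (ae_shift X ae_good) (ae_shift X ae1)) => x gx ex.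
  rewrite addrC ex; have c1 := fc _ gx.
  have gs n : gsum n (x + E X) = fproj q u n X + gsum n x.
    rewrite /gsum /fproj -big_split /=; apply: eq_bigr => i _.
    by rewrite (dual_shift qC x X (Y_dual i)) scalerDl addrC.
  have fp := fproj_cvg qC q_scalar q_lo q_hi u_on u_dense (z := X).
  have c2 : f (X + gsum n x) - f (gsum n (x + E X)) @[n --> \oo] --> 0.
    have c3 : `|L| * `|X - fproj q u n X| @[n --> \oo] --> `|L| * 0.
      apply: cvgM; first exact: cvg_cst.
      rewrite -(normr0 W) -(subrr X); apply: cvg_norm; apply: cvgB => //; exact: cvg_cst.
    rewrite mulr0 in c3.
    apply/cvgrPdist_le => e e0; have /cvgrPdist_le /(_ e e0) := c3.
    apply: filterS => n; rewrite !sub0r !normrN => Hn.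
    apply: le_trans (fL _ _) _; rewrite gs opprD addrACA subrr addr0.
    apply: le_trans (le_trans (ler_norm _) Hn).
    by rewrite ler_wpM2r // ler_norm.
  have -> : (fun n => f (X + gsum n x)) =
     (fun n => f (X + gsum n x) - f (gsum n (x + E X)) + f (gsum n (x + E X))).
    by apply/funext => n; rewrite subrK.
  by rewrite -[X in _ --> X]add0r; exact: cvgD.
have mX : measurable_fun setT (fun x : borel V => ff (the_stoch_ext q E mu F (E X + x))).
  have := measurableT_comp mff (measurable_addr (E X)).
  by congr measurable_fun; apply/funext => x /=; rewrite addrC.
have mn n : measurable_fun setT (fun x : borel V => f (X + gsum n x)).
  rewrite /gsum; exact: measurable_lincomb.
have := bounded_cvg_Rintegral mn mX (fun n x => fK _) ae2.
have -> : (fun n => \int[mu]_x f (X + gsum n x)) = (fun n => navg u id n (Num.sqrt h) f X).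
  by apply/funext => n; rewrite -(navg_gauss h0 mu_gauss n X Y_dual u_on Bf).
exact.
Qed.

End ComplexSymbol.

End StochasticExtension.

(** * The heat semigroup on real symbols *)

Section HeatSemigroup.
Variables (R : realType) (W : normedModType R) (K : eqType) (u : K -> W) (w : K -> R).
Variables (q : W -> W -> R) (en : nat -> K) (Sw S : R).
Hypothesis qC : forall x y, q x y = q y x.
Hypothesis q_scalar : forall y, scalar (q^~ y).
Hypothesis q_lo : forall x, `|x| ^+ 2 <= q x x.
Hypothesis q_hi : forall x, q x x <= 2 * `|x| ^+ 2.
Hypothesis u_on : forall i j, q (u (en i)) (u (en j)) = (i == j)%:R.
Hypothesis u_dense : dense (linspan (range (u \o en))).
Hypothesis en_surj : forall k, exists i, en i = k.
Hypothesis w_ge0 : forall k, 0 <= w k.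
Hypothesis w_cvg : \sum_(i < n) w (en i) @[n --> \oo] --> Sw.
Hypothesis nsq_cvg : nsq w en n @[n --> \oo] --> S.
Implicit Types (f g : W -> R) (s : seq K).

Let w_sum n : \sum_(i < n) w (en i) <= Sw.
Proof. exact: (w_partial_le (fun k => w_ge0 (en k)) w_cvg n). Qed.

Let w_series : cvgn (series (w \o en)).
Proof.
apply/cvg_ex; exists Sw; rewrite (_ : series _ = (fun n => \sum_(i < n) w (en i))) //.
by apply/funext => n; rewrite /series /= big_mkord.
Qed.

Let rclass_of m M f : rsymb u w m.+1 M f -> rclass u w m M (M * (2 * Sw + 1)) f.
Proof. exact: (rsymb_rclass qC q_scalar q_lo q_hi u_on u_dense en_surj w_ge0 w_sum). Qed.

Definition heatr (t : R) (f : W -> R) : W -> R := havg u en (Num.sqrt t) f.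

Lemma averaging_heatr t : averaging u w (heatr t).
Proof. exact: averaging_havg. Qed.

Lemma rclass_rsymb m M L f : rclass u w m M L f -> rsymb u w m M f.
Proof.
move=> H s ws; have [d b _] := H s ws; split=> //.
exact: BL_cont (rclass_BL H ws).
Qed.

Lemma rsymb_heatr t m M f : rsymb u w m.+1 M f -> rsymb u w m M (heatr t f).
Proof.
move=> H; apply: (@rclass_rsymb _ _ (M * (2 * Sw + 1))).
exact: (avg_rclass (averaging_heatr t) (rclass_of H)).
Qed.

Lemma rsymb_BL m M f : rsymb u w m.+1 M f -> BL u w f.
Proof. by move=> /rclass_of; exact: rclass_BL0. Qed.

Lemma heatr0 f : heatr 0 f = f.
Proof.
have nav0 n : navg u en n (0 : R) f = f.
  elim: n => [//|n IH] /=; rewrite IH; apply/funext => x.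
  rewrite /gavg /gauss_mean; under eq_Rintegral do rewrite mul0r scale0r addr0.
  exact: Rintegral_prob_cst.
apply/funext => x; rewrite /heatr sqrtr0; apply: cvg_lim => //.
by under eq_fun do rewrite nav0; exact: cvg_cst.
Qed.

Lemma nlap_cvg M f x : rsymb u w 2 M f -> nlap u en n f x @[n --> \oo] --> lapl u en f x.
Proof. by move=> H; have [_ c _] := dword_lapl nsq_cvg (p := 0) H (@wle_nil _ 0); exact: c. Qed.

Lemma lapl_lin a M M' f g : rsymb u w 2 M f -> rsymb u w 2 M' g ->
  lapl u en (fun x => a * f x + g x) = fun x => a * lapl u en f x + lapl u en g x.
Proof.
move=> Hf Hg; apply/funext => x.
have c1 : a * nlap u en n f x + nlap u en n g x @[n --> \oo] -->
    a * lapl u en f x + lapl u en g x.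
  apply: cvgD; last exact: nlap_cvg Hg.
  by apply: cvgM; [exact: cvg_cst | exact: nlap_cvg Hf].
have e n : nlap u en n (fun x => a * f x + g x) x = a * nlap u en n f x + nlap u en n g x.
  rewrite /nlap mulr_sumr -big_split /=; apply: eq_bigr => i _.
  have [df _ _] := Hf _ (@wle_pair _ (en i)); have [dg _ _] := Hg _ (@wle_pair _ (en i)).
  by have [_ E] := dwordD a df dg; rewrite -[LHS]/(dword u [:: en i; en i] _ x) E.
by apply: cvg_lim => //; under eq_fun do rewrite e; exact: c1.
Qed.

Lemma avg_sum (T : (W -> R) -> W -> R) n (F : nat -> W -> R) : averaging u w T ->
  (forall i, BL u w (F i)) ->
  T (fun x => \sum_(i < n) F i x) = (fun x => \sum_(i < n) T (F i) x).
Proof.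
move=> aT BF.
have B0 : BL u w (fun=> 0).
  by have := BL_lin 0 0 (BF 0%N) (BF 0%N); congr BL; apply/funext => y; ring.
have T0 : T (fun=> 0) = fun=> 0.
  apply/funext => x; apply/eqP; rewrite -normr_le0.
  by apply: (avg_bound aT B0) => y; rewrite normr0.
suff [_ ->] : BL u w (fun x => \sum_(i < n) F i x) /\
  T (fun x => \sum_(i < n) F i x) = (fun x => \sum_(i < n) T (F i) x) by [].
elim: n => [|n [IB IH]].
  have -> : (fun x => \sum_(i < 0) F i x) = fun=> 0 by apply/funext => x; rewrite big_ord0.
  by split=> //; rewrite T0; apply/funext => x; rewrite big_ord0.
have -> : (fun x => \sum_(i < n.+1) F i x) = (fun x => 1 * F n x + \sum_(i < n) F i x).
  by apply/funext => x; rewrite big_ord_recr /= mul1r addrC.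
split.
  by have := BL_lin 1 1 (BF n) IB; congr BL; apply/funext => x; rewrite (mul1r (\sum_(i < n) F i x)).
rewrite (avg_lin aT) // IH; apply/funext => x.
by rewrite big_ord_recr /= mul1r addrC.
Qed.

(** The average commutes with each partial Laplacian; these converge uniformly, and the average is a
    contraction. *)
Lemma lapl_heatr t M f : rsymb u w 3 M f -> lapl u en (heatr t f) = heatr t (lapl u en f).
Proof.
move=> H; have aT := averaging_heatr t; have H2 := rclass_of H.
have Bl : BL u w (lapl u en f) by apply: (@rsymb_BL 0 (M * S)); exact: (rsymb_lapl w_ge0 nsq_cvg (p := 1)).
have Hd i : BL u w (dword u [:: en i; en i] f) by exact: (rclass_BL H2 (@wle_pair _ (en i))).
have Bn n : BL u w (nlap u en n f) by apply: rclass_BL0; exact: (rclass_nlap (m := 0) en n H2).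
have e n : nlap u en n (heatr t f) = heatr t (nlap u en n f).
  rewrite /nlap (avg_sum n aT Hd); apply/funext => x; apply: eq_bigr => i _.
  by have [_ ->] := avg_dword aT H2 (@wle_pair _ (en i)).
apply/funext => x; apply: cvg_lim => //.
under eq_fun do rewrite e.
have H1 := leq_rsymb (isT : (2 <= 3)%N) H.
have [_ _ tl] := dword_lapl nsq_cvg (p := 0) H1 (@wle_nil _ 0).
apply/cvgrPdist_le => d d0.
have /cvgrPdist_le /(_ d d0) := nsq_tail_cvg0 nsq_cvg (M * wprod w [::]).
apply: filterS => n; rewrite sub0r normrN => Hn.
rewrite distrC; apply: le_trans (avg_dist aT (Bn n) Bl (tl n) x) _.
exact: le_trans (ler_norm _) Hn.
Qed.

Lemma dword_heatr t m M f s : rsymb u w m.+1 M f -> wle m s ->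
  derw u s (heatr t f) /\ dword u s (heatr t f) = heatr t (dword u s f).
Proof. by move=> /rclass_of H; exact: (avg_dword (averaging_heatr t) H). Qed.

Lemma nlap_dword m M f s n y : rsymb u w (m + 5) M f -> wle m s ->
  `|nlap u en n (dword u s f) y - dword u s (lapl u en f) y| <=
  M * wprod w s * (S - nsq w en n).
Proof.
move=> H ws.
have H2 : rsymb u w (m + 2) M f by apply: leq_rsymb H; rewrite leq_add2l.
have [_ _ tl] := dword_lapl nsq_cvg H2 ws.
have H3 : rclass u w (m + 2) M (M * (2 * Sw + 1)) f.
  by apply: rclass_of; apply: leq_rsymb H; rewrite -addnS leq_add2l.
have -> : nlap u en n (dword u s f) y = dword u s (nlap u en n f) y; last exact: tl.
rewrite (dword_nlap en n H2 ws).2; apply: eq_bigr => i _.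
by rewrite (dword_pair_comm (en i) H3 ws) dword_cat.
Qed.

(** Apply [havg_taylor] to [dword u s f], the uniform limit of its partial Laplacians being
    [dword u s (lapl u en f)]. Beyond the letters of [s], four derivatives in one direction feed the
    Taylor estimate and one more the Lipschitz bounds. *)
Lemma heatr_taylor m M f s a b x : 0 <= a -> 0 <= b -> rsymb u w (m + 6) M f -> wle m s ->
  `|dword u s (heatr b f) x - dword u s (heatr a f) x -
    (b - a) / 2 * dword u s (heatr a (lapl u en f)) x| <=
  `|b - a| ^+ 2 * (M * wprod w s * S ^+ 2).
Proof.
move=> a0 b0 H ws.
have Hm : rsymb u w m.+1 M f by apply: leq_rsymb H; rewrite -addn1 leq_add2l.
have Hl : rsymb u w m.+1 (M * S) (lapl u en f).
  apply: (rsymb_lapl w_ge0 nsq_cvg); apply: leq_rsymb H.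
  by rewrite -addn1 -addnA leq_add2l.
have [_ ->] := dword_heatr b Hm ws; have [_ ->] := dword_heatr a Hm ws.
have [_ ->] := dword_heatr a Hl ws.
have Hr : rclass u w (4 + m) M (M * (2 * Sw + 1)) f.
  by apply: rclass_of; apply: leq_rsymb H; rewrite addnC -addnS leq_add2l.
have H4 := rclass_dword Hr ws.
have Bg : BL u w (dword u s (lapl u en f)) by exact: (rclass_BL (rclass_of Hl) ws).
have H5 : rsymb u w (m + 5) M f by apply: leq_rsymb H; rewrite leq_add2l.
have := @havg_taylor _ _ _ u w w_ge0 en w_series _ _ _ _ _ (Num.sqrt a) (Num.sqrt b) S x
  (sqrtr_ge0 a) (sqrtr_ge0 b) (nsq_le nsq_cvg) H4 Bg
  (fun n y => nlap_dword n y H5 ws) (nsq_tail_cvg0 nsq_cvg _).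
by rewrite !sqr_sqrtr.
Qed.

Lemma heatr_lipschitz m M f s a b x : 0 <= a -> 0 <= b -> rsymb u w (m + 3) M f -> wle m s ->
  `|dword u s (heatr b f) x - dword u s (heatr a f) x| <= `|b - a| * (M * wprod w s * S).
Proof.
move=> a0 b0 H ws.
have Hm : rsymb u w m.+1 M f by apply: leq_rsymb H; rewrite -addn1 leq_add2l.
have [_ ->] := dword_heatr b Hm ws; have [_ ->] := dword_heatr a Hm ws.
have Hr : rclass u w (2 + m) M (M * (2 * Sw + 1)) f.
  by apply: rclass_of; apply: leq_rsymb H; rewrite addnC -addnS leq_add2l.
have H2 := rclass_dword Hr ws.
have := @havg_lipschitz _ _ _ u w w_ge0 en w_series _ _ _ (Num.sqrt a) (Num.sqrt b) S x
  (sqrtr_ge0 a) (sqrtr_ge0 b) (nsq_le nsq_cvg) H2.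
by rewrite !sqr_sqrtr.
Qed.

(** Linear combinations give membership with a crude constant; the pointwise estimates then supply
    the small one. *)
Lemma rsymb_tighten m M M' f : rsymb u w m M f ->
  (forall s x, wle m s -> `|dword u s f x| <= M' * wprod w s) -> rsymb u w m M' f.
Proof.
by move=> H b s ws; have [d c _] := H s ws; split=> // x; exact: b.
Qed.

Lemma rsymb_comb m M M' (a : R) f g : rsymb u w m M f -> rsymb u w m M' g ->
  rsymb u w m (`|a| * M + M') (fun x => a * f x + g x) /\
  (forall s x, wle m s -> dword u s (fun x => a * f x + g x) x =
     a * dword u s f x + dword u s g x).
Proof.
move=> Hf Hg.
have E s : wle m s -> derw u s (fun x => a * f x + g x) /\
    dword u s (fun x => a * f x + g x) = fun x => a * dword u s f x + dword u s g x.
  move=> ws; have [df _ _] := Hf s ws; have [dg _ _] := Hg s ws.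
  exact: dwordD.
split=> [s ws|s x ws]; last by rewrite (E s ws).2.
have [df cf bf] := Hf s ws; have [dg cg bg] := Hg s ws.
rewrite (E s ws).2; split; first exact: (E s ws).1.
  move=> x; apply: cvgD; last exact: cg.
  by apply: cvgM; [exact: cvg_cst | exact: cf].
move=> x; apply: (le_trans (ler_normD _ _)); rewrite normrM mulrDl -mulrA.
by apply: lerD; [rewrite ler_wpM2l | ].
Qed.

Lemma rsymb_heatr_quotient m M f a b : 0 <= a -> 0 <= b -> b != a -> rsymb u w (m + 6) M f ->
  rsymb u w m (`|b - a| * (M * S ^+ 2))
    (fun x => (b - a)^-1 * (heatr b f x - heatr a f x) - 2^-1 * heatr a (lapl u en f) x).
Proof.
move=> a0 b0 ba H.
have Hm : rsymb u w m.+1 M f by apply: leq_rsymb H; rewrite -addn1 leq_add2l.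
have Hl : rsymb u w m.+1 (M * S) (lapl u en f).
  apply: (rsymb_lapl w_ge0 nsq_cvg); apply: leq_rsymb H.
  by rewrite -addn1 -addnA leq_add2l.
have [H1 E1] := rsymb_comb (-1) (rsymb_heatr a Hm) (rsymb_heatr b Hm).
have H0 : rsymb u w m 0 (fun=> 0).
  have [H0 E0] := rsymb_comb (-1) (rsymb_heatr a Hm) (rsymb_heatr a Hm).
  have -> : (fun=> 0) = (fun x => -1 * heatr a f x + heatr a f x).
    by apply/funext => x; rewrite mulN1r addNr.
  apply: (rsymb_tighten H0) => s x ws; rewrite (E0 _ _ ws).
  by rewrite mulN1r addNr normr0 mul0r.
have [H2' E2'] := rsymb_comb (- 2^-1) (rsymb_heatr a Hl) H0.
have [H2 E2] := rsymb_comb ((b - a)^-1) H1 H2'.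
have z0 s x : wle m s -> dword u s (fun=> 0) x = 0.
  move=> ws; have [_ _ /(_ x)] := H0 s ws.
  by rewrite mul0r normr_le0 => /eqP.
have -> : (fun x => (b - a)^-1 * (heatr b f x - heatr a f x) - 2^-1 * heatr a (lapl u en f) x) =
  (fun x => (b - a)^-1 * (-1 * heatr a f x + heatr b f x) +
      (- 2^-1 * heatr a (lapl u en f) x + 0)).
  by apply/funext => x; ring.
apply: (rsymb_tighten H2) => s x ws.
rewrite (E2 _ _ ws) (E1 _ _ ws) (E2' _ _ ws) (z0 _ _ ws).
have T := heatr_taylor x a0 b0 H ws.
have ban : b - a != 0 by rewrite subr_eq0.
have p0 : 0 < `|b - a| by rewrite normr_gt0.
rewrite -(ler_pM2l p0) -normrM.
have -> : (b - a) * ((b - a)^-1 * (-1 * dword u s (heatr a f) x + dword u s (heatr b f) x) +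
     (- 2^-1 * dword u s (heatr a (lapl u en f)) x + 0)) =
   dword u s (heatr b f) x - dword u s (heatr a f) x -
    (b - a) / 2 * dword u s (heatr a (lapl u en f)) x by field.
apply: le_trans T _; rewrite le_eqVlt; apply/orP; left; apply/eqP; ring.
Qed.

Lemma rsymb_heatr_dist m M f a b : 0 <= a -> 0 <= b -> rsymb u w (m + 3) M f ->
  rsymb u w m (`|b - a| * (M * S)) (fun x => heatr b f x - heatr a f x).
Proof.
move=> a0 b0 H.
have Hm : rsymb u w m.+1 M f by apply: leq_rsymb H; rewrite -addn1 leq_add2l.
have [H1 E1] := rsymb_comb (-1) (rsymb_heatr a Hm) (rsymb_heatr b Hm).
have -> : (fun x => heatr b f x - heatr a f x) = (fun x => -1 * heatr a f x + heatr b f x).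
  by apply/funext => x; rewrite mulN1r addrC.
apply: (rsymb_tighten H1) => s x ws; rewrite (E1 _ _ ws) mulN1r addrC.
apply: le_trans (heatr_lipschitz x a0 b0 H ws) _.
by rewrite le_eqVlt; apply/orP; left; apply/eqP; ring.
Qed.

Lemma heatr_lin t a m M M' f g : rsymb u w m.+1 M f -> rsymb u w m.+1 M' g ->
  heatr t (fun x => a * f x + g x) = fun x => a * heatr t f x + heatr t g x.
Proof.
move=> Hf Hg; apply: (avg_lin (averaging_heatr t)); [exact: rsymb_BL Hf | exact: rsymb_BL Hg].
Qed.

Lemma rsymb_slow M f : rsymb u w 1 M f -> slow q (u \o en) (w \o en) f M M.
Proof.
move=> H; have M0 := rsymb_M_ge0 H.
have [_ cf fM] := H _ (@wle_nil _ 1).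
split=> //; first by move=> x; have := fM x; rewrite /wprod big_nil mulr1.
move=> y z s zs.
have d1 k x : derivable f x (u k) by have [[_ d] _ _] := H _ (@wle_one _ k); exact: d.
have d2 k x : `|'D_(u k) f x| <= M * w k.
  by have [_ _ /(_ x)] := H _ (@wle_one _ k); rewrite /wprod big_seq1.
exact: (basis_increment qC q_scalar q_lo q_hi u_on u_dense y M0 cf d1 d2 zs).
Qed.

Lemma BL_enum f : BL u w f -> BL (u \o en) (w \o en) f.
Proof.
by move=> [C [L [fC [f1 f2]]]]; exists C, L; split=> //; split=> // k x t; exact: f2.
Qed.

Lemma navg_enum n b f : navg (u \o en) id n b f = navg u en n b f.
Proof. by elim: n => //= n ->. Qed.

End HeatSemigroup.

(** * The space H * H *)

Section Density.
Variables (R : realType) (V : normedModType R).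
Implicit Types A : set V.

Lemma denseP A : dense A <-> forall x (r : R), 0 < r -> exists2 z, A z & `|x - z| < r.
Proof.
split=> [dA x r r0|dA O [x Ox] oO].
  have [z [xz Az]] := dA _ (ex_intro _ x (ballxx x r0)) (ball_open x r).
  by exists z => //; have : ball x r z := xz; rewrite -ball_normE.
have [r /= r0 xr] : nbhs_ball x O by apply/nbhs_ballP; exact: open_nbhs_nbhs.
have [z Az xz] := dA x r r0; exists z; split=> //; apply: xr.
by rewrite -ball_normE.
Qed.

Lemma linspan_single A c v : A v -> linspan A (c *: v).
Proof. by move=> Av; exists 1%N, (fun=> c), (fun=> v); rewrite big_ord1. Qed.

Lemma linspan0 A : linspan A 0.
Proof. by exists 0%N, (fun=> 0), (fun=> 0); rewrite big_ord0; split=> // -[]. Qed.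

Lemma linspanD A x y : linspan A x -> linspan A y -> linspan A (x + y).
Proof.
move=> [m [c [v [Av ->]]]] [n [d [w [Aw ->]]]].
exists (m + n)%N, (fun i => match fintype.split i with inl j => c j | inr j => d j end),
  (fun i => match fintype.split i with inl j => v j | inr j => w j end); split.
  by move=> i; case: fintype.split.
rewrite big_split_ord /=; congr (_ + _); apply: eq_bigr => i _.
  by rewrite (_ : fintype.split _ = inl i) //; exact: (unsplitK (inl i)).
by rewrite (_ : fintype.split _ = inr i) //; exact: (unsplitK (inr i)).
Qed.

Lemma linspan_sum A n (x : 'I_n -> V) : (forall i, linspan A (x i)) -> linspan A (\sum_i x i).
Proof.
move=> Ax; elim/big_ind : _ => //; [exact: linspan0 | exact: linspanD].
Qed.

Lemma separable_sequence : separable V -> exists D : nat -> V, dense (range D).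
Proof.
move=> [D /countable_injP [f finj] dD].
(* Indices outside the image of [f] give the default 0, which only adds a point to the range. *)
exists (fun k => xget 0 [set x | D x /\ f x = k]) => O O0 oO.
have [x [Ox Dx]] := dD O O0 oO; exists x; split=> //; exists (f x) => //.
case: xgetP => [y _ [Dy fy]|/(_ x)/=]; last by case.
by apply: finj; rewrite ?inE.
Qed.

End Density.

Lemma linspan_linear (R : realType) (V W : normedModType R) (f : V -> W) (A : set V) x :
  (forall a u v, f (a *: u + v) = a *: f u + f v) -> linspan A x -> linspan (f @` A) (f x).
Proof.
move=> fl; have f0 : f 0 = 0.
  by have := fl (-1) 0 0; rewrite scaler0 addr0 scaleN1r addNr.
move=> [n [c [v [Av ->]]]].
have -> : f (\sum_i c i *: v i) = \sum_i c i *: f (v i).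
  rewrite (big_morph f (id1 := 0) (op1 := +%R)) //; last first.
    by move=> x1 x2; rewrite -[x1]scale1r fl !scale1r.
  by apply: eq_bigr => i _; rewrite -[c i *: v i]addr0 fl f0 addr0.
by apply: linspan_sum => i; apply: linspan_single; exists (v i).
Qed.

Lemma enum_nat (J : countType) : infinite_set [set: J] -> exists enJ : nat -> J, bijective enJ.
Proof.
move=> Jinf.
have Jnat : ([set: J] #= [set: nat])%card.
  by apply/card_eqPle; split; [exact: countableP | exact/infiniteP].
have [f] := (card_set_bijP Jnat); rewrite setTT_bijective => -[g fg gf].
by exists g; exists f.
Qed.

Section HilbertBasis.
Variables (R : realType) (H : normedModType R) (ip : H -> H -> R).
Hypothesis H_ip : inner_product ip.

Let ipC x y : ip x y = ip y x. Proof. by case: H_ip. Qed.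
Let ip_scalar y : scalar (ip^~ y). Proof. by case: H_ip. Qed.
Let ip_norm x : ip x x = `|x| ^+ 2. Proof. by case: H_ip. Qed.
Let ip_lo x : `|x| ^+ 2 <= ip x x. Proof. by rewrite ip_norm. Qed.

(** If [v] had positive defect, density would give a point of the span at squared distance below it,
    against the minimality [defect_le]. Radii below 1 ensure that the square does not exceed the
    distance. *)
Lemma linspan_closed n (t : n.-tuple H) A : orthonormal_tuple ip t ->
  A `<=` linspan [set` t] -> dense A -> linspan [set` t] = setT.
Proof.
move=> t_on At /denseP dA; rewrite -subTset => v _.
have [d0|d0] := eqVneq (defect ip t v) 0.
  rewrite (_ : v = oproj ip t v); first exact: oproj_span.
  by move: d0; rewrite /defect ip_norm => /eqP; rewrite sqrf_eq0 normr_eq0 subr_eq0 => /eqP.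
have dp : 0 < defect ip t v by rewrite lt_neqAle eq_sym d0 /= q_ge0.
have [|x Ax vx] := dA v (Num.min 1 (defect ip t v)).
  by rewrite lt_min ltr01.
have := defect_le ip_scalar ipC ip_lo t_on v (At _ Ax).
rewrite ip_norm leNgt => /negP[].
move: vx; rewrite lt_min => /andP[v1 v2].
apply: le_lt_trans v2; rewrite expr2.
by rewrite ler_piMl // ltW.
Qed.

(** Infinite dimension enters here: a finite index set would make the span of the basis both finite
    dimensional and dense, hence all of [H]. *)
Lemma hilbert_basis_enum (J : countType) (e : J -> H) : infinite_dim H -> hilbert_basis ip e ->
  exists enJ : nat -> J, bijective enJ.
Proof.
move=> Hinf [e_on e_dense]; apply: enum_nat => /finite_seqP [s sT].
pose t := [tuple e (tnth (in_tuple (undup s)) i) | i < size (undup s)].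
have t_on : orthonormal_tuple ip t.
  move=> i j; rewrite !tnth_mktuple e_on; congr (_%:R); congr nat_of_bool.
  by apply/eqP/eqP => [|->//]; apply/tuple_uniqP; exact: undup_uniq.
move/eqP: (Hinf t); apply; apply: (linspan_closed t_on _ e_dense).
move=> x [n [c [v [ev ->]]]]; apply: linspan_sum => i; apply: linspan_single => /=.
have [j _ <-] := ev i.
have js : j \in in_tuple (undup s).
  rewrite /= mem_undup; have : [set` s] j by rewrite -sT.
  by [].
have /tnthP [k ->] := js; apply/tnthP; exists k; by rewrite tnth_mktuple.
Qed.

End HilbertBasis.

Section SquareForm.
Variables (R : realType) (H B : normedModType R) (ip : H -> H -> R) (emb : H -> B).
Hypothesis H_ip : inner_product ip.

Lemma ip2C x y : ip2 ip x y = ip2 ip y x.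
Proof. by have [C _ _] := H_ip; rewrite /ip2 (C x.1) (C x.2). Qed.

Lemma ip2_scalar y : scalar ((ip2 ip)^~ y).
Proof.
have [_ L _] := H_ip; move=> a u v; rewrite /ip2 /=.
have -> : ip (a *: u.1 + v.1) y.1 = a * ip u.1 y.1 + ip v.1 y.1 := L y.1 a u.1 v.1.
have -> : ip (a *: u.2 + v.2) y.2 = a * ip u.2 y.2 + ip v.2 y.2 := L y.2 a u.2 v.2.
ring.
Qed.

Lemma ip2_lo x : `|x| ^+ 2 <= ip2 ip x x.
Proof.
have [_ _ N] := H_ip; rewrite /ip2 !N prod_normE.
by case: (leP `|x.1| `|x.2|) => _; rewrite ?lerDl ?lerDr sqr_ge0.
Qed.

Lemma ip2_hi x : ip2 ip x x <= 2 * `|x| ^+ 2.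
Proof.
have [_ _ N] := H_ip; rewrite /ip2 !N mulr_natl mulr2n.
by apply: lerD; rewrite ler_sqr ?nnegrE ?normr_ge0 // prod_normE le_max lexx ?orbT.
Qed.

Variables (J : countType) (e : J -> H).
Hypothesis e_on : forall i j, ip (e i) (e j) = (i == j)%:R.
Hypothesis e_dense : dense (linspan (range e)).

Lemma dir_on k l : ip2 ip (dir e k) (dir e l) = (k == l)%:R.
Proof.
have s0 y : ip 0 y = 0 by have [_ L _] := H_ip; exact: scalar_zero (L y).
have s0r y : ip y 0 = 0 by have [C _ _] := H_ip; rewrite C.
by case: k l => i [] j; rewrite /ip2 /= ?s0 ?s0r ?addr0 ?add0r // e_on.
Qed.

Lemma dir_dense : dense (linspan (range (dir e))).
Proof.
have /denseP eD := e_dense; apply/denseP => -[x y] r r0.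
have [x' lx dx] := eD x r r0; have [y' ly dy] := eD y r r0.
exists (x', y'); last by rewrite prod_normE /= gt_max dx dy.
have -> : (x', y') = (x', 0) + (0, y') :> H * H by congr pair; rewrite /= ?addr0 ?add0r.
have sub (A A' : set (H * H)) z : A `<=` A' -> linspan A z -> linspan A' z.
  by move=> AA [n [c [v [Av ->]]]]; exists n, c, v; split=> // i; apply: AA.
apply: linspanD.
  have := @linspan_linear _ _ _ (fun x => (x, 0) : H * H) _ _ _ lx.
  move=> h; apply: (sub _ _ _ _ (h _)) => [z [_ [j _ <-] <-]|a u v].
    by exists (inl j).
  by congr pair; rewrite /= scaler0 addr0.
have := @linspan_linear _ _ _ (fun x => (0, x) : H * H) _ _ _ ly.
move=> h; apply: (sub _ _ _ _ (h _)) => [z [_ [j _ <-] <-]|a u v].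
  by exists (inr j).
by congr pair; rewrite /= scaler0 addr0.
Qed.

Lemma dir_dual : (forall j, in_dual ip emb (e j)) ->
  forall k, exists Y, dual_elt (ip2 ip) (emb2 emb) Y (dir e k).
Proof.
have s0 y : ip 0 y = 0 by have [_ L _] := H_ip; exact: scalar_zero (L y).
move=> ed [] j; have [y [ys yc yE]] := ed j.
  exists (fun z => y z.1); split=> [a u v|z|x]; first exact: ys.
    by apply: (@continuous_comp _ _ _ fst y); [exact: cvg_fst | exact: yc].
  by rewrite yE /ip2 /= s0 addr0.
exists (fun z => y z.2); split=> [a u v|z|x]; first exact: ys.
  by apply: (@continuous_comp _ _ _ snd y); [exact: cvg_snd | exact: yc].
by rewrite yE /ip2 /= s0 add0r.
Qed.

Lemma emb2_dense : dense (range emb) -> dense (range (emb2 emb)).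
Proof.
move=> /denseP eD; apply/denseP => -[x y] r r0.
have [_ [x' _ <-] dx] := eD x r r0; have [_ [y' _ <-] dy] := eD y r r0.
exists (emb x', emb y'); first by exists (x', y').
by rewrite prod_normE /= gt_max dx dy.
Qed.

End SquareForm.

Section Completeness.
Variable R : realType.

Lemma complete_seq (H : completeNormedModType R) (b : nat -> H) :
  (forall e : R, 0 < e -> exists N : nat, forall m n : nat, (N <= n)%N -> (n <= m)%N ->
     `|b m - b n| <= e) -> cvgn b.
Proof.
move=> bc; apply/cauchy_cvgP; apply: cauchy_exP => r r0.
have [N bN] := bc (r / 2) (divr_gt0 r0 (ltr0n _ 2)); exists (b N).
exists N => // m /= Nm; rewrite -ball_normE /= distrC.
by apply: le_lt_trans (bN _ _ (leqnn N) Nm) _; rewrite gtr_pMr // invf_lt1 // ltr1n.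
Qed.

Lemma complete_seq_pair (H : completeNormedModType R) (W := (H * H)%type : normedModType R) (b : nat -> W) :
  (forall e : R, 0 < e -> exists N : nat, forall m n : nat, (N <= n)%N -> (n <= m)%N ->
     `|b m - b n| <= e) -> cvgn b.
Proof.
move=> bc.
have /cvg_ex [l1 c1] : cvgn (fun n => (b n).1).
  apply: complete_seq => r /bc [N bN]; exists N => m n Nn nm.
  by apply: le_trans (bN m n Nn nm); rewrite prod_normE le_max lexx.
have /cvg_ex [l2 c2] : cvgn (fun n => (b n).2).
  apply: complete_seq => r /bc [N bN]; exists N => m n Nn nm.
  by apply: le_trans (bN m n Nn nm); rewrite prod_normE le_max lexx orbT.
apply/cvg_ex; exists (l1, l2).
apply/cvgrPdist_lt => d d0; move/cvgrPdist_lt/(_ _ d0) : c1; move/cvgrPdist_lt/(_ _ d0) : c2.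
by apply: filterS2 => n d2 d1; rewrite prod_normE gt_max d1 d2.
Qed.

End Completeness.

(** * Summability of the weights over all directions *)

Section SymbolSums.
Variables (R : realType) (J : countType) (eps : J -> R) (enJ : nat -> J).
Hypothesis eps_ge0 : forall j, 0 <= eps j.
Hypothesis eps_summable : summable setT (EFin \o eps).
Hypothesis enJ_bij : bijective enJ.

Lemma enK_surj k : exists i, enK enJ i = k.
Proof.
have [g _ gK] := enJ_bij; case: k => j.
  by exists (g j).*2; rewrite /enK odd_double doubleK gK.
by exists (g j).*2.+1; rewrite /enK /= odd_double /= uphalf_double gK.
Qed.

Lemma enK_inj : injective (enK enJ).
Proof.
have ei := bij_inj enJ_bij.
move=> i j ij; have [ij1 ij2] : odd i = odd j /\ i./2 = j./2; last first.
  by rewrite -(odd_double_half i) -(odd_double_half j) ij1 ij2.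
by move: ij; rewrite /enK; case: (odd i); case: (odd j) => // -[/ei ->] //.
Qed.

Lemma weights_cvg : exists Sw : R, \sum_(i < n) wt eps (enK enJ i) @[n --> \oo] --> Sw.
Proof.
have s1 : summable (fun x : nat => xpredT x) (fun i => (eps (enJ i))%:E).
  rewrite (_ : (fun x : nat => is_true (xpredT x)) = setT); last by apply/seteqP.
  move: eps_summable; rewrite /summable.
  by rewrite (@reindex_esum _ _ _ setT setT enJ) // setTT_bijective.
have /cvg_ex [S0 c0] := @summable_cvg R xpredT (fun i => (eps (enJ i))%:E) (fun i _ => eps_ge0 _) s1.
have b0 n : \sum_(i < n) eps (enJ i) <= S0.
  have c1 : \sum_(i < n) eps (enJ i) @[n --> \oo] --> S0.
    have -> : (fun n => \sum_(i < n) eps (enJ i)) =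
        (fun n => \sum_(0 <= k < n) fine (eps (enJ k))%:E) by apply/funext => m; rewrite big_mkord.
    exact: c0.
  exact: (w_partial_le (fun k => eps_ge0 (enJ k)) c1 n).
have nd : nondecreasing_seq (fun n => \sum_(i < n) wt eps (enK enJ i)).
  by apply/nondecreasing_seqP => n; rewrite big_ord_recr /= lerDl; exact: wt_ge0.
have /cvg_ex [Sw cw] : cvgn (fun n => \sum_(i < n) wt eps (enK enJ i)).
  apply: nondecreasing_is_cvgn => //; exists (S0 + S0) => _ [n _ <-].
  apply: (@le_trans _ _ (\sum_(i < n.*2) wt eps (enK enJ i))).
    by apply: nd; rewrite -addnn leq_addr.
  by have := sum_enK enJ (wt eps) n; rewrite big_split /= => ->; apply: lerD; exact: b0.
by exists Sw.
Qed.

(** Each weight is at most [Sw], so the squares are dominated by [Sw] times the weights. *)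
Lemma squares_cvg : exists S : R, nsq (wt eps) (enK enJ) n @[n --> \oo] --> S.
Proof.
have [Sw cw] := weights_cvg.
have w0 i : 0 <= wt eps (enK enJ i) by exact: wt_ge0.
have b n := w_partial_le w0 cw n.
apply/cvg_ex; apply: nondecreasing_is_cvgn.
  by apply/nondecreasing_seqP => n; rewrite /nsq big_ord_recr /= lerDl sqr_ge0.
exists (Sw * Sw) => _ [n _ <-].
have Sw0 : 0 <= Sw by have := b 0%N; rewrite big_ord0.
apply: (@le_trans _ _ (\sum_(i < n) Sw * wt eps (enK enJ i))); last first.
  by rewrite -mulr_sumr ler_wpM2l.
apply: ler_sum => i _; rewrite expr2 ler_wpM2r //.
have := b i.+1; rewrite big_ord_recr /=; apply: le_trans.
by rewrite lerDr sumr_ge0.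
Qed.

End SymbolSums.

(** * Boundedness of the embedding for a measurable norm *)

Section GrossNorm.
Variables (R : realType) (H B : normedModType R) (ip : H -> H -> R) (emb : {linear H -> B}).
Hypothesis H_ip : inner_product ip.
Hypothesis emb_measurable : measurable_norm ip emb.

Let ipC x y : ip x y = ip y x. Proof. by case: H_ip. Qed.
Let ip_scalar y : scalar (ip^~ y). Proof. by case: H_ip. Qed.
Let ip_norm x : ip x x = `|x| ^+ 2. Proof. by case: H_ip. Qed.
Let ip_lo x : `|x| ^+ 2 <= ip x x. Proof. by rewrite ip_norm. Qed.

(** The density never exceeds its peak, which is at most 1/2 because [pi >= 2], and the interval has
    length at most 1. *)
Lemma normal_prob_slab_le (r : R) : 0 < r -> r <= 2^-1 ->
  (normal_prob 0 (Num.sqrt 1) [set` `[(- r)%R, r]] <= (2^-1)%:E)%E.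
Proof.
move=> r0 r2; rewrite sqrtr1 /normal_prob.
apply: (@le_trans _ _ (\int[lebesgue_measure]_(x in [set` `[(- r)%R, r]]) (normal_peak (1 : R))%:E)%E).
  apply: ge0_le_integral => //.
  - by move=> x _; rewrite lee_fin normal_pdf_ge0.
  - apply: measurable_funTS; apply/measurable_EFinP; exact: measurable_normal_pdf.
  - by move=> x _; rewrite lee_fin normal_pdf_ub.
rewrite integral_cst //= lebesgue_measure_itv /= lte_fin.
have h2 : - r < r by rewrite (@lt_trans _ _ 0) // oppr_lt0.
rewrite h2 -EFinB -EFinM lee_fin opprK.
have p2 : 2 <= Num.sqrt (1 ^+ 2 * pi *+ 2 : R).
  have -> : 2 = Num.sqrt (2 ^+ 2) :> R by rewrite sqrtr_sqr gtr0_norm.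
  rewrite ler_sqrt expr1n mul1r; first by have := pi_ge2 R; lra.
  by rewrite mulrn_wge0 // pi_ge0.
have p3 : normal_peak (1 : R) <= 2^-1.
  by rewrite /normal_peak lef_pV2 ?posrE //; apply: lt_le_trans p2.
by have := normal_peak_ge0 (1 : R); nra.
Qed.

Lemma gauss0_setT : gauss 1 [set: 0.-tuple R] = 1%E.
Proof.
rewrite /gauss /= /gauss_density mul0r oppr0 powRr0 big_ord0 oppr0 mul0r expR0.
by rewrite indicT /= !mulr1.
Qed.

(* If |emb w| > 1 then {z : |emb (z *: w)| > 1/2} contains the complement of
   [-1/2, 1/2], whose normal probability is at least 1/2. *)
Lemma emb_unit_le1 n0 (w0 : n0.-tuple H) w :
  (forall (n : nat) (w : n.-tuple H), orthonormal_tuple ip w ->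
    (forall i j, ip (tnth w0 i) (tnth w j) = 0) ->
    (gauss 1 [set v : n.-tuple R |
       (2^-1 < `|emb (\sum_(i < n) tnth v i *: tnth w i)|)%R] < (2^-1)%:E)%E) ->
  ip w w = 1 -> (forall i, ip (tnth w0 i) w = 0) -> `|emb w| <= 1.
Proof.
move=> Hw w1 ww; rewrite leNgt; apply/negP => c1; set c := `|emb w| in c1.
have c0 : 0 < c := lt_trans ltr01 c1.
have t_on : orthonormal_tuple ip [tuple w] by move=> i j; rewrite !ord1.
have wt0 i j : ip (tnth w0 i) (tnth [tuple w] j) = 0 by rewrite ord1.
have := Hw 1%N [tuple w] t_on wt0.
pose r := (2 * c)^-1.
have r0 : 0 < r by rewrite invr_gt0 mulr_gt0.
have r2 : r <= 2^-1 by rewrite lef_pV2 ?posrE ?mulr_gt0 // ler_pMr // ltW.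
have -> : [set v : 1.-tuple R | 2^-1 < `|emb (\sum_(i < 1) tnth v i *: tnth [tuple w] i)|] =
    [set v | (~` [set` `[(- r)%R, r]]) (thead v) /\ [set: 0.-tuple R] [tuple of behead v]].
  apply/seteqP; split=> v /=; rewrite big_ord1 linearZ /= normrZ -/c in_itv /= -ler_norml.
    move=> h; split=> //; apply/negP; rewrite -ltNge.
    by rewrite /r invfM ltr_pdivrMr.
  by move=> [/negP]; rewrite -ltNge /r invfM ltr_pdivrMr.
rewrite gauss_cons ?gauss0_setT ?mule1 //; last exact: measurableC.
have := normal_prob_slab_le r0 r2.
set P := normal_prob _ _ _; set Q := normal_prob _ _ _.
have PQ : (Q = 1 - P)%E by exact: probability_setC.
have : P \is a fin_num by exact: fin_num_measure.
rewrite PQ; case: P {PQ} => // P _; rewrite lee_fin -EFinB lte_fin; lra.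
Qed.

(** Gross measurability at level 1/2 bounds [emb] on the orthogonal complement of a finite
    dimensional subspace; on that subspace the images of an orthonormal basis give the bound. *)
Lemma emb_bounded : exists C : R, forall x, `|emb x| <= C * `|x|.
Proof.
have [n0 [w0 [w0_on Hw]]] := emb_measurable (ltac:(by rewrite invr_gt0) : 0 < 2^-1).
exists (1 + \sum_(i < n0) `|emb (tnth w0 i)|) => x.
have on1 i : ip (tnth w0 i) (tnth w0 i) = 1 by rewrite w0_on eqxx.
have -> : x = (x - oproj ip w0 x) + oproj ip w0 x by rewrite subrK.
rewrite linearD /=; apply: le_trans (ler_normD _ _) _; rewrite subrK mulrDl mul1r; apply: lerD.
  set y := x - _.
  have yw i : ip (tnth w0 i) y = 0 by rewrite ipC (q_oproj ip_scalar).
  have yx : `|y| <= `|x|.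
    rewrite -ler_sqr ?nnegrE ?normr_ge0 // -!ip_norm.
    by have := defect_le ip_scalar ipC ip_lo w0_on x (linspan0 _); rewrite subr0.
  have [->|y0] := eqVneq y 0; first by rewrite linear0 normr0.
  have ny : 0 < `|y| by rewrite normr_gt0.
  apply: le_trans yx.
  have := @emb_unit_le1 n0 w0 (`|y|^-1 *: y) Hw.
  rewrite linearZ normrZ normfV normr_id ler_pdivrMl // mulr1; apply.
    by rewrite ip_norm normrZ normfV normr_id mulVf ?expr1n // gt_eqF.
  by move=> i; rewrite ipC (scalar_scale _ _ (ip_scalar _)) ipC yw mulr0.
rewrite /oproj linear_sum mulr_suml; apply: le_trans (ler_norm_sum _ _ _) _.
apply: ler_sum => i _; rewrite linearZ /= normrZ mulrC ler_wpM2l //.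
have := q_cauchy ipC ip_scalar ip_lo x (tnth w0 i).
rewrite on1 mulr1 ip_norm -[_ ^+ 2]real_normK ?num_real // ler_sqr ?nnegrE ?normr_ge0 //.
Qed.

End GrossNorm.

(** * The heat operator as a Gaussian average *)

Section HeatFormula.
Variables (R : realType) (H B : completeNormedModType R) (ip : H -> H -> R).
Variables (emb : {linear H -> B}) (mu : R -> probability (borel (B * B)%type) R).
Variables (J : countType) (e : J -> H) (eps : J -> R) (enJ : nat -> J) (Sw : R).
Hypothesis H_ip : inner_product ip.
Hypothesis H_separable : separable H.
Hypothesis emb_dense : dense (range emb).
Hypothesis emb_measurable : measurable_norm ip emb.
Hypothesis mu_gaussian : forall h, 0 < h -> gaussian_measure (ip2 ip) (emb2 emb) h (mu h).
Hypothesis e_basis : hilbert_basis ip e.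
Hypothesis e_dual : forall j, in_dual ip emb (e j).
Hypothesis eps_ge0 : forall j, 0 <= eps j.
Hypothesis enJ_bij : bijective enJ.
Local Notation en := (enK enJ).
Local Notation u := (dir e).
Local Notation w := (wt eps).
Local Notation q := (ip2 ip).
Hypothesis w_cvg : \sum_(i < n) w (en i) @[n --> \oo] --> Sw.

Lemma enum_dir_on i j : q (u (en i)) (u (en j)) = (i == j)%:R.
Proof. by rewrite (dir_on H_ip) ?(inj_eq (enK_inj enJ_bij)) //; case: e_basis. Qed.

Lemma enum_dir_dense : dense (linspan (range (u \o en))).
Proof.
have -> : range (u \o en) = range u.
  apply/seteqP; split=> _ [i _ <-]; first by exists (en i).
  by have [n <-] := enK_surj enJ_bij i; exists n.
by case: e_basis => _; exact: dir_dense.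
Qed.

Lemma emb2_bounded : exists C : R, forall x, `|emb2 emb x| <= C * `|x|.
Proof.
have [C eC] := emb_bounded H_ip emb_measurable; exists `|C| => x.
have le a : `|emb a| <= `|C| * `|a|.
  by apply: le_trans (eC a) _; rewrite ler_wpM2r ?ler_norm.
have -> : `|emb2 emb x| = Num.max `|emb x.1| `|emb x.2| by exact: prod_normE.
rewrite ge_max; apply/andP.
by split; apply: le_trans (le _) _; rewrite ler_wpM2l // prod_normE le_max lexx ?orbT.
Qed.

Lemma square_dense_sequence : exists D : nat -> B * B, dense (range D).
Proof.
have [d /denseP dd] := separable_sequence H_separable.
have [C0 eC0] := emb_bounded H_ip emb_measurable.
pose C := `|C0| + 1; have C_gt0 : 0 < C by rewrite ltr_wpDl.
have eC x : `|emb x| <= C * `|x|.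
  apply: le_trans (eC0 x) _; rewrite ler_wpM2r //.
  by apply: le_trans (ler_norm _) _; rewrite lerDl.
have approx (x : B) r : 0 < r -> exists n, `|x - emb (d n)| < r.
  move=> r0; have r2 : 0 < r / 2 by rewrite divr_gt0.
  have [_ [a _ <-] xa] := (denseP _).1 emb_dense x _ r2.
  have [_ [n _ <-] an] := dd a _ (divr_gt0 r2 C_gt0); exists n.
  have -> : x - emb (d n) = (x - emb a) + emb (a - d n) by rewrite linearB /= addrA subrK.
  apply: le_lt_trans (ler_normD _ _) _; rewrite [ltRHS]splitr; apply: ltrD => //.
  apply: le_lt_trans (eC _) _; rewrite mulrC -ltr_pdivlMr //.
exists (fun k => let p := odflt (0%N, 0%N) (choice.unpickle k : option (nat * nat)%type) in
  (emb (d p.1), emb (d p.2))).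
apply/denseP => -[x y] r r0; have [i xi] := approx x r r0; have [j yj] := approx y r r0.
exists (emb (d i), emb (d j)); first by exists (choice.pickle (i, j)) => //; rewrite choice.pickleK.
by rewrite prod_normE /= gt_max xi yj.
Qed.

(** Norming functionals of a dense sequence generate the Borel sets. Composed with the bounded map
    [emb2 emb] they are bounded forms on [H * H], so by Riesz they are dual elements, as
    quasi-invariance on cylinders demands. *)
Lemma heat_quasi_invariant t : 0 < t -> forall X (A : set (borel (B * B)%type)),
  measurable A -> mu t A = 0%E -> mu t [set x | A (x + emb2 emb X)] = 0%E.
Proof.
move=> t0.
have [D D_dense] := square_dense_sequence.
have [y y_norming] := choice (fun n => norming_functional (D n)).
have y_scalar n : scalar (y n) by case: (y_norming n).
have y_le n x : `|y n x| <= `|x| by case: (y_norming n).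
have [C eC] := emb2_bounded.
have yb n : exists b, dual_elt q (emb2 emb) (y n) b.
  have fl : scalar (fun x => y n (emb2 emb x)).
    move=> a x z; rewrite -(y_scalar n); congr (y n _).
    by rewrite /emb2 /= !linearP.
  have [|b bE] := riesz (ip2C H_ip) (ip2_scalar H_ip) (ip2_lo H_ip) (ip2_hi H_ip)
    enum_dir_on enum_dir_dense (@complete_seq_pair R H) fl (C := C).
    by move=> x; apply: le_trans (y_le _ _) (eC x).
  exists b; split=> // [|x].
    by apply: (@bounded_scalar_continuous _ _ _ 1) => // x; rewrite mul1r.
  by rewrite bE (ip2C H_ip).
have [b dy] := choice yb.
apply: (quasi_invariance t0 (mu_gaussian t0) (ip2_scalar H_ip) (ip2C H_ip) (ip2_lo H_ip)
  (emb2_dense emb_dense) dy).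
apply: (borel_generated D_dense y_scalar y_le) => n; by case: (y_norming n).
Qed.

(** For [t > 0] both members are limits of the same finite dimensional means, one by [heat_navg_cvg]
    and the other by [navg_cvg]. *)
Lemma heatE t m F : 0 <= t -> symbol e eps m.+1 F ->
  heat ip emb mu t F = (fun X => heatr u en t (cRe F) X +i* heatr u en t (cIm F) X).
Proof.
rewrite le_eqVlt => /predU1P[<-|t0] /symbolP [M [Fr Fi]].
  by rewrite /heat eqxx !heatr0; apply/funext => X; rewrite -complex_eta.
have Y_ex i : exists Y, dual_elt q (emb2 emb) Y (u (en i)).
  exact: (dir_dual (emb := emb) H_ip e_dual).
have [Y Y_dual] := choice Y_ex.
have qC := ip2C H_ip; have qs := ip2_scalar H_ip; have ql := ip2_lo H_ip; have qh := ip2_hi H_ip.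
have on := enum_dir_on; have dn := enum_dir_dense.
have w0 := wt_ge0 eps_ge0; have ws := enK_surj enJ_bij.
have w0n i : 0 <= (w \o en) i by exact: w0.
have Fr1 : rsymb u w 1 M (cRe F) by apply: leq_rsymb Fr.
have Fi1 : rsymb u w 1 M (cIm F) by apply: leq_rsymb Fi.
have sr := rsymb_slow qC qs ql qh on dn Fr1.
have si := rsymb_slow qC qs ql qh on dn Fi1.
have Br := rsymb_BL qC qs ql qh on dn ws w0 w_cvg Fr1.
have Bi := rsymb_BL qC qs ql qh on dn ws w0 w_cvg Fi1.
have w_ser : cvgn (series (w \o en)).
  apply/cvg_ex; exists Sw; rewrite (_ : series _ = (fun n => \sum_(i < n) w (en i))) //.
  by apply/funext => n; rewrite /series /= big_mkord.
have [[mr mi] _] := the_stoch_ext_cext t0 (mu_gaussian t0) qs qC ql qh (emb2_dense emb_dense)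
  on dn Y_dual w0n w_cvg sr si.
have lim f (ff : R[i] -> R) (X : H * H) : BL u w f ->
    measurable_fun setT (fun x : borel (B * B)%type => ff (the_stoch_ext q (emb2 emb) (mu t) F x)) ->
    (forall x : borel (B * B)%type, good Y (w \o en) x ->
       f (gsum (u \o en) Y n x) @[n --> \oo] --> ff (cext (u \o en) Y F x)) ->
    \int[mu t]_x ff (the_stoch_ext q (emb2 emb) (mu t) F (emb2 emb X + x)) = heatr u en t f X.
  move=> Bf mf gf.
  have c1 := heat_navg_cvg t0 (mu_gaussian t0) qs qC ql qh (emb2_dense emb_dense)
    on dn Y_dual w0n w_cvg sr si (heat_quasi_invariant t0) (BL_enum en Bf) mf gf (X := X).
  have c2 := navg_cvg w_ser (b := Num.sqrt t) (x := X) Bf.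
  have E : (fun n => navg (fun i => u (en i)) id n (Num.sqrt t) f X) =
      (fun n => navg u en n (Num.sqrt t) f X) by apply/funext => n; rewrite -navg_enum.
  rewrite E in c1; exact: (cvg_unique _ c1 c2).
apply/funext => X; rewrite /heat gt_eqF // /heat_integral /cintegral; congr (_ +i* _).
  apply: (lim (cRe F) (@complex.Re R)) => // x gx.
  exact: (ext_cvg qs on w0n sr gx).
apply: (lim (cIm F) (@complex.Im R)) => // x gx.
exact: (ext_cvg qs on w0n si gx).
Qed.

End HeatFormula.

(** * Heat and Laplace operators on symbols *)

Lemma cvg0_linear_bound (R : realType) (F : set_system R) (FF : Filter F) (t : R) (g : R -> R) (K : R) :
  F --> t -> (\forall s \near F, 0 <= g s <= K * `|s - t|) -> g s @[s --> F] --> (0 : R).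
Proof.
move=> Ft gK; apply: (@squeeze_cvgr _ _ _ _ (fun=> 0) _ _ gK); first exact: cvg_cst.
have c : K * `|s - t| @[s --> t] --> K * `|t - t|.
  apply: cvgM; first exact: cvg_cst.
  by apply: cvg_norm; apply: cvgB; [exact: cvg_id | exact: cvg_cst].
rewrite subrr normr0 mulr0 in c.
exact: (cvg_trans (cvg_app _ Ft) c).
Qed.

Section Operators.
Variables (R : realType) (H B : completeNormedModType R) (ip : H -> H -> R).
Variables (emb : {linear H -> B}) (mu : R -> probability (borel (B * B)%type) R).
Variables (J : countType) (e : J -> H) (eps : J -> R) (enJ : nat -> J) (Sw S : R).
Hypothesis H_ip : inner_product ip.
Hypothesis H_separable : separable H.
Hypothesis emb_dense : dense (range emb).
Hypothesis emb_measurable : measurable_norm ip emb.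
Hypothesis mu_gaussian : forall h, 0 < h -> gaussian_measure (ip2 ip) (emb2 emb) h (mu h).
Hypothesis e_basis : hilbert_basis ip e.
Hypothesis e_dual : forall j, in_dual ip emb (e j).
Hypothesis eps_ge0 : forall j, 0 <= eps j.
Hypothesis enJ_bij : bijective enJ.
Local Notation en := (enK enJ).
Local Notation u := (dir e).
Local Notation w := (wt eps).
Local Notation W := (H * H)%type.
Hypothesis w_cvg : \sum_(i < n) w (en i) @[n --> \oo] --> Sw.
Hypothesis nsq_cvg : nsq w en n @[n --> \oo] --> S.
Implicit Types (F G : W -> R[i]) (f : W -> R).

Let qC := ip2C H_ip.
Let q_scalar := ip2_scalar H_ip.
Let q_lo := ip2_lo H_ip.
Let q_hi := ip2_hi H_ip.
Let u_on := enum_dir_on H_ip e_basis enJ_bij.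
Let u_dense := enum_dir_dense e_basis enJ_bij.
Let en_surj := enK_surj enJ_bij.
Let w_ge0 := wt_ge0 eps_ge0.
Local Notation heatR := (heatr u en).
Local Notation laplR := (lapl u en).

Lemma S_ge0 : 0 <= S.
Proof. by have := nsq_le nsq_cvg 0; rewrite /nsq big_ord0. Qed.

Lemma symbol_leq m m' F : (m' <= m)%N -> symbol e eps m F -> symbol e eps m' F.
Proof.
by move=> mm /symbolP [M [Fr Fi]]; apply/symbolP; exists M; split; apply: leq_rsymb mm _.
Qed.

Let heat_eq t m F : 0 <= t -> symbol e eps m.+1 F ->
  heat ip emb mu t F = (fun X => heatR t (cRe F) X +i* heatR t (cIm F) X).
Proof.
exact: (heatE H_ip H_separable emb_dense emb_measurable mu_gaussian e_basis e_dual eps_ge0 enJ_bij w_cvg).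
Qed.

Let lapl_eq m F : symbol e eps (m + 2) F ->
  laplace e F = (fun X => laplR (cRe F) X +i* laplR (cIm F) X).
Proof. by move=> Fs; apply: (laplaceE enJ_bij nsq_cvg); apply: symbol_leq Fs; rewrite leq_addl. Qed.

Let rheat t m M f : rsymb u w m.+1 M f -> rsymb u w m M (heatR t f).
Proof. exact: (rsymb_heatr qC q_scalar q_lo q_hi u_on u_dense en_surj w_ge0 w_cvg). Qed.

Let rlapl m M f : rsymb u w (m + 2) M f -> rsymb u w m (M * S) (laplR f).
Proof. exact: (rsymb_lapl w_ge0 nsq_cvg). Qed.

Let cRe_pair f g : cRe (fun X => f X +i* g X) = f. Proof. by apply/funext. Qed.

Let cIm_pair f g : cIm (fun X => f X +i* g X) = g. Proof. by apply/funext. Qed.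

Let pair_sub (a b c d : W -> R) : (fun X => a X +i* b X) \- (fun X => c X +i* d X) =
  (fun X => (-1 * c X + a X) +i* (-1 * d X + b X)).
Proof.
by apply/funext => X; rewrite -[LHS]/((a X - c X) +i* (b X - d X)); congr (_ +i* _); ring.
Qed.

Let cRe_sub F G : cRe (F \- G) = fun X => -1 * cRe G X + cRe F X.
Proof. by apply/funext => X; rewrite /cRe /=; case: (F X) (G X) => [a b] [c d] /=; ring. Qed.

Let cIm_sub F G : cIm (F \- G) = fun X => -1 * cIm G X + cIm F X.
Proof. by apply/funext => X; rewrite /cIm /=; case: (F X) (G X) => [a b] [c d] /=; ring. Qed.

Lemma heat_symbol t m F : 0 <= t -> symbol e eps m.+1 F -> symbol e eps m (heat ip emb mu t F).
Proof.
move=> t0 Fs; rewrite (heat_eq t0 Fs); have [M [Fr Fi]] := (symbolP e eps _ F).1 Fs.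
by apply/symbolP; exists M; split; exact: rheat.
Qed.

Lemma laplace_symbol m F : symbol e eps (m + 2) F -> symbol e eps m (laplace e F).
Proof.
move=> Fs; rewrite (lapl_eq Fs); have [M [Fr Fi]] := (symbolP e eps _ F).1 Fs.
by apply/symbolP; exists (M * S); split; exact: rlapl.
Qed.

Lemma heat_sub t m F G : 0 <= t -> symbol e eps m.+1 F -> symbol e eps m.+1 G ->
  heat ip emb mu t F \- heat ip emb mu t G = heat ip emb mu t (F \- G).
Proof.
move=> t0 Fs Gs; rewrite (heat_eq t0 Fs) (heat_eq t0 Gs) (heat_eq t0 (symbol_sub Fs Gs)).
have [M [Fr Fi]] := (symbolP e eps _ F).1 Fs; have [M' [Gr Gi]] := (symbolP e eps _ G).1 Gs.
have lin := heatr_lin qC q_scalar q_lo q_hi u_on u_dense en_surj w_ge0 w_cvg t (-1).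
rewrite cRe_sub cIm_sub (lin _ _ _ _ _ Gr Fr) (lin _ _ _ _ _ Gi Fi).
exact: pair_sub.
Qed.

Lemma laplace_sub m F G : symbol e eps (m + 2) F -> symbol e eps (m + 2) G ->
  laplace e F \- laplace e G = laplace e (F \- G).
Proof.
move=> Fs Gs; rewrite (lapl_eq Fs) (lapl_eq Gs) (lapl_eq (symbol_sub Fs Gs)).
have Fs2 : symbol e eps 2 F by apply: symbol_leq Fs; rewrite leq_addl.
have Gs2 : symbol e eps 2 G by apply: symbol_leq Gs; rewrite leq_addl.
have [M [Fr Fi]] := (symbolP e eps _ F).1 Fs2; have [M' [Gr Gi]] := (symbolP e eps _ G).1 Gs2.
have lin := @lapl_lin _ _ _ u w en _ nsq_cvg (-1).
rewrite cRe_sub cIm_sub (lin _ _ _ _ Gr Fr) (lin _ _ _ _ Gi Fi).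
exact: pair_sub.
Qed.

Lemma heat_continuous t m : 0 <= t -> continuous_operator e eps m.+1 m (heat ip emb mu t).
Proof.
move=> t0; split=> [F|F0 F0s eta eta0]; first exact: heat_symbol.
exists (eta / 2); first exact: divr_gt0.
move=> F Fs /(symbol_norm_lt (symbol_sub Fs F0s)) [M [Md [Mr Mi]]].
rewrite (heat_sub t0 Fs F0s) (heat_eq t0 (symbol_sub Fs F0s)).
have /andP[_] := symbol_norm_le (F := fun X => heatR t (cRe (F \- F0)) X +i* heatR t (cIm (F \- F0)) X)
  (@rheat t _ _ _ Mr) (@rheat t _ _ _ Mi).
by move/le_lt_trans; apply; rewrite mulrC -ltr_pdivlMr.
Qed.

Lemma laplace_continuous m : continuous_operator e eps (m + 2) m (laplace e).
Proof.
split=> [F|F0 F0s eta eta0]; first exact: laplace_symbol.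
(* [S] vanishes when all weights do; [S + 1] keeps the quotient defining the radius meaningful. *)
have S1 : 0 < S + 1 by have := S_ge0; lra.
have S2 : 0 < 2 * (S + 1) by rewrite mulr_gt0.
exists (eta / (2 * (S + 1))); first exact: divr_gt0.
move=> F Fs /(symbol_norm_lt (symbol_sub Fs F0s)) [M [Md [Mr Mi]]].
rewrite (laplace_sub Fs F0s) (lapl_eq (symbol_sub Fs F0s)).
have /andP[_] := symbol_norm_le (F := fun X => laplR (cRe (F \- F0)) X +i* laplR (cIm (F \- F0)) X)
  (rlapl Mr) (rlapl Mi).
move/le_lt_trans; apply; have M0 := rsymb_M_ge0 Mr.
move: Md; rewrite ltr_pdivlMr //; apply: le_lt_trans.
by have := S_ge0; nra.
Qed.

Lemma laplace_heat t m F : 0 <= t -> symbol e eps (m + 3) F ->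
  laplace e (heat ip emb mu t F) = heat ip emb mu t (laplace e F).
Proof.
move=> t0 Fs.
have F1 : symbol e eps (m + 2).+1 F by rewrite -addnS.
have F2 : symbol e eps (m.+1 + 2) F by rewrite addSn -addnS.
rewrite (lapl_eq (heat_symbol t0 F1)) (heat_eq t0 (laplace_symbol F2)).
rewrite (heat_eq t0 F1) (lapl_eq F2).
have F3 : symbol e eps 3 F by apply: symbol_leq Fs; rewrite leq_addl.
have [M [Fr Fi]] := (symbolP e eps _ F).1 F3.
have comm := lapl_heatr qC q_scalar q_lo q_hi u_on u_dense en_surj w_ge0 w_cvg nsq_cvg t.
by rewrite !cRe_pair !cIm_pair (comm _ _ Fr) (comm _ _ Fi).
Qed.

Lemma half_complex : (2^-1 : R[i]) = (2^-1 : R)%:C.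
Proof. by rewrite fmorphV rmorph_nat. Qed.

Lemma half_symbol m F : symbol e eps m F -> symbol e eps m (fun X => 2^-1 * F X).
Proof.
move=> Fs; have := symbol_lin (2^-1) 0 Fs Fs; congr symbol; apply/funext => X.
by rewrite half_complex mul0r addr0.
Qed.

(** Both norms are squeezed by multiples of [|s - t|], valid for all [s >= 0] including at [t = 0]:
    the quotient by the second order estimate for [F], the derivative by the first order estimate
    for its Laplacian. *)
Lemma heat_C1 m F : symbol e eps (m + 6) F ->
  C1_halfline e eps m (fun t => heat ip emb mu t F)
    (fun t X => 2^-1 * heat ip emb mu t (laplace e F) X).
Proof.
move=> Fs.
have F1 : symbol e eps m.+1 F by apply: symbol_leq Fs; rewrite -addn1 leq_add2l.
have F2 : symbol e eps (m.+1 + 2) F.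
  by apply: symbol_leq Fs; rewrite addSn -addnS leq_add2l.
have LF : symbol e eps m.+1 (laplace e F) by exact: laplace_symbol.
split=> [t t0|t t0].
  by split; [exact: heat_symbol | apply: half_symbol; exact: heat_symbol].
have [M [Fr Fi]] := (symbolP e eps _ F).1 Fs.
have [L [Lr Li]] := (symbolP e eps _ _).1 LF.
have LFr : cRe (laplace e F) = laplR (cRe F) := etrans (congr1 (@cRe _ _) (lapl_eq F2)) (cRe_pair _ _).
have LFi : cIm (laplace e F) = laplR (cIm F) := etrans (congr1 (@cIm _ _) (lapl_eq F2)) (cIm_pair _ _).
have Lr3 f : rsymb u w (m + 6) M f -> rsymb u w (m + 3) (M * S) (laplR f).
  by move=> Mf; apply: rlapl; apply: leq_rsymb Mf; rewrite -addnA leq_add2l.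
have halfE (a b : R) : 2^-1 * (a +i* b) = (2^-1 * a) +i* (2^-1 * b) :> R[i].
  by rewrite half_complex; simpc.
have hsub (a b c d : R) :
    complex.Re (2^-1 * (a +i* b) - 2^-1 * (c +i* d) : R[i]) = 2^-1 * (a - c) /\
    complex.Im (2^-1 * (a +i* b) - 2^-1 * (c +i* d) : R[i]) = 2^-1 * (b - d).
  by rewrite !halfE /=; split; ring.
have quot s f : 0 <= s -> s != t -> rsymb u w (m + 6) M f ->
    rsymb u w m (`|s - t| * (M * S ^+ 2))
      (fun X => (s - t)^-1 * (heatR s f X - heatR t f X) - 2^-1 * heatR t (laplR f) X).
  move=> s0 st; exact: (rsymb_heatr_quotient qC q_scalar q_lo q_hi u_on u_dense en_surj w_ge0
    w_cvg nsq_cvg t0 s0 st).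
have dist s f : 0 <= s -> rsymb u w (m + 6) M f ->
    rsymb u w m (`|s - t| * (M * S * S))
      (fun X => 2^-1 * (heatR s (laplR f) X - heatR t (laplR f) X)).
  move=> s0 /Lr3 Lf.
  have D := rsymb_heatr_dist qC q_scalar q_lo q_hi u_on u_dense en_surj w_ge0 w_cvg nsq_cvg t0 s0 Lf.
  have := rsymb_lin (2^-1) 0 D D; rewrite normr0 mul0r addr0 => D2.
  have D0 := rsymb_M_ge0 D.
  have -> : (fun X => 2^-1 * (heatR s (laplR f) X - heatR t (laplR f) X)) =
    (fun X => 2^-1 * (heatR s (laplR f) X - heatR t (laplR f) X) +
      0 * (heatR s (laplR f) X - heatR t (laplR f) X)).
    by apply/funext => X; rewrite mul0r addr0.
  apply: (rsymb_le eps_ge0 _ D2); rewrite ger0_norm ?invr_ge0 //; nra.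
split.
  have all s : s != t -> 0 <= s -> 0 <= symbol_norm e eps m (fun X => ((s - t)^-1)%:C *
      (heat ip emb mu s F X - heat ip emb mu t F X) -
      2^-1 * heat ip emb mu t (laplace e F) X) <= 2 * (M * S ^+ 2) * `|s - t|.
    move=> st s0; rewrite (heat_eq s0 F1) (heat_eq t0 F1) (heat_eq t0 LF) LFr LFi.
    rewrite -mulrA [_ * `|_|]mulrC.
    have := quot s _ s0 st Fr; have := quot s _ s0 st Fi.
    move=> Qi Qr; apply: symbol_norm_le.
      move: Qr; congr rsymb; apply/funext => X; rewrite /cRe halfE; by simpc.
    move: Qi; congr rsymb; apply/funext => X; rewrite /cIm halfE; by simpc.
  apply: (@cvg0_linear_bound _ _ _ t _ (2 * (M * S ^+ 2))).
    apply: cvg_trans; [exact: cvg_within | exact: cvg_within].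
  by rewrite near_withinE near_withinE; apply: nearW => s st s0; exact: all.
have all s : 0 <= s -> 0 <= symbol_norm e eps m
    ((fun X => 2^-1 * heat ip emb mu s (laplace e F) X) \-
     (fun X => 2^-1 * heat ip emb mu t (laplace e F) X)) <= 2 * (M * S * S) * `|s - t|.
  move=> s0; rewrite (heat_eq s0 LF) (heat_eq t0 LF) LFr LFi.
  rewrite -mulrA [_ * `|_|]mulrC.
  have := dist s _ s0 Fr; have := dist s _ s0 Fi => Qi Qr; apply: symbol_norm_le.
    move: Qr; congr rsymb; apply/funext => X; symmetry; exact: (hsub _ _ _ _).1.
  move: Qi; congr rsymb; apply/funext => X; symmetry; exact: (hsub _ _ _ _).2.
apply: (@cvg0_linear_bound _ _ _ t _ (2 * (M * S * S))); first exact: cvg_within.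
by rewrite near_withinE; apply: nearW => s s0; exact: all.
Qed.

End Operators.

Theorem theorem5p9 (R : realType) (H B : completeNormedModType R)
  (ip : H -> H -> R) (emb : {linear H -> B})
  (mu : R -> probability (borel (B * B)%type) R)
  (J : countType) (e : J -> H) (eps : J -> R)
  (H_hilbert : inner_product ip)
  (H_separable : separable H)
  (H_infinite_dim : infinite_dim H)
  (emb_injective : injective emb)
  (emb_dense : dense (range emb))
  (emb_measurable_norm : measurable_norm ip emb)
  (mu_gaussian : forall h, 0 < h ->
     gaussian_measure (ip2 ip) (emb2 emb) h (mu h))
  (e_hilbert_basis : hilbert_basis ip e)
  (e_dual : forall j, in_dual ip emb (e j))
  (eps_ge0 : forall j, 0 <= eps j)
  (eps_summable : summable setT (EFin \o eps)) :
  [/\ (forall (m : nat) (t : R), (1 <= m)%N -> 0 < t ->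
         continuous_operator e eps m (m - 1)%N (heat ip emb mu t)) /\
      (forall m : nat, (2 <= m)%N ->
         continuous_operator e eps m (m - 2)%N (laplace e)),
      forall (m : nat) (t : R) (F : H * H -> R[i]), (3 <= m)%N -> 0 < t ->
        symbol e eps m F ->
        laplace e (heat ip emb mu t F) = heat ip emb mu t (laplace e F) /\
        symbol e eps (m - 3)%N (laplace e (heat ip emb mu t F)) &
      forall (m : nat) (F : H * H -> R[i]), (6 <= m)%N ->
        symbol e eps m F ->
        C1_halfline e eps (m - 6)%N
          (fun t => heat ip emb mu t F)
          (fun t X => 2^-1 * heat ip emb mu t (laplace e F) X)].
Proof.
have [enJ enJ_bij] := hilbert_basis_enum H_hilbert H_infinite_dim e_hilbert_basis.
have [Sw w_cvg] := weights_cvg eps_ge0 eps_summable enJ_bij.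
have [S nsq_cvg] := squares_cvg eps_ge0 eps_summable enJ_bij.
have hc := @heat_continuous R H B ip emb mu J e eps enJ Sw H_hilbert H_separable emb_dense
  emb_measurable_norm mu_gaussian e_hilbert_basis e_dual eps_ge0 enJ_bij w_cvg.
have lc := @laplace_continuous R H J e eps enJ S eps_ge0 enJ_bij nsq_cvg.
have lh := @laplace_heat R H B ip emb mu J e eps enJ Sw S H_hilbert H_separable emb_dense
  emb_measurable_norm mu_gaussian e_hilbert_basis e_dual eps_ge0 enJ_bij w_cvg nsq_cvg.
have hs := @heat_symbol R H B ip emb mu J e eps enJ Sw H_hilbert H_separable emb_dense
  emb_measurable_norm mu_gaussian e_hilbert_basis e_dual eps_ge0 enJ_bij w_cvg.
split; first split.
- by move=> [//|m] t _ t0; rewrite subn1; apply: hc; exact: ltW.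
- by move=> m m2; rewrite -{1}(subnK m2); exact: lc.
- move=> m t F m3 t0 Fs; move: Fs; rewrite -{1}(subnK m3) => Fs.
  split; first by apply: (lh _ _ _ (ltW t0) Fs).
  apply: (laplace_symbol eps_ge0 enJ_bij nsq_cvg); apply: (hs _ _ _ (ltW t0)).
  by rewrite -addnS.
move=> m F m6; rewrite -{1}(subnK m6) => Fs.
exact: (heat_C1 H_hilbert H_separable emb_dense emb_measurable_norm mu_gaussian e_hilbert_basis
  e_dual eps_ge0 enJ_bij w_cvg nsq_cvg).
Qed.
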